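(* Let $T\in\mathcal L(L^2(\mathbb R^2))$ be an operator associated with a $CZX$ kernel $K$. Then $$\|[b,T]f\|_{L^p}\lesssim\|b\|_{\mathrm{BMO}}\|f\|_{L^p}$$ whenever $p\in(1,\infty)$, where $[b,T]f:=bTf-T(bf)$ and the implied constant does not depend on $b$ or $f$.
   Context: Write points of $\mathbb R^2$ as $x=(x^1,x^2)$. For $\theta_2\in(0,1]$ and $x^1\ne y^1$, $x^2\ne y^2$ put $$D_{\theta_2}(x,y):=\Big(\frac{|x^1-y^1|}{|x^2-y^2|}+\frac{|x^2-y^2|}{|x^1-y^1|}\Big)^{-\theta_2}.$$ A function $K:\{(x,y)\in\mathbb R^2\times\mathbb R^2: x^1\neq y^1 \text{ and } x^2\ne y^2\}\to\mathbb C$ is a $CZX$ kernel if for some parameters $\theta_1,\theta_2\in(0,1]$ there is a constant $C_K$ such that (a) size: $|K(x,y)|\le C_K\frac{1}{|x^1-y^1|}\frac1{|x^2-y^2|}D_{\theta_2}(x,y)$; (b) mixed Hölder and size: $|K(x,y)-K((w^1,x^2),y)|\le C_K\frac{|x^1-w^1|^{\theta_1}}{|x^1-y^1|^{1+\theta_1}}\frac1{|x^2-y^2|}D_{\theta_2}(x,y)$ whenever $|x^1-w^1|\le|x^1-y^1|/2$, and $|K(x,y)-K((x^1,w^2),y)|\le C_K\frac{1}{|x^1-y^1|}\frac{|x^2-w^2|^{\theta_1}}{|x^2-y^2|^{1+\theta_1}}D_{\theta_2}(x,y)$ whenever $|x^2-w^2|\le|x^2-y^2|/2$; (c) the two estimates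 in (b) also hold for the kernel $(x,y)\mapsto K(y,x)$. $T\in\mathcal L(L^2(\mathbb R^2))$ (a bounded linear operator on $L^2(\mathbb R^2)$) is associated with $K$ if $\langle Tf,g\rangle=\iint K(x,y)f(y)g(x)\,dx\,dy$ whenever $f,g$ are finite linear combinations of indicators of cubes with $\{f\ne0\}\cap\{g\neq0\}=\varnothing$, where $\langle f,g\rangle=\int fg$. Cubes in $\mathbb R^2$ are axes-parallel squares. $\|b\|_{\mathrm{BMO}}=\sup_I\frac1{|I|}\int_I|b-\langle b\rangle_I|$, supremum over all cubes $I\subset\mathbb R^2$, $\langle b\rangle_I=\frac1{|I|}\int_Ib$. *)

(* Defs.v *)
From HB Require Import structures.
From mathcomp Require Import all_boot all_order all_algebra.
From mathcomp Require Import complex.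
From mathcomp Require Import all_classical all_reals all_analysis.

Set Implicit Arguments.
Unset Strict Implicit.
Unset Printing Implicit Defensive.

Import Order.TTheory GRing.Theory Num.Theory.
Import Normc.

Local Open Scope classical_set_scope.
Local Open Scope ring_scope.
Local Open Scope complex_scope.

Notation plane R := (measurableTypeR R * measurableTypeR R)%type.

(* Lebesgue measure on the Borel sets of the plane; all functions below are
   Borel representatives of their almost-everywhere classes. *)
Definition area (R : realType) : set (plane R) -> \bar R :=
  (@lebesgue_measure R \x @lebesgue_measure R)%E.

Arguments area : clear implicits.

HB.instance Definition _ (R : realType) := Measure.on (area R).

Lemma area_sigma_finite (R : realType) : sigma_finite setT (area R).
Proof.
have /sigma_finiteP[F [TF ndF Foo]] :=
  sigma_finiteT (@lebesgue_measure R :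
    {sigma_finite_measure set (measurableTypeR R) -> \bar R}).
exists (fun n => F n `*` F n).
  rewrite -setXTT TF predeqE => -[x y]; split.
    move=> [/= [n _ Fnx] [k _ Fky]]; exists (maxn n k) => //; split.
    - by move: x Fnx; exact/subsetPset/ndF/leq_maxl.
    - by move: y Fky; exact/subsetPset/ndF/leq_maxr.
  by move=> [n _ []/= ? ?]; split; exists n.
move=> k; have [mF Fk] := Foo k; split; first exact: measurableX.
by rewrite /area product_measure1E// lte_mul_pinfty// ge0_fin_numE.
Qed.

HB.instance Definition _ (R : realType) :=
  Measure_isSigmaFinite.Build _ _ _ (area R) (area_sigma_finite R).

Section complex_valued_functions.
Context (R : realType) d (X : measurableType d).

Definition cmeasurable (f : X -> R[i]) : Prop :=
  measurable_fun setT (fun x => complex.Re (f x)) /\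
  measurable_fun setT (fun x => complex.Im (f x)).

Definition cintegral (mu : {measure set X -> \bar R}) (D : set X)
    (f : X -> R[i]) : R[i] :=
  (\int[mu]_(x in D) complex.Re (f x)) +i* (\int[mu]_(x in D) complex.Im (f x)).

End complex_valued_functions.

Section plane_notions.
Context (R : realType).
Implicit Types (f g b : plane R -> R[i]) (p : R).

Definition ae_equal f g : Prop := {ae area R, forall x, f x = g x}.

Definition Lpnorm p f : \bar R := 
  Lnorm (area R) p%:E (fun x => (normc (f x))%:E).

Definition Lp p f : Prop := cmeasurable f /\ (Lpnorm p f < +oo)%E.

(* An operator on equivalence classes is given by its action on
   representatives, so linearity is only required almost everywhere. For a
   bounded operator this already forces [f = g] a.e. to imply [T f = T g] a.e. *)
Definition Lp_linear p (T : (plane R -> R[i]) -> plane R -> R[i]) : Prop :=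
  (forall f, Lp p f -> Lp p (T f)) /\
  (forall (c : R[i]) f g, Lp p f -> Lp p g ->
     ae_equal (T (fun x => c * f x + g x)) (fun x => c * T f x + T g x)).

Definition L2_bounded (T : (plane R -> R[i]) -> plane R -> R[i]) : Prop :=
  Lp_linear 2 T /\
  exists M : R, forall f, Lp 2 f -> (Lpnorm 2 (T f) <= M%:E * Lpnorm 2 f)%E.

(* The square with lower left corner [a] and side [l]. Taking it half-open is
   immaterial: boundaries are null sets, and two half-open step functions with
   essentially disjoint supports have disjoint supports. *)
Definition square (a : plane R) (l : R) : set (plane R) :=
  `[a.1, a.1 + l[%classic `*` `[a.2, a.2 + l[%classic.

Definition average b (Q : set (plane R)) : R[i] :=
  ((fine (area R Q))^-1)%:C * cintegral (area R) Q b.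

Definition mean_oscillation b (Q : set (plane R)) : \bar R :=
  (((fine (area R Q))^-1)%:E *
     \int[area R]_(x in Q) (normc (b x - average b Q))%:E)%E.

Definition BMO_norm b : \bar R :=
  ereal_sup [set mean_oscillation b (square al.1 al.2) |
             al in [set al : plane R * R | 0 < al.2]].

Definition L1_loc b : Prop :=
  cmeasurable b /\
  forall a l, 0 < l ->
    (area R).-integrable (square a l) (fun x => (normc (b x))%:E).

Definition BMO b : Prop := L1_loc b /\ (BMO_norm b < +oo)%E.

Definition square_step f : Prop :=
  exists s : seq (R[i] * (plane R * R)),
    (forall q, q \in s -> 0 < q.2.2) /\
    forall x, f x = \sum_(q <- s) q.1 * (\1_(square q.2.1 q.2.2) x)%:C.

Definition off_axes (x y : plane R) : Prop := x.1 != y.1 /\ x.2 != y.2.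

Definition decay (theta2 : R) (x y : plane R) : R :=
  (`|x.1 - y.1| / `|x.2 - y.2| + `|x.2 - y.2| / `|x.1 - y.1|) `^ (- theta2).

Implicit Type K : plane R -> plane R -> R[i].

Definition size_bound (theta2 CK : R) K : Prop :=
  forall x y, off_axes x y ->
    normc (K x y) <=
      CK * (1 / `|x.1 - y.1|) * (1 / `|x.2 - y.2|) * decay theta2 x y.

Definition mixed_bound (theta1 theta2 CK : R) K : Prop :=
  (forall x y (w1 : R), off_axes x y -> `|x.1 - w1| <= `|x.1 - y.1| / 2 ->
    normc (K x y - K (w1, x.2) y) <=
      CK * (`|x.1 - w1| `^ theta1 / `|x.1 - y.1| `^ (1 + theta1)) *
        (1 / `|x.2 - y.2|) * decay theta2 x y) /\
  (forall x y (w2 : R), off_axes x y -> `|x.2 - w2| <= `|x.2 - y.2| / 2 ->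
    normc (K x y - K (x.1, w2) y) <=
      CK * (1 / `|x.1 - y.1|) *
        (`|x.2 - w2| `^ theta1 / `|x.2 - y.2| `^ (1 + theta1)) *
        decay theta2 x y).

(* Kernels are total functions, but their values are only ever used at pairs
   of points satisfying [off_axes]. *)
Definition CZX_kernel K : Prop :=
  exists theta1 theta2 CK : R,
    [/\ 0 < theta1 <= 1, 0 < theta2 <= 1, size_bound theta2 CK K,
        mixed_bound theta1 theta2 CK K &
        mixed_bound theta1 theta2 CK (fun x y => K y x)].

Definition pairing f g : R[i] :=
  cintegral (area R) setT (fun x => f x * g x).

Definition associated (T : (plane R -> R[i]) -> plane R -> R[i]) K : Prop :=
  forall f g, square_step f -> square_step g ->
    [set x | f x != 0] `&` [set x | g x != 0] = set0 ->
    pairing (T f) g =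
      cintegral (area R \x area R)%E [set xy | off_axes xy.1 xy.2]
        (fun xy => K xy.1 xy.2 * f xy.2 * g xy.1).

Definition commutator b (T : (plane R -> R[i]) -> plane R -> R[i]) f :
    plane R -> R[i] :=
  fun x => b x * T f x - T (fun y => b y * f y) x.

(* For [f] in L^p and unbounded [b] the products defining the commutator need
   not lie in the domain of [T]. So [S] represents [b, T] on L^p if it is linear
   on L^p and given by the defining formula whenever that formula only involves
   values of [T] on L^2. Such [f] are dense in L^p (cut off to a ball on which
   |f| and |b| are bounded), so a bounded such [S] is unique. *)
Definition is_commutator p b (T S : (plane R -> R[i]) -> plane R -> R[i]) :
    Prop :=
  Lp_linear p S /\
  forall f, Lp p f -> Lp 2 f -> Lp 2 (fun x => b x * f x) ->
    ae_equal (S f) (commutator b T f).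

End plane_notions.

(* Main.v *)
(** By duality it is enough to bound the trilinear form <[b,T]f, g> for bounded
    functions [b], [f], [g] on a large square, with a constant depending only on
    T and p; truncation is Lipschitz, so it does not increase BMO norms. Cut the
    square into a grid and test T on the cells: the real and imaginary parts of
    the matrix entries <T 1_Q, 1_P> / |P| form a discrete operator that is bounded
    on l^2 because T is bounded on L^2. On a dyadic square of side l, at
    coordinate distances d1 and d2 from an index, the rows and columns of the
    matrix oscillate like the product weight (l/(l+d1))^(1+e) (l/(l+d2))^(1+e)
    divided by the area l^2. Where both coordinates are far, this is the
    regularity of K. Where one of them is near, only the size of K is available,
    but the factor D_theta2 turns the singularity |x1-y1|^(-1) into the integrable
    |x1-y1|^(theta2-1). The product weights are controlled by the strong maximal
    function, so the sharp function of the discrete operator and of its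
    commutator is bounded by maximal functions, with the John-Nirenberg
    inequality absorbing the weighted powers of [b]. The Fefferman-Stein
    inequality then gives l^p bounds for the discrete commutator that are uniform
    in the mesh. The averages of [b] over the cells have discrete BMO norm at
    most that of [b], and cell averages converge in L^1, so the bound passes to
    the limit; the commutator extends from the dense class by completeness. *)

Require Import Defs.
From mathcomp Require Import all_boot all_order all_algebra.
From mathcomp Require Import complex ring lra zify.
From mathcomp Require Import all_classical all_reals all_analysis.
From mathcomp Require Import measurable_realfun.

Set Implicit Arguments.
Unset Strict Implicit.
Unset Printing Implicit Defensive.

Import Order.TTheory GRing.Theory Num.Theory.

Local Open Scope classical_set_scope.
Local Open Scope ring_scope.

Import Normc.
Import HBSimple.
Import numFieldNormedType.Exports.
Local Open Scope complex_scope.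

(** * Sums over finite sequences *)

(** The kernel is not assumed measurable, so an integral against it is monotone but need not be
    additive. The grid confines [K] to the matrix entries, where comparison with measurable
    majorants suffices; what remains are finite sums. Finiteness also makes every absorption
    argument immediate: a quantity bounded by a smaller power of itself can be divided out, with no
    a priori estimate. Near the axes the absolute values of the entries of a column must be summed,
    and a separate bound for each cell would not add up well. Testing the column against its signs
    turns the sum into one singular integral over a strip. The commutator uses exponents 1 < q < s <
    p. The oscillation of the matrix applied to (b - b_Q) f is measured at q, the gap from q to s
    pays for the powers of b by Hölder, and the gap from s to p is left to the strong maximal
    function. As q may be close to 1, l^q bounds are obtained from l^2 by extrapolating upwards for
    the transposed matrix and dualizing; this is why rows and columns are estimated alike. *)

Section finite_sums.
Context {R : realType}.

Lemma sum_holder (T : eqType) (s : seq T) (a b : T -> R) (p q : R) :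
  0 < p -> 0 < q -> p^-1 + q^-1 = 1 ->
  (forall x, 0 <= a x) -> (forall x, 0 <= b x) ->
  \sum_(x <- s) a x * b x <=
  (\sum_(x <- s) a x `^ p) `^ p^-1 * (\sum_(x <- s) b x `^ q) `^ q^-1.
Proof.
move=> p0 q0 pq a0 b0.
have sa0 : 0 <= \sum_(x <- s) a x `^ p by apply: sumr_ge0 => *; exact: powR_ge0.
have sb0 : 0 <= \sum_(x <- s) b x `^ q by apply: sumr_ge0 => *; exact: powR_ge0.
have vanish (c : T -> R) r : 0 < r -> \sum_(x <- s) c x `^ r = 0 ->
    forall x, x \in s -> c x = 0.
  move=> r0 /eqP; rewrite psumr_eq0 => [|*]; last exact: powR_ge0.
  move=> /allP h x xs; apply/eqP.
  by have := h x xs; rewrite /= powR_eq0 => /andP[].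
have [/esym sa|sap] := eqVneq 0 (\sum_(x <- s) a x `^ p).
  rewrite big1_seq ?mulr_ge0 ?powR_ge0// => x /andP[_ xs].
  by rewrite (vanish a p)// mul0r.
have [/esym sb|sbp] := eqVneq 0 (\sum_(x <- s) b x `^ q).
  rewrite big1_seq ?mulr_ge0 ?powR_ge0// => x /andP[_ xs].
  by rewrite (vanish b q)// mulr0.
have {sap}sap : 0 < \sum_(x <- s) a x `^ p by rewrite lt_def eq_sym sap.
have {sbp}sbp : 0 < \sum_(x <- s) b x `^ q by rewrite lt_def eq_sym sbp.
set A := (\sum_(x <- s) a x `^ p) `^ p^-1.
set B := (\sum_(x <- s) b x `^ q) `^ q^-1.
have A0 : 0 < A by exact: powR_gt0.
have B0 : 0 < B by exact: powR_gt0.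
have Ap : A `^ p = \sum_(x <- s) a x `^ p.
  by rewrite -powRrM mulVf ?gt_eqF// powRr1.
have Bq : B `^ q = \sum_(x <- s) b x `^ q.
  by rewrite -powRrM mulVf ?gt_eqF// powRr1.
clearbody A B.
have AB0 : 0 < A * B by rewrite mulr_gt0.
rewrite -[leRHS]mulr1 -ler_pdivrMl//.
apply: (@le_trans _ _ (\sum_(x <- s)
   ((A^-1 `^ p * a x `^ p) / p + (B^-1 `^ q * b x `^ q) / q))).
  rewrite mulr_sumr; apply: ler_sum => x _.
  have -> : (A * B)^-1 * (a x * b x) = (A^-1 * a x) * (B^-1 * b x).
    by rewrite invfM mulrACA.
  rewrite -!powRM ?invr_ge0 ?(ltW A0) ?(ltW B0)//.
  by apply: conjugate_powR => //; rewrite mulr_ge0// invr_ge0 ltW.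
rewrite big_split/= -!mulr_suml -!mulr_sumr -Ap -Bq -!powRM ?invr_ge0 ?(ltW A0) ?(ltW B0)//.
by rewrite !mulVf ?gt_eqF// !powR1/= !div1r pq.
Qed.

Lemma ler_powR2r (r x y : R) : 0 <= r -> 0 <= x -> x <= y -> x `^ r <= y `^ r.
Proof.
move=> r0 x0 xy; apply: ge0_ler_powR => //; rewrite nnegrE//.
exact: le_trans xy.
Qed.

Lemma ler_powR_inv (r x y : R) : 0 < r -> 0 <= x -> 0 <= y -> x `^ r <= y `^ r ->
  x <= y.
Proof.
move=> r0 x0 y0 h; rewrite leNgt; apply/negP => yx.
have := @gt0_ltr_powR R r r0 y x; rewrite !nnegrE => /(_ y0 x0 yx).
by rewrite ltNge h.
Qed.

Lemma powR_invK (r x : R) : r != 0 -> 0 <= x -> (x `^ r^-1) `^ r = x.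
Proof. by move=> r0 x0; rewrite -powRrM mulVf// powRr1. Qed.

Lemma powRK (r x : R) : r != 0 -> 0 <= x -> (x `^ r) `^ r^-1 = x.
Proof. by move=> r0 x0; rewrite -powRrM mulfV// powRr1. Qed.

Lemma sum_holder_le (T : eqType) (s : seq T) (a b : T -> R) (p q A B : R) :
  0 < p -> 0 < q -> p^-1 + q^-1 = 1 -> 0 <= A -> 0 <= B ->
  (forall x, 0 <= a x) -> (forall x, 0 <= b x) ->
  \sum_(x <- s) a x `^ p <= A `^ p -> \sum_(x <- s) b x `^ q <= B `^ q ->
  \sum_(x <- s) a x * b x <= A * B.
Proof.
move=> p0 q0 pq A0 B0 a0 b0 aA bB.
apply: le_trans (sum_holder s p0 q0 pq a0 b0) _.
have A1 := powRK (lt0r_neq0 p0) A0; have B1 := powRK (lt0r_neq0 q0) B0.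
apply: ler_pM; rewrite ?powR_ge0//.
  rewrite -[leRHS]A1; apply: ler_powR2r; rewrite ?invr_ge0 ?(ltW p0)//.
  by apply: sumr_ge0 => *; exact: powR_ge0.
rewrite -[leRHS]B1; apply: ler_powR2r; rewrite ?invr_ge0 ?(ltW q0)//.
by apply: sumr_ge0 => *; exact: powR_ge0.
Qed.

(** Convexity: t^p lies above its tangent at y, that is x^p >= y^p + p y^(p-1) (x - y). This form
    replaces calculus below: it serves [powR_incr], the Riemann sum of [staircase_le] and the Jensen
    inequality [avg_jensen]. *)
Lemma young_powR (p x y : R) : 1 < p -> 0 <= x -> 0 <= y ->
  p * (x * y `^ (p - 1)) <= x `^ p + (p - 1) * y `^ p.
Proof.
move=> p1 x0 y0; have p0 : 0 < p by exact: lt_trans p1.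
have p10 : 0 < p - 1 by rewrite subr_gt0.
have q0 : 0 < p / (p - 1) by rewrite divr_gt0.
have := @conjugate_powR _ x (y `^ (p - 1)) p (p / (p - 1)) x0 (powR_ge0 _ _) p0 q0.
rewrite -powRrM mulrCA mulfV ?gt_eqF// mulr1.
have -> : p^-1 + (p / (p - 1))^-1 = 1.
  by rewrite invf_div; field; rewrite gt_eqF.
move=> /(_ erefl); rewrite -(ler_pM2l p0) mulrDr => /le_trans; apply.
by rewrite le_eqVlt; apply/orP; left; apply/eqP; field; rewrite !gt_eqF.
Qed.

Lemma powR_incr (p x u : R) : 1 < p -> 0 <= x -> 0 <= u ->
  (x + u) `^ p - x `^ p <= p * (u * (x + u) `^ (p - 1)).
Proof.
move=> p1 x0 u0.
have p0 : 0 < p by exact: lt_trans p1.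
have xu0 : 0 <= x + u by rewrite addr_ge0.
have := young_powR p1 x0 xu0.
have := mulr_powRB1 xu0 p0.
set z := (_ `^ (p - 1)); set w := _ `^ p; nra.
Qed.

(** Absorption: X^(1 - 1/p) is cancelled from both sides, which is legitimate because X is a real
    number. In every use X is a finite sum. *)
Lemma self_bound_powR (p X K G : R) : 1 < p -> 0 <= X -> 0 <= K -> 0 <= G ->
  X <= K * (G `^ p^-1 * X `^ (1 - p^-1)) -> X <= K `^ p * G.
Proof.
move=> p1 X0 K0 G0 h.
have p0 : 0 < p by exact: lt_trans p1.
have [->|Xn0] := eqVneq X 0; first by rewrite mulr_ge0// powR_ge0.
have Xp : 0 < X by rewrite lt_def Xn0.
have : X `^ p^-1 <= K * G `^ p^-1.
  have Y0 : 0 < X `^ (1 - p^-1) by exact: powR_gt0.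
  rewrite -(ler_pM2r Y0) -powRD ?Xn0 ?implybT//.
  by rewrite addrCA subrr addr0 powRr1// -mulrA.
move=> /(ler_powR2r (ltW p0) (powR_ge0 _ _)).
by rewrite powR_invK ?gt_eqF// powRM ?powR_ge0// powR_invK ?gt_eqF.
Qed.

Lemma powR_add_le (p x y : R) : 0 <= p -> 0 <= x -> 0 <= y ->
  (x + y) `^ p <= 2 `^ p * (x `^ p + y `^ p).
Proof.
move=> p0 x0 y0.
wlog xy : x y x0 y0 / x <= y.
  move=> h; case: (leP x y) => [|/ltW] xy; first exact: h.
  by rewrite addrC [leRHS]mulrDr [leRHS]addrC -mulrDr; exact: h.
apply: (@le_trans _ _ ((2 * y) `^ p)).
  by apply: ler_powR2r; rewrite ?addr_ge0//; lra.
rewrite powRM// ler_wpM2l ?powR_ge0// lerDr powR_ge0//.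
Qed.

End finite_sums.

(** * Discrete squares and the Fefferman-Stein inequality *)

Section squares.

Definition sqr (c : nat * nat) (l : nat) : seq (nat * nat) :=
  [seq (i, j) | i <- iota c.1 l, j <- iota c.2 l].

Lemma mem_sqr c l x : (x \in sqr c l) =
  ((c.1 <= x.1 < c.1 + l) && (c.2 <= x.2 < c.2 + l))%N.
Proof.
case: x => x y; apply/allpairsP/andP => /= [[[a b]/= [+ + [-> ->]]]|[h1 h2]].
  by rewrite !mem_iota.
by exists (x, y); rewrite !mem_iota.
Qed.

Lemma sqr_uniq c l : uniq (sqr c l).
Proof.
by apply: allpairs_uniq; rewrite ?iota_uniq// => -[a b] [a' b'] _ _ [-> ->].
Qed.

Lemma size_sqr c l : size (sqr c l) = (l * l)%N.
Proof. by rewrite size_allpairs !size_iota. Qed.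

Lemma sqr_split c m : perm_eq (sqr c (m + m))
  ((sqr c m ++ sqr (c.1, c.2 + m)%N m) ++
   (sqr (c.1 + m, c.2)%N m ++ sqr (c.1 + m, c.2 + m)%N m)).
Proof.
apply: uniq_perm; first exact: sqr_uniq.
  rewrite !cat_uniq !sqr_uniq/= !andbT -!all_predC.
  apply/and3P; split; apply/allP => x; rewrite /= ?mem_cat !mem_sqr/=; lia.
move=> x; rewrite !mem_cat !mem_sqr/=.
by move: x c => [a b] [u v]/=; apply/idP/idP; lia.
Qed.

Lemma sum1_sqr (R : realType) c l :
  \sum_(x <- sqr c l) (1 : R) = (l * l)%:R.
Proof. by rewrite big_const_seq count_predT size_sqr iter_addr_0. Qed.

End squares.

Section fefferman_stein.
Context {R : realType}.
Variables (p : R) (F g : nat * nat -> R).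
Hypotheses (p1 : 1 < p) (g0 : forall x, 0 <= g x).

Definition savg (G : nat * nat -> R) (c : nat * nat) (k : nat) : R :=
  (4 ^+ k)^-1 * \sum_(x <- sqr c (2 ^ k)) G x.

(** 32 = 8 * 2 * 2: the mean over a stopping square is within 8 w of the centre, w is at most 2 g,
    and the stopping squares fill at most half of the square, which costs the last 2. The factor p
    comes from [powR_incr]. *)
Let K := 32 * p.

Let p0 : 0 < p. Proof. exact: lt_trans p1. Qed.

(* [phi] replaces [|F - m|]: its increments telescope when a bound on a square is
   assembled from bounds on the subsquares, which those of [|F - m|] do not. *)
Definition major (s : seq (nat * nat)) m :=
  exists2 phi : nat * nat -> R, (forall x, 0 <= phi x) &
  (forall x, x \in s -> `|F x - m| <= phi x) /\
  (forall t, 0 <= t -> \sum_(x <- s) ((t + phi x) `^ p - t `^ p) <=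
     K * \sum_(x <- s) g x * (t + phi x) `^ (p - 1)).

(* [E] is the union of the stopping squares, the maximal subsquares on which the
   mean of [|F - m|] exceeds [2 w]; the second inequality makes [E] small. *)
Definition stopped m w (s : seq (nat * nat)) :=
  exists (phi : nat * nat -> R) (E : pred (nat * nat)),
  [/\ forall x, 0 <= phi x,
      forall x, x \in s -> `|F x - m| <= 8 * w + (if E x then phi x else 0),
      2 * w * (\sum_(x <- s | E x) 1) <= \sum_(x <- s | E x) `|F x - m| &
      forall t, 0 <= t ->
        \sum_(x <- s | E x) ((t + phi x) `^ p - t `^ p) <=
        K * \sum_(x <- s | E x) g x * (t + phi x) `^ (p - 1)].

Lemma stopped_cat m w s1 s2 : uniq (s1 ++ s2) ->
  stopped m w s1 -> stopped m w s2 -> stopped m w (s1 ++ s2).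
Proof.
rewrite cat_uniq => /and3P[_ /hasPn dis _].
move=> [f1 [E1 [f10 h1 n1 b1]]] [f2 [E2 [f20 h2 n2 b2]]].
have inl x : x \in s1 -> (x \in s1) = true by [].
have inr x : x \in s2 -> (x \in s1) = false by move=> /dis /negbTE.
exists (fun x => if x \in s1 then f1 x else f2 x).
exists (fun x => if x \in s1 then E1 x else E2 x).
have sum1 G : \sum_(x <- s1 | (if x \in s1 then E1 x else E2 x)) G x =
    \sum_(x <- s1 | E1 x) G x :> R.
  by rewrite big_seq_cond [RHS]big_seq_cond; apply: eq_bigl => x; case: (x \in s1).
have sum2 G : \sum_(x <- s2 | (if x \in s1 then E1 x else E2 x)) G x =
    \sum_(x <- s2 | E2 x) G x :> R.
  rewrite big_seq_cond [RHS]big_seq_cond; apply: eq_bigl => x.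
  by case: (boolP (x \in s2)) => //= /inr ->.
split.
- by move=> x; case: ifP.
- move=> x; rewrite mem_cat => /orP[] xs; first by rewrite xs; exact: h1.
  by rewrite inr//; exact: h2.
- by rewrite !big_cat/= !sum1 !sum2 mulrDr lerD.
- move=> t t0; rewrite !big_cat/= !sum1 !sum2 mulrDr lerD//.
    rewrite big_seq_cond [in leRHS]big_seq_cond.
    under eq_bigr => x /andP[-> _] do [].
    under [in leRHS]eq_bigr => x /andP[-> _] do [].
    by rewrite -!big_seq_cond; exact: b1.
  rewrite big_seq_cond [in leRHS]big_seq_cond.
  under eq_bigr => x /andP[/inr -> _] do [].
  under [in leRHS]eq_bigr => x /andP[/inr -> _] do [].
  by rewrite -!big_seq_cond; exact: b2.
Qed.

Lemma stopped_perm m w s1 s2 : perm_eq s1 s2 -> stopped m w s1 -> stopped m w s2.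
Proof.
move=> s12 [f [E [f0 h n b]]]; exists f, E; split => //.
- by move=> x; rewrite -(perm_mem s12); exact: h.
- by rewrite -!(perm_big _ s12).
- by move=> t /b; rewrite -!(perm_big _ s12).
Qed.

(** A family of squares closed under passing to children, kept abstract for two uses: all squares in
    [john_nirenberg], and the subsquares of the box in [fefferman_stein_box]. *)
Variable ok : nat * nat -> nat -> Prop.
Hypothesis ok_child : forall c k d, ok c k.+1 ->
  (d.1 == c.1) || (d.1 == c.1 + 2 ^ k)%N ->
  (d.2 == c.2) || (d.2 == c.2 + 2 ^ k)%N -> ok d k.
Hypothesis osc : forall c k, ok c k -> exists m : R,
  forall x, x \in sqr c (2 ^ k) ->
    \sum_(y <- sqr c (2 ^ k)) `|F y - m| <= 4 ^+ k * g x.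

Let card_sqr c k : \sum_(x <- sqr c (2 ^ k)) (1 : R) = 4 ^+ k.
Proof. by rewrite sum1_sqr -expnMn natrX. Qed.

Let four0 k : 0 < 4 ^+ k :> R. Proof. by rewrite exprn_gt0. Qed.

Let savg_near c k m :
  `|savg F c k - m| <= (4 ^+ k)^-1 * \sum_(x <- sqr c (2 ^ k)) `|F x - m|.
Proof.
have -> : savg F c k - m =
    (4 ^+ k)^-1 * \sum_(x <- sqr c (2 ^ k)) (F x - m).
  rewrite sumrB mulrBr; congr (_ - _).
  have -> : \sum_(x <- sqr c (2 ^ k)) m = 4 ^+ k * m.
    by rewrite -(card_sqr c) mulr_suml; under [RHS]eq_bigr do rewrite mul1r.
  by rewrite mulKf// gt_eqF.
rewrite normrM ger0_norm ?invr_ge0 ?(ltW (four0 _))//.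
by rewrite ler_wpM2l ?invr_ge0 ?(ltW (four0 _))// ler_norm_sum.
Qed.

(** Taking the mean as centre at most doubles the oscillation, and it fixes one centre per square
    for the induction. *)
Lemma osc_savg c k x : ok c k -> x \in sqr c (2 ^ k) ->
  \sum_(y <- sqr c (2 ^ k)) `|F y - savg F c k| <= 4 ^+ k * (2 * g x).
Proof.
move=> okc xc; have [m hm] := osc okc.
have h := hm x xc.
apply: (@le_trans _ _ (\sum_(y <- sqr c (2 ^ k)) (`|F y - m| + `|savg F c k - m|))).
  by apply: ler_sum => y _; rewrite [X in _ <= _ + X]distrC; exact: ler_distD.
rewrite big_split/=.
have -> : \sum_(y <- sqr c (2 ^ k)) `|savg F c k - m| =
    4 ^+ k * `|savg F c k - m|.
  by rewrite -(card_sqr c) mulr_suml; under [RHS]eq_bigr do rewrite mul1r.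
rewrite mulrCA mulr2n mulrDl !mul1r lerD//.
apply: le_trans h; rewrite mulrC -ler_pdivlMr// mulrC; exact: savg_near.
Qed.

Let stopped_sqr m w k : 0 <= w ->
  (forall j, (j < k)%N -> forall c, ok c j -> major (sqr c (2 ^ j)) (savg F c j)) ->
  forall j, (j <= k)%N -> forall c, ok c j ->
  \sum_(x <- sqr c (2 ^ j)) `|F x - m| <= 4 ^+ j * (2 * w) ->
  stopped m w (sqr c (2 ^ j)).
Proof.
move=> w0 IH; elim=> [|j IHj] jk c okc hc.
  exists (fun=> 0), pred0; split => //.
  - move=> x; rewrite mem_sqr expn0 => /andP[h1 h2].
    have -> : x = c by case: x c h1 h2 {hc okc} => [? ?] [? ?]/= ? ?; congr pair; lia.
    move: hc; rewrite /sqr expn0/= big_cons big_nil addr0 expr0 mul1r -surjective_pairing.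
    by move=> /le_trans; apply; rewrite addr0; lra.
  - by rewrite !big_pred0_eq mulr0.
  - by move=> t t0; rewrite !big_pred0_eq mulr0.
have child d : (d.1 == c.1) || (d.1 == c.1 + 2 ^ j)%N ->
    (d.2 == c.2) || (d.2 == c.2 + 2 ^ j)%N -> stopped m w (sqr d (2 ^ j)).
  move=> d1 d2; have okd := ok_child okc d1 d2.
  have [small|large] := leP (\sum_(x <- sqr d (2 ^ j)) `|F x - m|) (4 ^+ j * (2 * w)).
    by apply: IHj => //; exact: ltnW.
  have [phi phi0 [h b]] := IH j jk d okd.
  have sub : \sum_(x <- sqr d (2 ^ j)) `|F x - m| <=
             \sum_(x <- sqr c (2 ^ j.+1)) `|F x - m|.
    rewrite expnS mul2n -addnn (perm_big _ (sqr_split c _))/= !big_cat/=.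
    have pos e : 0 <= \sum_(x <- sqr e (2 ^ j)) `|F x - m| by exact: sumr_ge0.
    move: (pos c) (pos (c.1, c.2 + 2 ^ j)%N) (pos (c.1 + 2 ^ j, c.2)%N)
      (pos (c.1 + 2 ^ j, c.2 + 2 ^ j)%N).
    move: d1 d2; case: d {okd large h b} => d1 d2/= /orP[] /eqP-> /orP[] /eqP ->;
      rewrite -?surjective_pairing; lra.
  (* The child is stopped as a whole, with the majorant supplied by induction around its own mean.
     That mean is within 4 * 2 w = 8 w of m, since the parent passed the test and has four times the
     area. *)
  exists phi, predT; split => //.
  - move=> x xd /=; apply: le_trans (_ : `|savg F d j - m| + `|F x - savg F d j| <= _).
      by rewrite [leRHS]addrC; exact: ler_distD.
    rewrite lerD//; last exact: h.
    apply: le_trans (savg_near _ _ _) _.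
    rewrite ler_pdivrMl//; apply: le_trans sub _.
    by apply: le_trans hc _; rewrite exprS; lra.
  - by rewrite card_sqr mulrC; exact: ltW.
have := sqr_uniq c (2 ^ j + 2 ^ j).
rewrite (perm_uniq (sqr_split c _)) => U.
apply: stopped_perm (_ : stopped _ _ _).
  by rewrite expnS mul2n -addnn perm_sym; exact: sqr_split.
apply: stopped_cat => //; move: U; rewrite cat_uniq => /and3P[U1 _ U2].
- by apply: stopped_cat => //; apply: child => /=; rewrite eqxx ?orbT.
- by apply: stopped_cat => //; apply: child => /=; rewrite eqxx ?orbT.
Qed.

Lemma major_sqr k : forall c, ok c k -> major (sqr c (2 ^ k)) (savg F c k).
Proof.
have [n] := ubnP k; elim: n k => // n IH k kn c okc.
have IHk j : (j < k)%N -> forall c, ok c j -> major (sqr c (2 ^ j)) (savg F c j).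
  by move=> jk; apply: IH; lia.
set S := sqr c (2 ^ k); set m := savg F c k.
pose w := (4 ^+ k)^-1 * \sum_(x <- S) `|F x - m|.
have w0 : 0 <= w by rewrite mulr_ge0 ?invr_ge0 ?(ltW (four0 _))// sumr_ge0.
have wE : \sum_(x <- S) `|F x - m| = 4 ^+ k * w by rewrite mulVKf ?gt_eqF.
have K0 : 0 <= K by rewrite mulr_ge0 ?(ltW p0).
have [w_eq0|w_neq0] := eqVneq w 0.
  exists (fun=> 0) => //; split.
    move=> x xS; move: wE; rewrite w_eq0 mulr0 => /eqP.
    by rewrite psumr_eq0// => /allP /(_ x xS) /= /eqP ->.
  move=> t t0; rewrite big1 => [|? _]; last by rewrite addr0 subrr.
  by rewrite mulr_ge0// sumr_ge0// => *; rewrite mulr_ge0// powR_ge0.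
have wp : 0 < w by rewrite lt_def w_neq0.
have [|phi [E [phi0 h cE b]]] := stopped_sqr w0 IHk (leqnn k) okc (m := m).
  by rewrite wE ler_wpM2l ?(ltW (four0 _))//; lra.
have wg x : x \in S -> w <= 2 * g x.
  by move=> xS; rewrite -(ler_pM2l (four0 k)) -wE; exact: osc_savg.
have split (G : nat * nat -> R) :
    \sum_(x <- S) G x = \sum_(x <- S | E x) G x + \sum_(x <- S | ~~ E x) G x.
  by rewrite (bigID E).
(* Chebyshev: 2 w |E| is at most the total oscillation, which is w times the area of the square. *)
have cEC : \sum_(x <- S | E x) (1 : R) <= \sum_(x <- S | ~~ E x) (1 : R).
  have : 2 * w * (\sum_(x <- S | E x) 1) <= 4 ^+ k * w.
    rewrite -wE; apply: le_trans cE _; rewrite [leRHS]split lerDl.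
    exact: sumr_ge0.
  rewrite -(card_sqr c) (split (fun=> 1)) mulrAC ler_pM2r//; lra.
exists (fun x => 8 * w + (if E x then phi x else 0)).
  by move=> x; apply: addr_ge0; [exact: mulr_ge0|case: (E x)].
(* Raising the base level from t to t + u makes the increments telescope. On E the majorants of the
   stopping squares are used at level t + u, and the remaining increment D is constant over the
   square; this is why the bound in [major] is required for every t. *)
split => // t t0; set u := 8 * w.
have u0 : 0 <= u by rewrite mulr_ge0.
have tu0 : 0 <= t + u by rewrite addr_ge0.
pose D := (t + u) `^ p - t `^ p.
have D0 : 0 <= D by rewrite subr_ge0 ler_powR2r ?(ltW p0)// lerDl.
have DK x : x \in S -> D <= K / 2 * (g x * (t + u) `^ (p - 1)).
  move=> xS; apply: le_trans (powR_incr p1 t0 u0) _.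
  rewrite /K mulrA mulrA ler_wpM2r ?powR_ge0// /u.
  by have := ler_wpM2l (ltW p0) (wg x xS); lra.
have -> : \sum_(x <- S) ((t + (u + (if E x then phi x else 0))) `^ p - t `^ p) =
    \sum_(x <- S | E x) ((t + u + phi x) `^ p - (t + u) `^ p) +
    \sum_(x <- S) D.
  rewrite [in RHS]split addrA -big_split/= split; congr (_ + _).
    by apply: eq_bigr => x ->; rewrite /D addrA subrKA.
  by apply: eq_bigr => x /negbTE ->; rewrite addr0.
have -> : K * (\sum_(x <- S) g x * (t + (u + (if E x then phi x else 0))) `^ (p - 1)) =
    K * (\sum_(x <- S | E x) g x * (t + u + phi x) `^ (p - 1)) +
    K * (\sum_(x <- S | ~~ E x) g x * (t + u) `^ (p - 1)).
  rewrite split -mulrDr; congr (_ * (_ + _)).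
    by apply: eq_bigr => x ->; rewrite addrA.
  by apply: eq_bigr => x /negbTE ->; rewrite addr0.
apply: lerD; first exact: b.
(* The increment of the whole square is charged to the points outside E, at most doubling it there,
   because g on E is already spent on the stopping squares. *)
apply: (@le_trans _ _ (2 * \sum_(x <- S | ~~ E x) D)).
  have sD Q : \sum_(x <- S | Q x) D = (\sum_(x <- S | Q x) 1) * D.
    by rewrite mulr_suml; apply: eq_bigr => x _; rewrite mul1r.
  by rewrite split !sD; nra.
rewrite !mulr_sumr big_seq_cond [leRHS]big_seq_cond.
apply: ler_sum => x /andP[xS _].
by have := DK x xS; lra.
Qed.

(** At t = 0 the majorant satisfies a bound of the sum of phi^p by that of g phi^(p-1); Hölder and
    absorption turn it into a bound by g alone. *)
Lemma fefferman_stein c k : ok c k ->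
  \sum_(x <- sqr c (2 ^ k)) `|F x - savg F c k| `^ p <=
  K `^ p * \sum_(x <- sqr c (2 ^ k)) g x `^ p.
Proof.
move=> okc; have [phi phi0 [h b]] := major_sqr okc.
have p10 : 0 < p - 1 by rewrite subr_gt0.
set S := sqr _ _ in h b *.
apply: (@le_trans _ _ (\sum_(x <- S) phi x `^ p)).
  rewrite big_seq [leRHS]big_seq; apply: ler_sum => x xS.
  by rewrite ler_powR2r ?(ltW p0)//; exact: h.
have sp0 : 0 <= \sum_(x <- S) phi x `^ p by apply: sumr_ge0 => *; exact: powR_ge0.
have sg0 : 0 <= \sum_(x <- S) g x `^ p by apply: sumr_ge0 => *; exact: powR_ge0.
apply: self_bound_powR => //; first by rewrite mulr_ge0 ?(ltW p0).
have := b 0 (lexx _).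
rewrite powR0 ?gt_eqF//.
under eq_bigr do rewrite subr0 add0r.
under [in leRHS]eq_bigr do rewrite add0r.
move=> /le_trans; apply; rewrite ler_wpM2l ?mulr_ge0 ?(ltW p0)//.
have q0 : 0 < p / (p - 1) by rewrite divr_gt0.
have pq : p^-1 + (p / (p - 1))^-1 = 1.
  by rewrite invf_div; field; rewrite gt_eqF.
apply: le_trans (sum_holder S p0 q0 pq g0 (fun=> powR_ge0 _ _)) _.
apply: ler_wpM2l; first exact: powR_ge0.
have -> : (p / (p - 1))^-1 = 1 - p^-1 by apply/eqP; rewrite -subr_eq0 opprB addrA subr_eq0 addrC pq.
under eq_bigr do rewrite -powRrM mulrCA mulfV ?gt_eqF// mulr1.
by [].
Qed.

End fefferman_stein.

(** * Maximal functions *)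

Section level_sets.
Context {R : realType} (T : eqType).
Variables (s : seq T) (f M : T -> R) (p : R).
Hypotheses (p1 : 1 < p) (f0 : forall x, 0 <= f x) (M0 : forall x, 0 <= M x).
Hypothesis level : forall lam, 0 < lam ->
  0 <= \sum_(x <- s | lam <= M x) (f x - lam).

(* The layer-cake integral of [lam^(p-2)] against the hypothesis [level], in finite
   form: [l] lists the values of [M], where the level sets change. *)
Fixpoint staircase (v : R) (l : seq R) (y z : R) : R :=
  if l is w :: l' then
    (if w <= y then (w `^ (p - 1) - v `^ (p - 1)) * (z - w) else 0) +
    staircase w l' y z
  else 0.

Lemma staircase0 v l y z : all (fun w => y < w) l -> staircase v l y z = 0.
Proof.
elim: l v => //= w l IH v /andP[yw /IH ->].
by rewrite leNgt yw addr0.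
Qed.

(** The right side is p times the integral of (p-1) lam^(p-2) (z - lam) over lam from v to y. The
    staircase is its Riemann sum at right endpoints, hence not larger, because z - lam decreases in
    lam. *)
Lemma staircase_le v l y z : 0 <= v -> path <%R v l -> y \in v :: l ->
  p * staircase v l y z <=
  p * (z * (y `^ (p - 1) - v `^ (p - 1))) - (p - 1) * (y `^ p - v `^ p).
Proof.
have p0 : 0 < p by exact: lt_trans p1.
elim: l v => [|w l IH] v v0 /=.
  by rewrite inE => _ /eqP ->; rewrite !subrr !mulr0 subr0.
move=> /andP[vw pl]; rewrite inE => /predU1P[->|yl].
  rewrite (leNgt w) vw/= add0r staircase0; last first.
    apply/allP => t tl; apply: lt_trans vw _.
    by move: pl; rewrite lt_path_sortedE => /andP[/allP /(_ t tl)].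
  by rewrite !subrr !mulr0 subr0.
have w0 : 0 <= w by rewrite (le_trans v0)// ltW.
have wy : w <= y.
  move: yl; rewrite inE => /predU1P[->//|yl].
  by move: pl; rewrite lt_path_sortedE => /andP[/allP /(_ y yl) /ltW].
have := IH w w0 pl yl; rewrite wy.
have := young_powR p1 w0 v0.
have := mulr_powRB1 w0 p0.
set a := w `^ (p - 1); set b := v `^ (p - 1); set S := staircase _ _ _ _.
set c := w `^ p; set d := v `^ p; set y1 := y `^ _; set y2 := y `^ _ => <-.
lra.
Qed.

Lemma level_staircase v l : 0 <= v -> path <%R v l ->
  0 <= \sum_(x <- s) staircase v l (M x) (f x).
Proof.
elim: l v => [|w l IH] v v0 /= pl; first by rewrite big1.
move: pl => /andP[vw pl]; have w0 : 0 < w by exact: le_lt_trans vw.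
rewrite big_split/= addr_ge0//; last by apply: IH => //; exact: ltW.
rewrite -big_mkcond/= -mulr_sumr mulr_ge0//; last exact: level.
by rewrite subr_ge0 ler_powR2r ?subr_ge0 ?(ltW p1) ?(ltW vw).
Qed.

Lemma level_sum_powR :
  (p - 1) * \sum_(x <- s) M x `^ p <= p * \sum_(x <- s) f x * M x `^ (p - 1).
Proof.
have p0 : 0 < p by exact: lt_trans p1.
have p10 : p - 1 != 0 by rewrite gt_eqF// subr_gt0.
pose l := sort <=%R (undup [seq y <- map M s | 0 < y]).
have pl : path <%R 0 l.
  rewrite lt_path_sortedE; apply/andP; split.
    by apply/allP => y; rewrite mem_sort mem_undup mem_filter => /andP[].
  by rewrite sort_lt_sorted undup_uniq.
have := level_staircase (lexx 0) pl.
rewrite -(pmulr_rge0 _ p0) mulr_sumr => h.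
rewrite -subr_ge0 !mulr_sumr -sumrB; apply: le_trans h _.
rewrite mulr_sumr big_seq [leRHS]big_seq; apply: ler_sum => x xs.
have Ml : M x \in 0 :: l.
  rewrite inE mem_sort mem_undup mem_filter map_f// andbT.
  by rewrite lt_def M0 andbT; case: eqP.
apply: le_trans (staircase_le _ (lexx 0) pl Ml) _.
by rewrite !powR0 ?subr0// gt_eqF.
Qed.

Lemma level_powR :
  \sum_(x <- s) M x `^ p <= (p / (p - 1)) `^ p * \sum_(x <- s) f x `^ p.
Proof.
have p0 : 0 < p by exact: lt_trans p1.
have p10 : 0 < p - 1 by rewrite subr_gt0.
have q0 : 0 < p / (p - 1) by rewrite divr_gt0.
have pq : p^-1 + (p / (p - 1))^-1 = 1.
  by rewrite invf_div; field; rewrite gt_eqF.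
apply: self_bound_powR => //; rewrite ?(ltW q0)//.
- by apply: sumr_ge0 => *; exact: powR_ge0.
- by apply: sumr_ge0 => *; exact: powR_ge0.
rewrite -(ler_pM2l p10); apply: le_trans level_sum_powR _.
rewrite [leRHS]mulrA [(p - 1) * _]mulrC divfK ?gt_eqF//.
apply: ler_wpM2l; first exact: ltW.
apply: le_trans (sum_holder s p0 q0 pq f0 (fun=> powR_ge0 _ _)) _.
apply: ler_wpM2l; first exact: powR_ge0.
have -> : (p / (p - 1))^-1 = 1 - p^-1.
  by apply/eqP; rewrite -subr_eq0 opprB addrA subr_eq0 addrC pq.
by under eq_bigr do rewrite -powRrM mulrCA mulfV ?gt_eqF// mulr1.
Qed.

End level_sets.

Section maximal_function.
Context {R : realType}.
Implicit Types (f : nat -> R) (o e u v x y : nat).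

(** One-sided maximal functions satisfy the weak-type inequality with constant 1 and with f summed
    over the level set only, as [level] demands; no covering argument is needed. The neutral value 0
    of the maximum never reaches a level lam > 0. *)
Definition max_right e f x : R :=
  \big[Num.max/0]_(y <- index_iota x.+1 e.+1)
    ((\sum_(x <= t < y) f t) / (y - x)%:R).

Definition max_left o f x : R :=
  \big[Num.max/0]_(u <- index_iota o x.+1)
    ((\sum_(u <= t < x.+1) f t) / (x.+1 - u)%:R).

Definition hardy_littlewood o e f x := max_left o f x + max_right e f x.

Lemma bigmax0_ge0 (I : Type) (r : seq I) (F : I -> R) :
  0 <= \big[Num.max/0]_(i <- r) F i.
Proof.
by elim: r => [|i r IH]; rewrite ?big_nil// big_cons le_max IH orbT.
Qed.

Lemma bigmax0_sup (I : eqType) (r : seq I) (F : I -> R) i :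
  i \in r -> F i <= \big[Num.max/0]_(j <- r) F j.
Proof.
elim: r => //= j r IH; rewrite inE big_cons le_max => /predU1P[->|/IH ->].
  by rewrite lexx.
by rewrite orbT.
Qed.

Lemma bigmax0_attained (I : eqType) (r : seq I) (F : I -> R) lam :
  0 < lam -> lam <= \big[Num.max/0]_(j <- r) F j ->
  exists2 i, i \in r & lam <= F i.
Proof.
move=> l0; elim: r => [|i r IH]; first by rewrite big_nil leNgt l0.
rewrite big_cons le_max => /orP[h|/IH[j jr h]]; first by exists i; rewrite ?mem_head.
by exists j => //; rewrite inE jr orbT.
Qed.

Lemma sum_sub_const u v f lam : (u <= v)%N ->
  \sum_(u <= t < v) (f t - lam) = \sum_(u <= t < v) f t - lam * (v - u)%:R.
Proof. by move=> uv; rewrite sumrB big_const_nat iter_addr_0 mulr_natr. Qed.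

Lemma max_right_level o e f lam : (o <= e)%N -> 0 < lam ->
  0 <= \sum_(o <= x < e | lam <= max_right e f x) (f x - lam).
Proof.
move=> oe l0.
pose G x := \sum_(x <= z < e | lam <= max_right e f z) (f z - lam).
(* Rising sun lemma. The induction runs from the right end and needs the bound for every partial sum
   from x, not only G >= 0. At a point of the level set some interval starting there has a
   nonnegative sum, so its term keeps G nonnegative; at any other point all partial sums from x are
   nonpositive. *)
suff H k : forall x, (e - x = k)%N -> (x <= e)%N ->
    forall y, (x <= y <= e)%N -> \sum_(x <= t < y) (f t - lam) <= G x.
  by have := H (e - o)%N o erefl oe o; rewrite leqnn oe big_geq//; apply.
elim: k => [|k IH] x xk xe y /andP[xy ye].
  have -> : y = x by lia.
  by rewrite /G !big_geq//; lia.
have xlt : (x < e)%N by lia.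
have step : G x = (if lam <= max_right e f x then f x - lam else 0) + G x.+1.
  by rewrite /G big_ltn_cond//; case: ifP; rewrite ?add0r.
have G1 : 0 <= G x.+1.
  have := IH x.+1 _ _ x.+1; rewrite big_geq//; apply; lia.
have IH1 z : (x < z <= e)%N -> \sum_(x.+1 <= t < z) (f t - lam) <= G x.+1.
  by move=> xz; apply: IH => //; lia.
rewrite step; case: ifPn => [hx|].
  have G0 : 0 <= f x - lam + G x.+1.
    have [z] := bigmax0_attained l0 hx; rewrite mem_index_iota => /andP[xz ze].
    have zx : 0 < (z - x)%:R :> R by rewrite ltr0n subn_gt0.
    rewrite ler_pdivlMr// => hz.
    apply: (@le_trans _ _ (\sum_(x <= t < z) (f t - lam))).
      by rewrite sum_sub_const ?(ltnW xz)// subr_ge0.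
    by rewrite big_ltn// lerD2l; apply: IH1; lia.
  have [xy'|] := ltnP x y; first by rewrite big_ltn// lerD2l; apply: IH1; lia.
  by move=> yx; rewrite big_geq.
rewrite -ltNge => hx; rewrite add0r; apply: le_trans G1.
have [xy'|] := ltnP x y; last by move=> yx; rewrite big_geq.
rewrite sum_sub_const// subr_le0 -ler_pdivrMr ?ltr0n ?subn_gt0//.
apply: le_trans (ltW hx); rewrite /max_right.
have := @bigmax0_sup nat (index_iota x.+1 e.+1)
  (fun y => (\sum_(x <= t < y) f t) / (y - x)%:R) y.
by apply; rewrite mem_index_iota; lia.
Qed.

(** The mirror image of [max_right_level], by induction from the left end. *)
Lemma max_left_level o e f lam : (o <= e)%N -> 0 < lam ->
  0 <= \sum_(o <= x < e | lam <= max_left o f x) (f x - lam).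
Proof.
move=> oe l0.
pose G x := \sum_(o <= z < x | lam <= max_left o f z) (f z - lam).
suff H k : forall u, (o <= u <= o + k)%N ->
    \sum_(u <= t < o + k) (f t - lam) <= G (o + k)%N.
  have := H (e - o)%N (o + (e - o))%N; rewrite big_geq// subnKC//; apply; lia.
elim: k => [|k IH] u /andP[ou uk].
  by rewrite /G !big_geq//; lia.
rewrite addnS; set x := (o + k)%N in IH *.
have step : G x.+1 = G x + (if lam <= max_left o f x then f x - lam else 0).
  by rewrite /G big_mkcond big_nat_recr ?leq_addr//= -big_mkcond.
have G1 : 0 <= G x by have := IH x; rewrite big_geq//; apply; lia.
rewrite step; case: ifPn => [hx|].
  have G0 : 0 <= G x + (f x - lam).
    have [z] := bigmax0_attained l0 hx; rewrite mem_index_iota => /andP[xz ze].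
    have zx : 0 < (x.+1 - z)%:R :> R by rewrite ltr0n subn_gt0.
    rewrite ler_pdivlMr// => hz.
    apply: (@le_trans _ _ (\sum_(z <= t < x.+1) (f t - lam))).
      by rewrite sum_sub_const ?(ltnW ze)// subr_ge0.
    by rewrite big_nat_recr//= lerD2r; apply: IH; lia.
  have [ux|] := leqP u x; first by rewrite big_nat_recr//= lerD2r; apply: IH; lia.
  by move=> xu; rewrite big_geq.
rewrite -ltNge => hx; rewrite addr0; apply: le_trans G1.
have [ux|] := leqP u x; last by move=> xu; rewrite big_geq.
rewrite sum_sub_const ?(leqW ux)// subr_le0 -ler_pdivrMr ?ltr0n ?subn_gt0//.
apply: le_trans (ltW hx); rewrite /max_left.
have := @bigmax0_sup nat (index_iota o x.+1)
  (fun u => (\sum_(u <= t < x.+1) f t) / (x.+1 - u)%:R) u.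
by apply; rewrite mem_index_iota; lia.
Qed.

Lemma hardy_littlewood_ge0 o e f x : 0 <= hardy_littlewood o e f x.
Proof. by rewrite addr_ge0// bigmax0_ge0. Qed.

Lemma hardy_littlewood_sup o e f u x v : (forall t, 0 <= f t) ->
  (o <= u <= x)%N -> (x < v <= e)%N ->
  \sum_(u <= t < v) f t <= (v - u)%:R * hardy_littlewood o e f x.
Proof.
move=> f0 /andP[ou ux] /andP[xv ve].
have hl : \sum_(u <= t < x.+1) f t <= (v - u)%:R * max_left o f x.
  apply: (@le_trans _ _ ((x.+1 - u)%:R * max_left o f x)); last first.
    by rewrite ler_wpM2r ?bigmax0_ge0// ler_nat; lia.
  rewrite mulrC -ler_pdivrMr; last by rewrite ltr0n; lia.
  have := @bigmax0_sup nat (index_iota o x.+1)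
    (fun u => (\sum_(u <= t < x.+1) f t) / (x.+1 - u)%:R) u.
  by apply; rewrite mem_index_iota; lia.
have hr : \sum_(x <= t < v) f t <= (v - u)%:R * max_right e f x.
  apply: (@le_trans _ _ ((v - x)%:R * max_right e f x)); last first.
    by rewrite ler_wpM2r ?bigmax0_ge0// ler_nat; lia.
  rewrite mulrC -ler_pdivrMr; last by rewrite ltr0n; lia.
  have := @bigmax0_sup nat (index_iota x.+1 e.+1)
    (fun y => (\sum_(x <= t < y) f t) / (y - x)%:R) v.
  by apply; rewrite mem_index_iota; lia.
rewrite (@big_cat_nat _ _ _ x)//=; last exact: ltnW.
rewrite mulrDr lerD//; apply: le_trans hl.
by rewrite big_nat_recr//= lerDl.
Qed.

Lemma hardy_littlewood_powR (p : R) o e f : 1 < p -> (o <= e)%N ->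
  (forall t, 0 <= f t) ->
  \sum_(o <= x < e) hardy_littlewood o e f x `^ p <=
  2 `^ p * 2 * (p / (p - 1)) `^ p * \sum_(o <= x < e) f x `^ p.
Proof.
move=> p1 oe f0.
apply: (@le_trans _ _ (\sum_(o <= x < e)
    2 `^ p * (max_left o f x `^ p + max_right e f x `^ p))).
  apply: ler_sum => x _.
  by apply: powR_add_le; rewrite ?bigmax0_ge0// (le_trans ler01)// ltW.
rewrite -mulr_sumr -!mulrA ler_wpM2l ?powR_ge0// big_split/=.
rewrite mulr2n mulrDl mul1r lerD//.
- apply: level_powR => // [x|lam l0]; first exact: bigmax0_ge0.
  exact: max_left_level.
- apply: level_powR => // [x|lam l0]; first exact: bigmax0_ge0.
  exact: max_right_level.
Qed.

End maximal_function.

(** * Power means and geometric sums *)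

Section power_mean.
Context {R : realType}.

(** Jensen for weights of arbitrary total mass: Hölder with w split as w^(1 - 1/q) w^(1/q). *)
Lemma weighted_power_mean (T : eqType) (s : seq T) (w a : T -> R) (q : R) :
  1 < q -> (forall x, 0 <= w x) -> (forall x, 0 <= a x) ->
  (\sum_(x <- s) w x * a x) `^ q <=
  (\sum_(x <- s) w x) `^ (q - 1) * \sum_(x <- s) w x * a x `^ q.
Proof.
move=> q1 w0 a0.
have q0 : 0 < q by exact: lt_trans q1.
have q10 : 0 < q - 1 by rewrite subr_gt0.
have q'0 : 0 < q / (q - 1) by rewrite divr_gt0.
have pq : (q / (q - 1))^-1 + q^-1 = 1.
  by rewrite invf_div; field; rewrite gt_eqF.
have e1 : (q / (q - 1))^-1 * q = q - 1.
  by rewrite invf_div divfK// gt_eqF.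
have h := sum_holder s q'0 q0 pq
  (fun x => powR_ge0 (w x) (q / (q - 1))^-1)
  (fun x => mulr_ge0 (powR_ge0 (w x) q^-1) (a0 x)).
have sw0 : 0 <= \sum_(x <- s) w x by exact: sumr_ge0.
have swa0 : 0 <= \sum_(x <- s) w x * a x.
  by apply: sumr_ge0 => x _; exact: mulr_ge0.
have swaq0 : 0 <= \sum_(x <- s) w x * a x `^ q.
  by apply: sumr_ge0 => x _; rewrite mulr_ge0 ?powR_ge0.
have eL : \sum_(x <- s) w x `^ (q / (q - 1))^-1 * (w x `^ q^-1 * a x) =
    \sum_(x <- s) w x * a x.
  apply: eq_bigr => x _; rewrite mulrA -powRD ?pq ?powRr1//.
  by rewrite oner_eq0.
have e2 : \sum_(x <- s) (w x `^ (q / (q - 1))^-1) `^ (q / (q - 1)) =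
    \sum_(x <- s) w x.
  by apply: eq_bigr => x _; rewrite powR_invK ?gt_eqF.
have e3 : \sum_(x <- s) (w x `^ q^-1 * a x) `^ q =
    \sum_(x <- s) w x * a x `^ q.
  by apply: eq_bigr => x _; rewrite powRM ?powR_ge0// powR_invK ?gt_eqF.
rewrite eL e2 e3 in h.
apply: le_trans (ler_powR2r (ltW q0) swa0 h) _.
by rewrite powRM ?powR_ge0// -powRrM e1 powR_invK ?gt_eqF.
Qed.

Lemma power_mean (T : eqType) (s : seq T) (a : T -> R) (q : R) :
  1 < q -> (forall x, 0 <= a x) ->
  (\sum_(x <- s) a x) `^ q <=
  (\sum_(x <- s) 1) `^ (q - 1) * \sum_(x <- s) a x `^ q.
Proof.
move=> q1 a0.
have := weighted_power_mean s q1 (fun=> ler01) a0.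
rewrite (eq_bigr a) => [|x _]; last by rewrite mul1r.
by rewrite [X in _ <= _ * X](eq_bigr (fun x => a x `^ q)) => // x _; rewrite mul1r.
Qed.

Lemma geometric_le (z : R) (H : nat) : 0 <= z < 1 ->
  \sum_(m < H) z ^+ m <= (1 - z)^-1.
Proof.
move=> /andP[z0 z1]; have z10 : 0 < 1 - z by rewrite subr_gt0.
rewrite -[leRHS]mul1r ler_pdivlMr//.
have := subrX1 z H; have := exprn_ge0 H z0.
by set S := \sum_(_ < _) _; set y := z ^+ H; lra.
Qed.

Lemma ler_sum_sub (T : eqType) (s t : seq T) (P : pred T) (G : T -> R) :
  uniq s -> uniq t -> (forall y, 0 <= G y) ->
  (forall y, y \in s -> P y -> y \in t) ->
  \sum_(y <- s | P y) G y <= \sum_(y <- t) G y.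
Proof.
move=> us ut G0 st; rewrite -big_filter.
rewrite [leRHS](bigID (mem [seq y <- s | P y]))/= -[X in X + _]big_filter.
have st' : perm_eq [seq y <- s | P y] [seq y <- t | y \in [seq y <- s | P y]].
  apply: uniq_perm; rewrite ?filter_uniq// => y.
  rewrite !mem_filter; apply/idP/idP => [/andP[h1 h2]|/andP[//]].
  by rewrite h1 h2 (st y).
by rewrite -(perm_big _ st') lerDl sumr_ge0.
Qed.

End power_mean.

(** * Product weights and discrete BMO *)

Section weights.
Context {R : realType}.

Definition ndist (i j : nat) := ((i - j) + (j - i))%N.

Definition decayw (k : R) (l d : nat) : R := (l%:R / (l + d)%:R) `^ k.

Lemma decayw_ge0 k l d : 0 <= decayw k l d. Proof. exact: powR_ge0. Qed.

(** The term of the least m with d < 2^m l suffices alone: if m > 0, then d >= 2^(m-1) l. Weighted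
    sums thus become sums of plain averages over concentric dyadic enlargements; H only keeps the
    series finite. *)
Lemma decay_layers (k : R) l d H : 0 <= k -> (0 < l)%N -> (d < 2 ^ H * l)%N ->
  decayw k l d <=
  2 `^ k * \sum_(m < H.+1) (2 `^ (- k)) ^+ m * (d < 2 ^ m * l)%N%:R.
Proof.
move=> k0 l0 dH.
have [m [dm hm mH]] : exists m, [/\ (d < 2 ^ m * l)%N,
    forall i, (d < 2 ^ i * l)%N -> (m <= i)%N & (m < H.+1)%N].
  have ex : exists m, (d < 2 ^ m * l)%N by exists H.
  by case: (ex_minnP ex) => m dm hm; exists m; split => //; rewrite ltnS hm.
rewrite (bigD1 (Ordinal mH))//=.
apply: (@le_trans _ _ (2 `^ k * (2 `^ (- k)) ^+ m)); last first.
  rewrite ler_wpM2l ?powR_ge0// dm mulr1 lerDl.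
  by apply: sumr_ge0 => i _; rewrite mulr_ge0// exprn_ge0// powR_ge0.
have lp : 0 < l%:R :> R by rewrite ltr0n.
have ldp : 0 < (l + d)%:R :> R by rewrite ltr0n addn_gt0 l0.
case: m dm hm {mH} => [|m] dm hm.
  rewrite mulr1 ler_powR2r ?divr_ge0//.
  by rewrite ler_pdivrMr// natrD; have : 0 <= d%:R :> R by []; lra.
have dm' : (2 ^ m * l <= d)%N.
  by rewrite leqNgt; apply/negP => /hm; rewrite ltnn.
rewrite exprS mulrA -powRD ?pnatr_eq0 ?implybT// subrr powRr0 mul1r.
have -> : (2 `^ (- k)) ^+ m = ((2 ^+ m)^-1) `^ k :> R.
  rewrite -powR_mulrn ?powR_ge0// powRAC powR_mulrn//.
  by rewrite -powR_inv1 ?exprn_ge0// -powRrM mulN1r.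
rewrite ler_powR2r ?divr_ge0// ler_pdivrMr// ler_pdivlMl ?exprn_gt0//.
by rewrite -natrX -natrM ler_nat (leq_trans dm')// leq_addl.
Qed.

Lemma decayw_antitone (k : R) l d d' : 0 <= k -> (0 < l)%N -> (d <= d')%N ->
  decayw k l d' <= decayw k l d.
Proof.
move=> k0 l0 dd'; have lp : 0 < l%:R :> R by rewrite ltr0n.
rewrite ler_powR2r ?divr_ge0// ler_pM2l// lef_pV2 ?posrE ?ltr0n ?addn_gt0 ?l0//.
by rewrite ler_nat leq_add2l.
Qed.

Lemma decayw_le1 (k : R) l d : 0 <= k -> (0 < l)%N -> decayw k l d <= 1.
Proof.
move=> k0 l0; have := decayw_antitone k0 l0 (leq0n d).
by rewrite /decayw addn0 divff ?pnatr_eq0 ?gtn_eqF// powR1.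
Qed.

Lemma decayw_exponent (k k' : R) l d : (0 < l)%N -> k <= k' ->
  decayw k' l d <= decayw k l d.
Proof.
move=> l0 kk'; rewrite /decayw.
have lp : 0 < l%:R :> R by rewrite ltr0n.
have ldp : 0 < (l + d)%:R :> R by rewrite ltr0n addn_gt0 l0.
apply: ger_powR => //; rewrite divr_gt0//= ler_pdivrMr// mul1r ler_nat.
exact: leq_addr.
Qed.

(** Layer m carries the factor 2^(-k m) and an interval of length at most 2 * 2^m l, so the series
    is geometric with ratio 2^(1-k), convergent for k > 1. The factor 2^k is that of
    [decay_layers]. *)
Definition Cweight (k : R) : R := 2 `^ k * 2 / (1 - 2 * 2 `^ (- k)).

Lemma two_powRN_lt (k : R) : 1 < k -> 0 <= 2 * 2 `^ (- k) < 1.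
Proof.
move=> k1; rewrite mulr_ge0 ?powR_ge0//= -[X in X * _](powRr1 (ler0n _ 2)).
rewrite -powRD ?pnatr_eq0 ?implybT// -[ltRHS](powRr0 (2 : R)).
rewrite -subr_gt0 /powR pnatr_eq0/= subr_gt0 ltr_expR ltr_pM2r ?ln_gt0 ?ltr1n//.
lra.
Qed.

Lemma Cweight_gt0 (k : R) : 1 < k -> 0 < Cweight k.
Proof.
move=> k1; rewrite divr_gt0 ?mulr_gt0 ?powR_gt0//.
by have /andP[_] := two_powRN_lt k1; rewrite subr_gt0.
Qed.

(** Here mu stands for any bound of the averages over intervals around x: a maximal function at x,
    or 1 when f = 1 and the mass of the weight is wanted. *)
Lemma weighted_sum (k : R) l o e c x (f : nat -> R) mu :
  1 < k -> (0 < l)%N -> (o <= c <= x)%N -> (x < c + l)%N -> (x < e)%N ->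
  (forall t, 0 <= f t) -> 0 <= mu ->
  (forall u v, (o <= u <= x)%N -> (x < v <= e)%N ->
    \sum_(u <= t < v) f t <= (v - u)%:R * mu) ->
  \sum_(o <= t < e) decayw k l (ndist t c) * f t <= Cweight k * l%:R * mu.
Proof.
move=> k1 l0 /andP[oc cx] xcl xe f0 mu0 hmu.
have k0 : 0 <= k by rewrite ltW// (lt_trans ltr01).
have lp : 0 < l%:R :> R by rewrite ltr0n.
have [H hH] : exists H, forall t, (t < e)%N -> (ndist t c < 2 ^ H * l)%N.
  exists (e + c)%N => t te.
  apply: (@leq_trans (2 ^ (e + c)))%N; last by rewrite leq_pmulr.
  by apply: leq_trans (ltn_expl _ (ltnSn 1)); rewrite ltnS /ndist; lia.
apply: (@le_trans _ _ (2 `^ k * \sum_(m < H.+1) (2 `^ (- k)) ^+ m *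
    \sum_(o <= t < e) (ndist t c < 2 ^ m * l)%N%:R * f t)).
  rewrite mulr_sumr.
  under [leRHS]eq_bigr do rewrite mulr_sumr mulr_sumr.
  rewrite exchange_big/= big_nat_cond [leRHS]big_nat_cond.
  apply: ler_sum => t /andP[/andP[ot te] _].
  apply: le_trans (ler_wpM2r (f0 t) (decay_layers k0 l0 (hH t te))) _.
  by rewrite mulr_sumr mulr_suml; apply: ler_sum => m _; rewrite -!mulrA.
apply: (@le_trans _ _ (2 `^ k * \sum_(m < H.+1) (2 * 2 `^ (- k)) ^+ m *
    (2 * l%:R * mu))).
  rewrite ler_wpM2l ?powR_ge0//; apply: ler_sum => m _.
  rewrite [leRHS](_ : _ = (2 `^ (- k)) ^+ m * ((2 * 2 ^ m * l)%:R * mu)); last first.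
    by rewrite exprMn !natrM natrX; ring.
  rewrite ler_wpM2l ?exprn_ge0 ?powR_ge0//.
  (* The layer clipped to [o, e). It contains x because x lies in [c, c + l) and l <= 2^m l, so mu
     controls its average. *)
  pose u := maxn o (c - 2 ^ m * l)%N; pose v := minn e (c + 2 ^ m * l)%N.
  have ml : (l <= 2 ^ m * l)%N by rewrite leq_pmull// expn_gt0.
  have ou : (o <= u <= x)%N by rewrite /u; lia.
  have ve : (x < v <= e)%N by rewrite /v; lia.
  have uv : (u <= v)%N by lia.
  apply: (@le_trans _ _ (\sum_(u <= t < v) f t)).
    rewrite (@big_cat_nat _ _ _ u)/=; [|lia|lia].
    rewrite (@big_cat_nat _ _ _ v u)/=; [|lia|lia].
    rewrite [X in X + _]big_nat_cond [X in X + _]big1 ?add0r; last first.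
      move=> t /andP[/andP[h1 h2] _].
      have -> : (ndist t c < 2 ^ m * l)%N = false.
        by apply/negbTE; rewrite -leqNgt; move: h1 h2; rewrite /u /ndist; lia.
      by rewrite mul0r.
    rewrite [X in _ + X]big_nat_cond [X in _ + X]big1 ?addr0; last first.
      move=> t /andP[/andP[h1 h2] _].
      have -> : (ndist t c < 2 ^ m * l)%N = false.
        by apply/negbTE; rewrite -leqNgt; move: h1 h2; rewrite /v /ndist; lia.
      by rewrite mul0r.
    by apply: ler_sum => t _; case: (_ < _)%N; rewrite ?mul1r ?mul0r.
  apply: le_trans (hmu u v ou ve) _.
  by rewrite ler_wpM2r// ler_nat; move: ou ve; rewrite /u /v; lia.
rewrite -mulr_suml.
apply: (@le_trans _ _ (2 `^ k * ((1 - 2 * 2 `^ (- k))^-1 * (2 * l%:R * mu)))).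
  rewrite ler_wpM2l ?powR_ge0// ler_wpM2r ?mulr_ge0//.
  exact/geometric_le/two_powRN_lt.
by rewrite /Cweight le_eqVlt; apply/orP; left; apply/eqP; ring.
Qed.

Definition weight (k : R) (c : nat * nat) (l : nat) (y : nat * nat) : R :=
  decayw k l (ndist y.1 c.1) * decayw k l (ndist y.2 c.2).

Lemma weight_ge0 k c l y : 0 <= weight k c l y.
Proof. by rewrite mulr_ge0 ?decayw_ge0. Qed.

Lemma sum_sqr (c : nat * nat) l (G : nat * nat -> R) :
  \sum_(x <- sqr c l) G x =
  \sum_(c.1 <= i < c.1 + l) \sum_(c.2 <= j < c.2 + l) G (i, j).
Proof. by rewrite /sqr big_allpairs_dep /index_iota !addKn. Qed.

Lemma sum_weight (k : R) o e c l :
  1 < k -> (0 < l)%N -> (o <= c.1)%N -> (o <= c.2)%N ->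
  (c.1 < o + e)%N -> (c.2 < o + e)%N ->
  \sum_(y <- sqr (o, o) e) weight k c l y <= (Cweight k * l%:R) ^+ 2.
Proof.
move=> k1 l0 oc1 oc2 ce1 ce2; rewrite sum_sqr/=.
have one d : (o <= d)%N -> (d < o + e)%N ->
    \sum_(o <= t < o + e) decayw k l (ndist t d) <= Cweight k * l%:R.
  move=> od de.
  have := @weighted_sum k l o (o + e)%N d d (fun=> 1) 1 k1 l0.
  rewrite od leqnn de; under eq_bigr do rewrite mulr1.
  rewrite mulr1 => -> //; first by lia.
  by move=> u v; rewrite big_const_nat iter_addr_0 mulr1.
under eq_bigr => i _ do rewrite /weight/= -mulr_sumr.
rewrite -mulr_suml expr2; apply: ler_pM => //; try exact: one.
  by apply: sumr_ge0 => *; exact: decayw_ge0.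
by apply: sumr_ge0 => *; exact: decayw_ge0.
Qed.

(** Iterating the one-dimensional operator dominates averages over rectangles. Squares would not do:
    a product weight with exponents close to 1 decays too slowly along the axes. *)
Definition strong_max o e (f : nat * nat -> R) (x : nat * nat) : R :=
  hardy_littlewood o e
    (fun i => hardy_littlewood o e (fun j => f (i, j)) x.2) x.1.

Lemma strong_max_ge0 o e f x : 0 <= strong_max o e f x.
Proof. exact: hardy_littlewood_ge0. Qed.

Lemma strong_max_weight (k : R) o e c l x (f : nat * nat -> R) :
  1 < k -> (0 < l)%N -> (o <= c.1)%N -> (o <= c.2)%N -> x \in sqr c l ->
  (x.1 < o + e)%N -> (x.2 < o + e)%N -> (forall y, 0 <= f y) ->
  \sum_(y <- sqr (o, o) e) weight k c l y * f y <=
  (Cweight k * l%:R) ^+ 2 * strong_max o (o + e) f x.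
Proof.
move=> k1 l0 oc1 oc2; rewrite mem_sqr => /andP[/andP[cx1 xc1] /andP[cx2 xc2]].
move=> xe1 xe2 f0; rewrite sum_sqr/=.
have C0 : 0 <= Cweight k * l%:R by rewrite mulr_ge0// ltW// Cweight_gt0.
pose h i := hardy_littlewood o (o + e) (fun j => f (i, j)) x.2.
have h0 i : 0 <= h i by exact: hardy_littlewood_ge0.
apply: (@le_trans _ _ (\sum_(o <= i < o + e) decayw k l (ndist i c.1) *
    (Cweight k * l%:R * h i))).
  apply: ler_sum => i _.
  under eq_bigr do rewrite /weight/= -mulrA.
  rewrite -mulr_sumr ler_wpM2l ?decayw_ge0//.
  apply: (@weighted_sum _ _ _ _ _ x.2) => //; first by rewrite oc2.
  by move=> u v ou xv; apply: hardy_littlewood_sup.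
under eq_bigr do rewrite mulrCA.
rewrite -mulr_sumr expr2 -[leRHS]mulrA ler_wpM2l//.
apply: (@weighted_sum _ _ _ _ _ x.1) => //; first by rewrite oc1.
  exact: hardy_littlewood_ge0.
by move=> u v ou xv; apply: hardy_littlewood_sup.
Qed.

Definition Cmax (p : R) : R := 2 `^ p * 2 * (p / (p - 1)) `^ p.

Lemma Cmax_ge0 p : 0 <= Cmax p.
Proof. by rewrite !mulr_ge0 ?powR_ge0. Qed.

Lemma strong_max_powR (p : R) o e (f : nat * nat -> R) :
  1 < p -> (forall y, 0 <= f y) ->
  \sum_(x <- sqr (o, o) e) strong_max o (o + e) f x `^ p <=
  Cmax p ^+ 2 * \sum_(x <- sqr (o, o) e) f x `^ p.
Proof.
move=> p1 f0; rewrite !sum_sqr/= exchange_big/=.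
apply: (@le_trans _ _ (\sum_(o <= j < o + e) Cmax p *
    \sum_(o <= i < o + e)
      hardy_littlewood o (o + e) (fun j => f (i, j)) j `^ p)).
  apply: ler_sum => j _; rewrite /strong_max/=.
  apply: (hardy_littlewood_powR (f := fun i =>
    hardy_littlewood o (o + e) (fun j => f (i, j)) j) p1 (leq_addr _ _)).
  by move=> t; exact: hardy_littlewood_ge0.
rewrite -mulr_sumr expr2 -[leRHS]mulrA ler_wpM2l ?Cmax_ge0//.
rewrite exchange_big/= mulr_sumr; apply: ler_sum => i _.
exact: (hardy_littlewood_powR (f := fun j => f (i, j)) p1 (leq_addr _ _)).
Qed.

End weights.

(** * Weighted John-Nirenberg estimates *)

Section bmo_weights.
Context {R : realType}.
Variables (b : nat * nat -> R) (beta r : R).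
Hypotheses (beta0 : 0 <= beta) (r1 : 1 < r).

(** Every corner is allowed, not only those of one dyadic grid, because [bmo_weighted] enlarges
    squares symmetrically and so leaves the grid. *)
Definition discrete_bmo := forall c k, exists m : R,
  \sum_(x <- sqr c (2 ^ k)) `|b x - m| <= 4 ^+ k * beta.

Hypothesis bmo_b : discrete_bmo.

Lemma john_nirenberg c k :
  \sum_(x <- sqr c (2 ^ k)) `|b x - savg b c k| `^ r <=
  (32 * r) `^ r * (4 ^+ k * beta `^ r).
Proof.
have := @fefferman_stein R r b (fun=> beta) r1 (fun=> beta0) (fun _ _ => True).
move=> /(_ (fun _ _ _ _ _ _ => I)).
have h c' k' : True -> exists m : R, forall x, x \in sqr c' (2 ^ k') ->
    \sum_(y <- sqr c' (2 ^ k')) `|b y - m| <= 4 ^+ k' * beta.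
  by move=> _; have [m hm] := bmo_b c' k'; exists m.
move=> /(_ h c k I) /le_trans; apply.
rewrite big_const_seq count_predT size_sqr iter_addr_0.
by rewrite -[X in _ * X]mulr_natl -expnMn natrX.
Qed.

Lemma savg_sub_powR (F : nat * nat -> R) m c k :
  4 ^+ k * `|savg F c k - m| `^ r <=
  \sum_(x <- sqr c (2 ^ k)) `|F x - m| `^ r.
Proof.
have four0 : 0 < 4 ^+ k :> R by rewrite exprn_gt0.
have card : \sum_(x <- sqr c (2 ^ k)) (1 : R) = 4 ^+ k.
  by rewrite sum1_sqr -expnMn natrX.
have r0 : 0 < r by exact: lt_trans r1.
have h : 4 ^+ k * `|savg F c k - m| <= \sum_(x <- sqr c (2 ^ k)) `|F x - m|.
  have -> : savg F c k - m =
      (4 ^+ k)^-1 * \sum_(x <- sqr c (2 ^ k)) (F x - m).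
    rewrite sumrB mulrBr; congr (_ - _).
    have -> : \sum_(x <- sqr c (2 ^ k)) m = 4 ^+ k * m.
      by rewrite -card mulr_suml; under [RHS]eq_bigr do rewrite mul1r.
    by rewrite mulKf// gt_eqF.
  rewrite normrM ger0_norm ?invr_ge0 ?(ltW four0)//.
  by rewrite mulVKf ?gt_eqF// ler_norm_sum.
have := ler_powR2r (ltW r0) (mulr_ge0 (ltW four0) (normr_ge0 _)) h.
move=> /le_trans /(_ (power_mean _ r1 (fun=> normr_ge0 _))).
rewrite powRM ?(ltW four0)// card.
rewrite -(mulr_powRB1 (ltW four0) r0) mulrAC [X in X <= _]mulrC.
by rewrite ler_pM2l// powR_gt0.
Qed.

(** The factor 2^5 comes from the layers, the final 2 from summing 2^(-m), 2^r from splitting |b -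
    b_Q|, (32 r)^r from [john_nirenberg], and 32 dominates (1 + 4 * 4^m) (4 * 4^m) / 16^m. *)
Definition Cbmo : R := 2 `^ 5 * (2 `^ r * 32 * (32 * r) `^ r) * 2.

Lemma Cbmo_ge0 : 0 <= Cbmo.
Proof. by rewrite !mulr_ge0 ?powR_ge0// ltW. Qed.

(** The exponent 5 pays for crude losses: at layer m the enlarged square has 4^(m+1) times the area
    of Q, and comparing the two means of b over the whole enlargement costs another 4^(m+1). The
    factor 2^(-5m) leaves the summable 2^(-m). *)
Lemma bmo_weighted n k c : (k <= n)%N ->
  (2 ^ n <= c.1)%N -> (2 ^ n <= c.2)%N ->
  (c.1 + 2 ^ k <= 2 ^ n + 2 ^ n)%N -> (c.2 + 2 ^ k <= 2 ^ n + 2 ^ n)%N ->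
  \sum_(y <- sqr (2 ^ n, 2 ^ n)%N (2 ^ n))
     decayw 5 (2 ^ k) (maxn (ndist y.1 c.1) (ndist y.2 c.2)) *
       `|b y - savg b c k| `^ r <=
  Cbmo * (4 ^+ k * beta `^ r).
Proof.
move=> kn c1 c2 c1' c2'; set bQ := savg b c k; set l := (2 ^ k)%N.
have l0 : (0 < l)%N by rewrite expn_gt0.
have r0 : 0 < r by exact: lt_trans r1.
have lH m : (2 ^ m * l = 2 ^ (m + k))%N by rewrite expnD.
have nk : (2 ^ (n - k) * l = 2 ^ n)%N by rewrite lH subnK.
pose d (y : nat * nat) := maxn (ndist y.1 c.1) (ndist y.2 c.2).
apply: (@le_trans _ _ (2 `^ 5 * \sum_(m < (n - k).+1) (2 `^ (- 5)) ^+ m *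
    \sum_(y <- sqr (2 ^ n, 2 ^ n)%N (2 ^ n))
      (d y < 2 ^ m * l)%N%:R * `|b y - bQ| `^ r)).
  rewrite mulr_sumr.
  under [leRHS]eq_bigr do rewrite mulr_sumr mulr_sumr.
  rewrite exchange_big/= big_seq [leRHS]big_seq.
  apply: ler_sum => y; rewrite mem_sqr/= => yB.
  have dy : (d y < 2 ^ (n - k) * l)%N by rewrite nk /d /ndist; lia.
  apply: le_trans (ler_wpM2r (powR_ge0 _ _) (decay_layers _ l0 dy)) _ => //.
  by rewrite mulr_sumr mulr_suml; apply: ler_sum => m _; rewrite -!mulrA.
rewrite /Cbmo -2![leRHS]mulrA ler_wpM2l ?powR_ge0//.
set D := 2 `^ r * 32 * (32 * r) `^ r.
have D0 : 0 <= D by rewrite !mulr_ge0 ?powR_ge0.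
apply: (@le_trans _ _ (\sum_(m < (n - k).+1) (2^-1) ^+ m *
   (D * (4 ^+ k * beta `^ r)))); last first.
  rewrite -mulr_suml [leRHS](_ : _ = 2 * (D * (4 ^+ k * beta `^ r))); last by ring.
  rewrite ler_wpM2r ?mulr_ge0 ?exprn_ge0 ?powR_ge0//.
  have := @geometric_le R 2^-1 (n - k).+1.
  have -> : (1 - 2^-1 : R)^-1 = 2 by field.
  by apply; lra.
apply: ler_sum => m _.
have mn : (2 ^ m * l <= 2 ^ n)%N.
  rewrite -nk leq_mul2r leq_exp2l//; apply/orP; right.
  by have := ltn_ord m; rewrite ltnS.
(* The corner of the enlarged square. The truncated subtraction is exact because both coordinates of
   c are at least 2^n >= 2^m l. *)
pose c' := (c.1 - 2 ^ m * l, c.2 - 2 ^ m * l)%N.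
pose S := sqr c' (2 ^ (m + k).+1).
pose bS := savg b c' (m + k).+1.
have SE : (2 ^ (m + k).+1 = 2 ^ m * l + 2 ^ m * l)%N.
  by rewrite lH expnS mul2n addnn.
have l2 : (l <= 2 ^ m * l)%N by rewrite leq_pmull// expn_gt0.
have jnS : \sum_(y <- S) `|b y - bS| `^ r <=
    (32 * r) `^ r * (4 ^+ (m + k).+1 * beta `^ r) by exact: john_nirenberg.
have QS : 4 ^+ k * `|bQ - bS| `^ r <= \sum_(y <- S) `|b y - bS| `^ r.
  apply: le_trans (savg_sub_powR _ _ _ _) _.
  apply: ler_sum_sub => [| |y|y]; rewrite ?sqr_uniq ?powR_ge0// !mem_sqr/= SE => h _.
  by move: h; rewrite -/l; lia.
have cS : \sum_(y <- S) (1 : R) = 4 ^+ (m + k).+1.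
  by rewrite sum1_sqr -expnMn natrX.
have E0 : 0 <= \sum_(y <- S) `|b y - bS| `^ r.
  by apply: sumr_ge0 => *; exact: powR_ge0.
have main : \sum_(y <- sqr (2 ^ n, 2 ^ n)%N (2 ^ n))
      (d y < 2 ^ m * l)%N%:R * `|b y - bQ| `^ r <=
    2 `^ r * ((1 + 4 ^+ m.+1) * \sum_(y <- S) `|b y - bS| `^ r).
  apply: (@le_trans _ _ (\sum_(y <- S) `|b y - bQ| `^ r)).
    rewrite (eq_bigr (fun y => if (d y < 2 ^ m * l)%N then `|b y - bQ| `^ r else 0)).
      rewrite -big_mkcond; apply: ler_sum_sub => [| |y|y]; rewrite ?sqr_uniq ?powR_ge0//.
      by rewrite !mem_sqr/= SE /d /ndist; lia.
    by move=> y _; case: (_ < _)%N; rewrite ?mul1r ?mul0r.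
  apply: (@le_trans _ _ (\sum_(y <- S)
      2 `^ r * (`|b y - bS| `^ r + `|bQ - bS| `^ r))).
    apply: ler_sum => y _.
    apply: le_trans (powR_add_le (ltW r0) (normr_ge0 _) (normr_ge0 _)).
    by rewrite ler_powR2r ?(ltW r0)// [X in _ <= _ + X]distrC; exact: ler_distD.
  rewrite -mulr_sumr ler_wpM2l ?powR_ge0// big_split/= mulrDl mul1r lerD2l.
  have -> : \sum_(y <- S) `|bQ - bS| `^ r = 4 ^+ (m + k).+1 * `|bQ - bS| `^ r.
    by rewrite -cS mulr_suml; under [RHS]eq_bigr do rewrite mul1r.
  by rewrite -addSn exprD -mulrA ler_wpM2l// exprn_ge0.
apply: (@le_trans _ _ ((2 `^ (- 5)) ^+ m * (2 `^ r * ((1 + 4 ^+ m.+1) *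
   ((32 * r) `^ r * (4 ^+ (m + k).+1 * beta `^ r)))))).
  rewrite ler_wpM2l ?exprn_ge0 ?powR_ge0//; apply: le_trans main _.
  by rewrite ler_wpM2l ?powR_ge0// ler_wpM2l// addr_ge0// exprn_ge0.
have -> : 2 `^ (- 5) = 32^-1 :> R.
  by rewrite powRN powR_mulrn//; congr (_^-1); ring.
have h4 : (1 : R) <= 4 ^+ m by rewrite exprn_ege1// ler1n.
have -> : 2^-1 ^+ m = 32^-1 ^+ m * (4 ^+ m * 4 ^+ m) :> R.
  by rewrite -!exprMn; congr (_ ^+ _); field.
rewrite -!mulrA ler_wpM2l ?exprn_ge0//.
rewrite -addSn exprD !exprS /D.
have B0 : 0 <= 2 `^ r * ((32 * r) `^ r * (4 ^+ k * beta `^ r)).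
  by rewrite !mulr_ge0 ?powR_ge0 ?exprn_ge0.
rewrite [leLHS](_ : _ = ((1 + 4 * 4 ^+ m) * (4 * 4 ^+ m)) *
   (2 `^ r * ((32 * r) `^ r * (4 ^+ k * beta `^ r)))); last by ring.
rewrite [leRHS](_ : _ = (32 * (4 ^+ m * 4 ^+ m)) *
   (2 `^ r * ((32 * r) `^ r * (4 ^+ k * beta `^ r)))); last by ring.
by rewrite ler_wpM2r//; nra.
Qed.

End bmo_weights.

(** * Discrete singular integrals and their commutators *)

Section discrete_operators.
Context {R : realType}.
Implicit Types (n k : nat) (c i j x : nat * nat) (a : nat * nat -> nat * nat -> R).
Implicit Types (f h F g b : nat * nat -> R).

(* Away from the axes, so that the squares surrounding an index of the box still
   have natural coordinates. *)
Definition box n := sqr (2 ^ n, 2 ^ n)%N (2 ^ n).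

Definition app n a f i := \sum_(j <- box n) a i j * f j.

Definition tr a := fun i j => a j i.

Definition lp_bounded n (q A : R) a := forall f,
  \sum_(i <- box n) `|app n a f i| `^ q <= A * \sum_(j <- box n) `|f j| `^ q.

Definition subbox n c k := [&& 2 ^ n <= c.1, 2 ^ n <= c.2,
  c.1 + 2 ^ k <= 2 ^ n + 2 ^ n & c.2 + 2 ^ k <= 2 ^ n + 2 ^ n]%N.

(** With the threshold 4 l, a far coordinate separates the square from the cell by at least 3/5 of l
    + d, see [far_dist]. *)
Definition near_sqr c (l : nat) j :=
  ((ndist j.1 c.1 < 4 * l) && (ndist j.2 c.2 < 4 * l))%N.

(** A Hörmander condition in l^1 mean. The constant may depend on the column; weighted by the input,
    these constants add up to one centre for the output. *)
Definition far_bounded n (kp A : R) a := forall c k j,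
  subbox n c k -> j \in box n -> ~~ near_sqr c (2 ^ k) j ->
  exists m : R, \sum_(i <- sqr c (2 ^ k)) `|a i j - m| <= A * weight kp c (2 ^ k) j.

Definition comm n b a f i := \sum_(j <- box n) (b i - b j) * a i j * f j.

Lemma subbox_le n c k : subbox n c k -> (k <= n)%N.
Proof.
move=> /and4P[h1 _ h2 _]; rewrite -(leq_exp2l _ _ (ltnSn 1)).
by rewrite -(leq_add2l (2 ^ n)); apply: leq_trans h2; rewrite leq_add2r.
Qed.

Lemma subbox_sub n c k x : subbox n c k -> x \in sqr c (2 ^ k) -> x \in box n.
Proof. by rewrite /subbox !mem_sqr/=; lia. Qed.

Lemma subbox_bounds n c k : subbox n c k ->
  [/\ 2 ^ n <= c.1, 2 ^ n <= c.2, c.1 < 2 ^ n + 2 ^ n & c.2 < 2 ^ n + 2 ^ n]%N.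
Proof.
move=> /and4P[h1 h2 h3 h4]; have k0 : (0 < 2 ^ k)%N by rewrite expn_gt0.
split => //; first by apply: leq_trans h3; rewrite -addn1 leq_add2l.
by apply: leq_trans h4; rewrite -addn1 leq_add2l.
Qed.

Lemma subbox_child n c k d : subbox n c k.+1 ->
  (d.1 == c.1) || (d.1 == c.1 + 2 ^ k)%N ->
  (d.2 == c.2) || (d.2 == c.2 + 2 ^ k)%N -> subbox n d k.
Proof.
rewrite /subbox expnS mul2n -addnn => h /orP[] /eqP h1 /orP[] /eqP h2;
  by rewrite h1 h2; lia.
Qed.

Lemma subbox_root n : subbox n (2 ^ n, 2 ^ n)%N n.
Proof. by rewrite /subbox/= !leqnn. Qed.

Lemma near_root n j : j \in box n -> near_sqr (2 ^ n, 2 ^ n)%N (2 ^ n) j.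
Proof. by rewrite mem_sqr /near_sqr /ndist /=; lia. Qed.

Lemma near_self c l x : x \in sqr c l -> near_sqr c l x.
Proof.
by case: x c => [x1 x2] [c1 c2]; rewrite mem_sqr /near_sqr /ndist/=; lia.
Qed.

Lemma pow2_sqr k : (2 ^ k)%N%:R ^+ 2 = 4 ^+ k :> R.
Proof. by rewrite natrX -exprM mulnC exprM; congr (_ ^+ _); ring. Qed.

Lemma near_weight (kp : R) c l j : 0 <= kp -> (0 < l)%N -> near_sqr c l j ->
  1 <= (5 `^ kp) ^+ 2 * weight kp c l j.
Proof.
move=> k0 l0 /andP[h1 h2].
have one d : (d < 4 * l)%N -> 1 <= 5 `^ kp * decayw kp l d.
  move=> dl; have ld0 : 0 < (l + d)%:R :> R by rewrite ltr0n addn_gt0 l0.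
  rewrite -powRM// ?divr_ge0//; apply: (@le_trans _ _ (1 `^ kp)).
    by rewrite powR1.
  rewrite ler_powR2r// mulrA.
  by rewrite ler_pdivlMr// mul1r -natrM ler_nat; lia.
have := ler_pM ler01 ler01 (one _ h1) (one _ h2).
rewrite mulr1 => /le_trans; apply; rewrite /weight le_eqVlt.
by apply/orP; left; apply/eqP; ring.
Qed.

Definition Cosc (q kp A A' : R) : R :=
  2 `^ q * (A * (5 `^ kp) ^+ 2 + A' `^ q * (Cweight kp ^+ 2) `^ (q - 1)).

Lemma Cosc_ge0 q kp A A' : 0 <= A -> 0 <= Cosc q kp A A'.
Proof.
by move=> A0; rewrite mulr_ge0 ?powR_ge0// addr_ge0 ?mulr_ge0 ?powR_ge0 ?sqr_ge0.
Qed.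

(** The input is split at [near_sqr]. The near part is bounded by the l^q norm and placed under the
    weight, which is at least 5^(-2 kp) there; on the far part each column is replaced by its
    constant. If no index is far, the centre is 0, which [fefferman_stein_box] exploits at the
    root. *)
Lemma oscillation n (q kp A A' : R) a c k h :
  1 < q -> 1 < kp -> 0 <= A -> 0 <= A' ->
  lp_bounded n q A a -> far_bounded n kp A' a -> subbox n c k ->
  exists m : R, (all (near_sqr c (2 ^ k)) (box n) -> m = 0) /\
    (\sum_(i <- sqr c (2 ^ k)) `|app n a h i - m|) `^ q <=
    Cosc q kp A A' * (4 ^+ k) `^ (q - 1) *
      \sum_(j <- box n) weight kp c (2 ^ k) j * `|h j| `^ q.
Proof.
move=> q1 kp1 A0 A'0 La Fa sub.
have q0 : 0 < q by exact: lt_trans q1.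
have kp0 : 0 <= kp by rewrite ltW// (lt_trans ltr01).
set l := (2 ^ k)%N; have l0 : (0 < l)%N by rewrite expn_gt0.
have /choice[kap hkap] : forall j, exists m : R,
    j \in box n -> ~~ near_sqr c l j ->
    \sum_(i <- sqr c l) `|a i j - m| <= A' * weight kp c l j.
  move=> j; case: (boolP (j \in box n)) => jB; last by exists 0.
  case: (boolP (near_sqr c l j)) => nj; first by exists 0.
  by have [m hm] := Fa c k j sub jB nj; exists m.
exists (\sum_(j <- box n | ~~ near_sqr c l j) kap j * h j); split.
  move=> /allP al; rewrite big_seq_cond big1// => j /andP[jB].
  by rewrite al.
pose h1 j := if near_sqr c l j then h j else 0.
set Q := sqr c l; set W := weight kp c l.
have W0 j : 0 <= W j by exact: weight_ge0.
have four0 : 0 < 4 ^+ k :> R by rewrite exprn_gt0.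
pose S := \sum_(j <- box n) W j * `|h j| `^ q.
have S0 : 0 <= S by apply: sumr_ge0 => j _; rewrite mulr_ge0 ?powR_ge0.
pose X := \sum_(i <- Q) `|app n a h1 i|.
pose Y := A' * \sum_(j <- box n) W j * `|h j|.
have X0 : 0 <= X by exact: sumr_ge0.
have Y0 : 0 <= Y by rewrite mulr_ge0// sumr_ge0// => j _; exact: mulr_ge0.
have XY : \sum_(i <- Q) `|app n a h i -
    \sum_(j <- box n | ~~ near_sqr c l j) kap j * h j| <= X + Y.
  apply: (@le_trans _ _ (\sum_(i <- Q) (`|app n a h1 i| +
      \sum_(j <- box n | ~~ near_sqr c l j) `|a i j - kap j| * `|h j|))).
    apply: ler_sum => i _.
    have -> : app n a h i - \sum_(j <- box n | ~~ near_sqr c l j) kap j * h j =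
        app n a h1 i + \sum_(j <- box n | ~~ near_sqr c l j) (a i j - kap j) * h j.
      rewrite /app (bigID (near_sqr c l))/= -addrA -sumrB; congr (_ + _).
        rewrite big_mkcond; apply: eq_bigr => j _.
        by rewrite /h1; case: ifP; rewrite ?mulr0.
      by apply: eq_bigr => j _; rewrite mulrBl.
    apply: le_trans (ler_normD _ _) _; rewrite lerD2l.
    by apply: le_trans (ler_norm_sum _ _ _) _; under eq_bigr do rewrite normrM.
  rewrite big_split/= lerD2l exchange_big/= /Y mulr_sumr.
  rewrite big_mkcond/= big_seq [leRHS]big_seq; apply: ler_sum => j jB.
  case: ifPn => nj; last by apply: mulr_ge0 => //; exact: mulr_ge0.
  by rewrite -mulr_suml mulrA ler_wpM2r//; exact: hkap.
apply: le_trans (ler_powR2r (ltW q0) _ XY) _; first exact: sumr_ge0.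
apply: le_trans (powR_add_le (ltW q0) X0 Y0) _.
rewrite /Cosc -!mulrA ler_wpM2l ?powR_ge0// mulrDl lerD//.
- apply: le_trans (power_mean _ q1 (fun=> normr_ge0 _)) _.
  rewrite sum1_sqr -expnMn natrX [X in _ <= X]mulrCA ler_wpM2l ?powR_ge0//.
  apply: (@le_trans _ _ (\sum_(i <- box n) `|app n a h1 i| `^ q)).
    apply: ler_sum_sub; rewrite ?sqr_uniq// => y yQ _.
    exact: subbox_sub yQ.
  apply: le_trans (La h1) _; rewrite -mulrA ler_wpM2l// mulr_sumr.
  apply: ler_sum => j _; rewrite /h1; case: ifPn => nj.
    rewrite mulrA -[X in X <= _]mul1r ler_wpM2r ?powR_ge0//.
    exact: near_weight.
  rewrite normr0 powR0 ?gt_eqF// mulr_ge0 ?exprn_ge0 ?powR_ge0//.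
  by rewrite mulr_ge0 ?powR_ge0.
- rewrite /Y powRM//; last by rewrite sumr_ge0// => j _; exact: mulr_ge0.
  rewrite -!mulrA ler_wpM2l ?powR_ge0//.
  apply: le_trans (weighted_power_mean _ q1 W0 (fun=> normr_ge0 _)) _.
  rewrite mulrA ler_wpM2r// -powRM ?sqr_ge0 ?(ltW four0)//.
  rewrite ler_powR2r ?subr_ge0 ?(ltW q1)//; first exact: sumr_ge0.
  rewrite -pow2_sqr -exprMn; have [s1 s2 s3 s4] := subbox_bounds sub.
  exact: sum_weight.
Qed.

Definition CFS (p : R) : R := 2 `^ p * ((32 * p) `^ p + 1).

Lemma CFS_ge0 p : 0 <= CFS p.
Proof. by rewrite mulr_ge0 ?powR_ge0// addr_ge0 ?powR_ge0. Qed.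

(** At the root every index is near, so the centre is 0 and g dominates the mean of |F| over the
    box. The average subtracted in [fefferman_stein] is therefore absorbed by g. *)
Lemma fefferman_stein_box n (p : R) F g : 1 < p -> (forall x, 0 <= g x) ->
  (forall c k, subbox n c k -> exists m : R,
    (all (near_sqr c (2 ^ k)) (box n) -> m = 0) /\
    forall x, x \in sqr c (2 ^ k) ->
      \sum_(y <- sqr c (2 ^ k)) `|F y - m| <= 4 ^+ k * g x) ->
  \sum_(x <- box n) `|F x| `^ p <= CFS p * \sum_(x <- box n) g x `^ p.
Proof.
move=> p1 g0 osc; have p0 : 0 < p by exact: lt_trans p1.
have osc' c k : subbox n c k -> exists m : R,
    forall x, x \in sqr c (2 ^ k) ->
      \sum_(y <- sqr c (2 ^ k)) `|F y - m| <= 4 ^+ k * g x.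
  by move=> /osc[m [_ hm]]; exists m.
have FS := fefferman_stein p1 g0 (@subbox_child n) osc' (subbox_root n).
have [m [m0 hm]] := osc _ _ (subbox_root n).
set av := savg F _ _ in FS.
have avg x : x \in box n -> `|av| <= g x.
  move=> xB; rewrite /av /savg normrM ger0_norm ?invr_ge0 ?exprn_ge0//.
  rewrite ler_pdivrMl ?exprn_gt0//; apply: le_trans (ler_norm_sum _ _ _) _.
  apply: le_trans (hm x xB); rewrite m0; last by apply/allP => j /near_root.
  by under [leRHS]eq_bigr do rewrite subr0.
apply: (@le_trans _ _ (\sum_(x <- box n) 2 `^ p * (`|F x - av| `^ p + `|av| `^ p))).
  apply: ler_sum => x _.
  apply: le_trans (powR_add_le (ltW p0) (normr_ge0 _) (normr_ge0 _)).
  rewrite ler_powR2r ?(ltW p0)//; apply: le_trans (ler_normD _ _).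
  by rewrite subrK.
rewrite -mulr_sumr /CFS -mulrA ler_wpM2l ?powR_ge0// big_split/= mulrDl lerD//.
rewrite mul1r big_seq [leRHS]big_seq; apply: ler_sum => x xB.
by rewrite ler_powR2r ?(ltW p0)//; exact: avg.
Qed.

Definition Cextrapolate (p q kp A A' : R) : R :=
  CFS p * ((Cosc q kp A A' * Cweight kp ^+ 2) `^ (p / q) * Cmax (p / q) ^+ 2).

Lemma Cextrapolate_ge0 p q kp A A' : 0 <= Cextrapolate p q kp A A'.
Proof.
by apply: mulr_ge0; [exact: CFS_ge0|rewrite mulr_ge0 ?powR_ge0 ?sqr_ge0].
Qed.

Lemma strong_max_root n (s p : R) f : 0 < s -> s < p ->
  \sum_(x <- box n)
    (strong_max (2 ^ n) (2 ^ n + 2 ^ n) (fun y => `|f y| `^ s) x `^ s^-1) `^ p <=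
  Cmax (p / s) ^+ 2 * \sum_(x <- box n) `|f x| `^ p.
Proof.
move=> s0 sp.
have ps1 : 1 < p / s by rewrite ltr_pdivlMr// mul1r.
have := @strong_max_powR R (p / s) (2 ^ n) (2 ^ n) _ ps1 (fun y => powR_ge0 `|f y| s).
under eq_bigr do rewrite mulrC powRrM.
move=> /le_trans; apply; rewrite ler_wpM2l ?sqr_ge0//.
by apply: ler_sum => x _; rewrite -powRrM mulrC divfK ?gt_eqF.
Qed.

(** The sharp function of the output is bounded by (M |f|^q)^(1/q) with M the strong maximal
    function, which acts on l^p exactly when p exceeds q. *)
Lemma lp_extrapolate n (p q kp A A' : R) a : 1 < q -> q < p -> 1 < kp ->
  0 <= A -> 0 <= A' ->
  lp_bounded n q A a -> far_bounded n kp A' a ->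
  lp_bounded n p (Cextrapolate p q kp A A') a.
Proof.
move=> q1 qp kp1 A0 A'0 La Fa f.
have q0 : 0 < q by exact: lt_trans q1.
have p1 : 1 < p by exact: lt_trans qp.
set D := Cosc q kp A A' * Cweight kp ^+ 2.
have D0 : 0 <= D by rewrite mulr_ge0 ?Cosc_ge0 ?sqr_ge0.
pose SM := strong_max (2 ^ n) (2 ^ n + 2 ^ n) (fun y => `|f y| `^ q).
pose g x := D `^ q^-1 * SM x `^ q^-1.
have g0 x : 0 <= g x by rewrite mulr_ge0 ?powR_ge0.
have four0 k : 0 < 4 ^+ k :> R by rewrite exprn_gt0.
have := @fefferman_stein_box n p (app n a f) g p1 g0.
move=> H; apply: le_trans (H _) _ => {H}.
  move=> c k sub; have [m [m0 hm]] := oscillation f q1 kp1 A0 A'0 La Fa sub.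
  exists m; split => // x xQ.
  apply: (@ler_powR_inv _ q) => //; first exact: sumr_ge0.
    by rewrite mulr_ge0// ltW.
  apply: le_trans hm _; rewrite powRM ?(ltW (four0 _))// powRM ?powR_ge0//.
  rewrite !powR_invK ?gt_eqF ?strong_max_ge0//.
  have xB := subbox_sub sub xQ.
  have l0 : (0 < 2 ^ k)%N by rewrite expn_gt0.
  have [s1 s2 _ _] := subbox_bounds sub.
  move: xB; rewrite mem_sqr => /andP[/andP[_ x1] /andP[_ x2]].
  apply: (@le_trans _ _ (Cosc q kp A A' * (4 ^+ k) `^ (q - 1) *
     ((Cweight kp * (2 ^ k)%N%:R) ^+ 2 * SM x))).
    apply: ler_wpM2l; first by apply: mulr_ge0; [exact: Cosc_ge0|exact: powR_ge0].
    exact: strong_max_weight.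
  rewrite exprMn pow2_sqr -(mulr_powRB1 (ltW (four0 k)) q0) /D.
  by rewrite le_eqVlt; apply/orP; left; apply/eqP; ring.
rewrite /Cextrapolate -/D; move: (CFS p) (CFS_ge0 p) => CF CF0.
set S := \sum_(j <- _) `|f j| `^ p.
rewrite [leRHS](_ : _ = CF * (D `^ (p / q) * (Cmax (p / q) ^+ 2 * S))); last by ring.
rewrite ler_wpM2l//.
under eq_bigr do rewrite powRM ?powR_ge0//.
have -> : D `^ (p / q) = (D `^ q^-1) `^ p by rewrite mulrC powRrM.
rewrite -mulr_sumr ler_wpM2l ?powR_ge0//.
exact: strong_max_root.
Qed.

Lemma lp_dual n (p A : R) a : 1 < p -> 0 <= A -> lp_bounded n p A a ->
  lp_bounded n (p / (p - 1)) ((A `^ p^-1) `^ (p / (p - 1))) (tr a).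
Proof.
move=> p1 A0 La f.
have p0 : 0 < p by exact: lt_trans p1.
have p10 : 0 < p - 1 by rewrite subr_gt0.
set p' := p / (p - 1); have p'0 : 0 < p' by rewrite divr_gt0.
have p'1 : 1 < p' by rewrite ltr_pdivlMr// mul1r ltrBlDr ltrDl.
have pp' : p'^-1 + p^-1 = 1 by rewrite invf_div; field; rewrite gt_eqF.
pose F := app n (tr a) f.
pose g i := Num.sg (F i) * `|F i| `^ (p' - 1).
have Fg i : `|F i| `^ p' = F i * g i.
  rewrite /g mulrA [F i * _]mulrC -normrEsg mulr_powRB1//.
have gp i : `|g i| `^ p = `|F i| `^ p'.
  rewrite /g normrM [X in _ * X]ger0_norm ?powR_ge0// powRM ?powR_ge0//.
  rewrite -powRrM; have -> : (p' - 1) * p = p'.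
    by rewrite /p'; field; rewrite gt_eqF.
  have [->|Fi0] := eqVneq (F i) 0; first by rewrite normr0 !powR0 ?gt_eqF// mulr0.
  by rewrite normr_sg Fi0 powR1 mul1r.
set X := \sum_(i <- box n) `|F i| `^ p'.
have XE : X = \sum_(j <- box n) f j * app n a g j.
  rewrite /X; under eq_bigr do rewrite Fg /F /app mulr_suml.
  rewrite exchange_big/=; apply: eq_bigr => j _; rewrite mulr_sumr.
  by apply: eq_bigr => i _; rewrite /tr; ring.
have X0 : 0 <= X by apply: sumr_ge0 => *; exact: powR_ge0.
apply: self_bound_powR; rewrite ?powR_ge0//.
  by apply: sumr_ge0 => *; exact: powR_ge0.
rewrite {1}XE; apply: (@le_trans _ _ (\sum_(j <- box n) `|f j| * `|app n a g j|)).
  by apply: ler_sum => j _; rewrite -normrM ler_norm.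
apply: le_trans (sum_holder _ p'0 p0 pp' (fun=> normr_ge0 _) (fun=> normr_ge0 _)) _.
rewrite mulrCA ler_wpM2l ?powR_ge0//.
have -> : 1 - p'^-1 = p^-1 by rewrite -pp' addrC addKr.
rewrite -powRM// ler_powR2r ?invr_ge0 ?(ltW p0)//.
  by apply: sumr_ge0 => *; exact: powR_ge0.
apply: le_trans (La g) _; rewrite ler_wpM2l//.
by apply: ler_sum => i _; rewrite gp.
Qed.

(** Extrapolation only raises the exponent. Below 2 it is applied to the transpose at the conjugate
    exponent, which exceeds 2, and dualized back. The constant is chosen before the matrix and its
    size. *)
Lemma lp_all (p kp A A' : R) : 1 < p -> 1 < kp -> 0 <= A -> 0 <= A' ->
  exists2 A2, 0 <= A2 & forall n a, lp_bounded n 2 A a ->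
    far_bounded n kp A' a -> far_bounded n kp A' (tr a) -> lp_bounded n p A2 a.
Proof.
move=> p1 kp1 A0 A'0.
have two1 : 1 < 2 :> R by rewrite ltr1n.
have [p2|p2|<-] := ltrgtP 2 p; last by exists A.
  exists (Cextrapolate p 2 kp A A'); first exact: Cextrapolate_ge0.
  by move=> n a La Fa _; exact: lp_extrapolate.
pose B2 := (A `^ 2^-1) `^ 2.
pose B3 := Cextrapolate (p / (p - 1)) 2 kp B2 A'.
pose p' := p / (p - 1).
have p10 : 0 < p - 1 by rewrite subr_gt0.
have p'2 : 2 < p' by rewrite ltr_pdivlMr//; lra.
exists ((B3 `^ p'^-1) `^ (p' / (p' - 1))); first exact: powR_ge0.
move=> n a La Fa Fta.
have L2t : lp_bounded n 2 B2 (tr a).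
  have := lp_dual two1 A0 La.
  by have -> : 2 / (2 - 1) = 2 :> R by field.
have L3t : lp_bounded n p' B3 (tr a).
  by apply: lp_extrapolate => //; rewrite powR_ge0.
have := lp_dual (lt_trans two1 p'2) (Cextrapolate_ge0 _ _ _ _ _) L3t.
have -> : p' / (p' - 1) = p.
  by rewrite /p'; field; rewrite gt_eqF//= mulNr addrC; lra.
by [].
Qed.

End discrete_operators.

(** * The commutator bound for matrices *)

Section discrete_commutator.
Context {R : realType}.

Lemma ler_sum_lincomb (T : Type) (s : seq T) (G1 G2 : T -> R) (d1 d2 X1 X2 : R) :
  0 <= d1 -> 0 <= d2 -> \sum_(x <- s) G1 x <= X1 -> \sum_(x <- s) G2 x <= X2 ->
  \sum_(x <- s) (d1 * G1 x + d2 * G2 x) <= d1 * X1 + d2 * X2.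
Proof.
by move=> d10 d20 h1 h2; rewrite big_split/= -!mulr_sumr lerD// ler_wpM2l.
Qed.

Lemma sum_holder_powR (T : eqType) (s : seq T) (X Y : T -> R) (u v : R) :
  0 < u -> 0 < v -> u + v = 1 -> (forall x, 0 <= X x) -> (forall x, 0 <= Y x) ->
  \sum_(x <- s) X x `^ u * Y x `^ v <=
  (\sum_(x <- s) X x) `^ u * (\sum_(x <- s) Y x) `^ v.
Proof.
move=> u0 v0 uv X0 Y0.
have iu0 : 0 < u^-1 by rewrite invr_gt0.
have iv0 : 0 < v^-1 by rewrite invr_gt0.
have iuv : u^-1^-1 + v^-1^-1 = 1 by rewrite !invrK.
have root (Z : T -> R) w : 0 < w -> (forall x, 0 <= Z x) ->
    \sum_(x <- s) (Z x `^ w) `^ w^-1 <= ((\sum_(x <- s) Z x) `^ w) `^ w^-1.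
  move=> w0 Z0; rewrite (powRK (lt0r_neq0 w0) (sumr_ge0 _ (fun x _ => Z0 x))).
  by apply: ler_sum => x _; rewrite (powRK (lt0r_neq0 w0) (Z0 x)).
apply: (sum_holder_le iu0 iv0 iuv); try exact: powR_ge0.
- by move=> x; exact: powR_ge0.
- by move=> x; exact: powR_ge0.
- exact: root.
- exact: root.
Qed.

Implicit Types (n k : nat) (c i j x : nat * nat) (a : nat * nat -> nat * nat -> R).
Implicit Types (f h F g b : nat * nat -> R).

(** On the square itself the weight is bounded below, so a plain sum is dominated by a weighted one;
    kp enters only through the constant. *)
Lemma sum_near_le n c k (kp mu : R) F x : 1 < kp -> subbox n c k ->
  x \in sqr c (2 ^ k) -> (forall y, 0 <= F y) ->
  \sum_(y <- sqr c (2 ^ k)) F y <=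
  4 ^+ k * ((5 `^ kp) ^+ 2 * Cweight kp ^+ 2 *
    strong_max (2 ^ n) (2 ^ n + 2 ^ n) F x).
Proof.
move=> kp1 sub xQ F0.
have kp0 : 0 <= kp by rewrite ltW// (lt_trans ltr01).
have l0 : (0 < 2 ^ k)%N by rewrite expn_gt0.
have [s1 s2 _ _] := subbox_bounds sub.
have := subbox_sub sub xQ; rewrite mem_sqr => /andP[/andP[_ x1] /andP[_ x2]].
have h := strong_max_weight kp1 l0 s1 s2 xQ x1 x2 F0.
rewrite [leRHS](_ : _ = (5 `^ kp) ^+ 2 * ((Cweight kp * (2 ^ k)%N%:R) ^+ 2 *
   strong_max (2 ^ n) (2 ^ n + 2 ^ n) F x)); last first.
  by rewrite [(Cweight kp * _) ^+ 2]exprMn pow2_sqr; ring.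
apply: le_trans (ler_wpM2l (sqr_ge0 _) h); rewrite mulr_sumr.
apply: (@le_trans _ _ (\sum_(y <- box n | y \in sqr c (2 ^ k)) F y)).
  rewrite -[leRHS]big_filter.
  apply: ler_sum_sub; rewrite ?sqr_uniq ?filter_uniq ?sqr_uniq// => y yQ _.
  by rewrite mem_filter yQ (subbox_sub sub yQ).
rewrite big_mkcond; apply: ler_sum => y _.
have w0 : 0 <= weight kp c (2 ^ k) y by exact: weight_ge0.
case: ifPn => yQ; last by apply: mulr_ge0; [exact: sqr_ge0|exact: mulr_ge0].
by rewrite mulrA -[X in X <= _]mul1r ler_wpM2r// near_weight// near_self.
Qed.

Lemma weight_split (kp kp1 kp2 t : R) c l y : (0 < l)%N -> 0 < t ->
  kp = kp1 * (1 - t^-1) + kp2 * t^-1 ->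
  weight kp c l y = weight kp1 c l y `^ (1 - t^-1) * weight kp2 c l y `^ t^-1.
Proof.
move=> l0 t0 E; rewrite /weight !powRM ?decayw_ge0//.
have one d : decayw kp l d =
    decayw kp1 l d `^ (1 - t^-1) * decayw kp2 l d `^ t^-1.
  have lp : 0 < l%:R :> R by rewrite ltr0n.
  have ldp : 0 < (l + d)%:R :> R by rewrite ltr0n addn_gt0 l0.
  rewrite /decayw -!powRrM -powRD; first by rewrite -E.
  by apply/implyP => _; rewrite gt_eqF// divr_gt0.
move: (one (ndist y.1 c.1)) (one (ndist y.2 c.2)) => {one} -> ->.
move: (decayw kp1 l (ndist y.1 c.1) `^ _) (decayw kp1 l (ndist y.2 c.2) `^ _).
move: (decayw kp2 l (ndist y.1 c.1) `^ _) (decayw kp2 l (ndist y.2 c.2) `^ _).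
by move=> u v u' v'; ring.
Qed.

Lemma weight_le_decayw (kp kp' : R) c l y : 0 <= kp' -> kp' <= kp -> (0 < l)%N ->
  weight kp c l y <= decayw kp' l (maxn (ndist y.1 c.1) (ndist y.2 c.2)).
Proof.
move=> kp0 kk l0; apply: le_trans (_ : weight kp' c l y <= _).
  by rewrite /weight ler_pM ?decayw_ge0// decayw_exponent.
rewrite /weight; case: (leqP (ndist y.1 c.1) (ndist y.2 c.2)) => _.
  by rewrite -[leRHS]mul1r ler_wpM2r ?decayw_ge0// decayw_le1.
by rewrite -[leRHS]mulr1 ler_wpM2l ?decayw_ge0// decayw_le1.
Qed.

Definition Cproduct (k1 r t : R) : R :=
  (Cweight k1 ^+ 2) `^ (1 - t^-1) * Cbmo r `^ t^-1.

Lemma Cproduct_ge0 (k1 r t : R) : 0 <= Cproduct k1 r t.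
Proof. by rewrite mulr_ge0 ?powR_ge0. Qed.

(** Hölder with exponent t on the BMO factor. The weight is shared so that f keeps an exponent k1 >
    1, enough for the strong maximal function, and the powers of b receive k2 >= 5, enough for
    [bmo_weighted]. *)
Lemma weighted_bmo_product (s t q r kp k1 k2 : R) n c k b f x (beta : R) :
  0 < s -> 1 < t -> q = s * (1 - t^-1) -> r = q * t -> 1 < r ->
  kp = k1 * (1 - t^-1) + k2 * t^-1 -> 1 < k1 -> 5 <= k2 ->
  0 <= beta ->
  discrete_bmo b beta -> subbox n c k -> x \in sqr c (2 ^ k) ->
  \sum_(j <- box n) weight kp c (2 ^ k) j *
    `|(b j - savg b c k) * f j| `^ q <=
  4 ^+ k * (Cproduct k1 r t * beta `^ q *
    (strong_max (2 ^ n) (2 ^ n + 2 ^ n) (fun y => `|f y| `^ s) x `^ s^-1) `^ q).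
Proof.
move=> s0 t1 qE rE r1 kE k11 k25 beta0 bmo sub xQ.
have t0 : 0 < t by exact: lt_trans t1.
have tV : t^-1 * t = 1 by rewrite mulVf// gt_eqF.
have u0 : 0 < 1 - t^-1 by rewrite subr_gt0 invf_lt1.
have rt : r / t = q by rewrite rE mulfK ?gt_eqF.
have sq : s^-1 * q = 1 - t^-1 by rewrite qE mulKf ?gt_eqF.
have l0 : (0 < 2 ^ k)%N by rewrite expn_gt0.
have [b1 b2 _ _] := subbox_bounds sub.
have := subbox_sub sub xQ; rewrite mem_sqr => /andP[/andP[_ x1] /andP[_ x2]].
have four0 : 0 < 4 ^+ k :> R by rewrite exprn_gt0.
set bQ := savg b c k; set M := strong_max _ _ _ _.
have M0 : 0 <= M by exact: strong_max_ge0.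
pose X1 j := weight k1 c (2 ^ k) j * `|f j| `^ s.
pose X2 j := weight k2 c (2 ^ k) j * `|b j - bQ| `^ r.
have X10 j : 0 <= X1 j by apply: mulr_ge0; rewrite ?powR_ge0 ?weight_ge0.
have X20 j : 0 <= X2 j by apply: mulr_ge0; rewrite ?powR_ge0 ?weight_ge0.
have -> : \sum_(j <- box n) weight kp c (2 ^ k) j * `|(b j - bQ) * f j| `^ q =
    \sum_(j <- box n) X1 j `^ (1 - t^-1) * X2 j `^ t^-1.
  apply: eq_bigr => j _; rewrite (weight_split c j l0 t0 kE) normrM /X1 /X2.
  rewrite [(_ * `|f j| `^ s) `^ _]powRM ?weight_ge0 ?powR_ge0//.
  rewrite [(_ * `|b j - bQ| `^ r) `^ _]powRM ?weight_ge0 ?powR_ge0//.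
  rewrite (powRM q (normr_ge0 _) (normr_ge0 _)) -[(_ `^ s) `^ _]powRrM -[(_ `^ r) `^ _]powRrM -qE rt.
  move: (_ `^ (1 - _)) (_ `^ t^-1) (`|b j - bQ| `^ _) (`|f j| `^ _) => u v w z.
  by ring.
have tV00 : 0 < t^-1 by rewrite invr_gt0.
have uv1 : 1 - t^-1 + t^-1 = 1 by rewrite subrK.
apply: le_trans (sum_holder_powR _ u0 tV00 uv1 X10 X20) _.
have hX : \sum_(j <- box n) X1 j <= 4 ^+ k * (Cweight k1 ^+ 2 * M).
  rewrite -pow2_sqr mulrA -exprMn [_ * Cweight _]mulrC.
  by apply: strong_max_weight => // y; exact: powR_ge0.
have hY : \sum_(j <- box n) X2 j <= 4 ^+ k * (Cbmo r * beta `^ r).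
  rewrite [leRHS]mulrCA.
  have kn := subbox_le sub; move: (sub) => /and4P[d1 d2 d3 d4].
  apply: le_trans (bmo_weighted beta0 r1 bmo kn d1 d2 d3 d4).
  apply: ler_sum => j _; rewrite /X2 -/bQ.
  apply: ler_wpM2r; first exact: powR_ge0.
  exact: weight_le_decayw.
have X0 : 0 <= \sum_(j <- box n) X1 j by exact: sumr_ge0.
have Y0 : 0 <= \sum_(j <- box n) X2 j by exact: sumr_ge0.
have tV0 : 0 <= t^-1 by rewrite invr_ge0 ltW.
apply: le_trans (ler_pM (powR_ge0 _ _) (powR_ge0 _ _)
  (ler_powR2r (ltW u0) X0 hX) (ler_powR2r tV0 Y0 hY)) _.
have B0 : 0 <= Cbmo r by exact: Cbmo_ge0.
have c0 : 0 <= Cweight k1 ^+ 2 by exact: sqr_ge0.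
rewrite /Cproduct; move: (Cbmo r) (Cweight k1 ^+ 2) (4 ^+ k) B0 c0 four0
  => B cw F B0 cw0 F0.
rewrite (powRM _ (ltW F0) (mulr_ge0 cw0 M0)) (powRM _ cw0 M0).
rewrite (powRM _ (ltW F0) (mulr_ge0 B0 (powR_ge0 _ _))) (powRM _ B0 (powR_ge0 _ _)).
rewrite -[(beta `^ r) `^ _]powRrM -[(M `^ _) `^ _]powRrM rt sq.
have four1 : F `^ (1 - t^-1) * F `^ t^-1 = F.
  by rewrite -powRD ?subrK ?powRr1 ?(ltW F0)// oner_eq0.
rewrite -[in leRHS]four1.
move: (F `^ _) (F `^ _) (cw `^ _) (M `^ _) (B `^ _) (beta `^ _) => z1 z2 z3 z4 z5 z6.
by rewrite le_eqVlt; apply/orP; left; apply/eqP; ring.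
Qed.

Section exponents.
Variables (p kp A A' : R).
Hypotheses (p1 : 1 < p) (kp1 : 1 < kp) (A0 : 0 <= A) (A'0 : 0 <= A').

(** The exponents: s is midway between 1 and p; t > s / (s - 1) forces q > 1; t (kp - 1) > 8 forces
    k2 > 5, while k1 keeps half of the excess of kp over 1. *)
Let s := (1 + p) / 2.
Let t := 8 / (kp - 1) + 2 * (s / (s - 1)).
Let q := s * (1 - t^-1).
Let r := q * t.
Let k1 := 1 + (kp - 1) / 2.
Let k2 := k1 + t * ((kp - 1) / 2).

Let s1 : 1 < s. Proof. by move: p1; rewrite /s; lra. Qed.
Let sp : s < p. Proof. by move: p1; rewrite /s; lra. Qed.
Let s0 : 0 < s. Proof. exact: lt_trans s1. Qed.
Let s10 : 0 < s - 1. Proof. by rewrite subr_gt0. Qed.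
Let e0 : 0 < kp - 1. Proof. by rewrite subr_gt0. Qed.
Let t_gt : 2 * (s / (s - 1)) < t. Proof. by rewrite ltrDr divr_gt0. Qed.
Let ss1 : 1 < s / (s - 1). Proof. by rewrite ltr_pdivlMr// mul1r; lra. Qed.
Let t1 : 1 < t. Proof. by move: t_gt ss1; lra. Qed.
Let t0 : 0 < t. Proof. exact: lt_trans t1. Qed.
Let tV : t^-1 * t = 1. Proof. by rewrite mulVf// gt_eqF. Qed.
Let te : 8 < t * (kp - 1).
Proof.
rewrite mulrDl divfK ?gt_eqF// ltrDl mulr_gt0// mulr_gt0//.
by rewrite divr_gt0.
Qed.
Let q1 : 1 < q.
Proof.
have : s / (s - 1) < t by move: t_gt ss1; lra.
rewrite ltr_pdivrMr// => h; rewrite /q -(ltr_pM2r t0).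
have -> : s * (1 - t^-1) * t = s * t - s * (t^-1 * t) by ring.
by rewrite tV; move: h; lra.
Qed.
Let q0 : 0 < q. Proof. exact: lt_trans q1. Qed.
Let r1 : 1 < r. Proof. by move: q1 t1; rewrite /r; nra. Qed.
Let kE : kp = k1 * (1 - t^-1) + k2 * t^-1.
Proof.
have -> : k2 * t^-1 = k1 * t^-1 + (kp - 1) / 2 * (t^-1 * t) by rewrite /k2; ring.
by rewrite tV /k1; move: (t^-1) => u; field.
Qed.
Let k11 : 1 < k1. Proof. by move: kp1; rewrite /k1; lra. Qed.
Let k25 : 5 <= k2. Proof. by move: te kp1; rewrite /k2 /k1; lra. Qed.
Let u0 : 0 < 1 - t^-1.
Proof. by rewrite subr_gt0 invf_lt1. Qed.

Let SM n f x := strong_max (2 ^ n) (2 ^ n + 2 ^ n) (fun y => `|f y| `^ s) x.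

Let C1 := Cproduct k1 r t.

Let C1_ge0 : 0 <= C1. Proof. exact: Cproduct_ge0. Qed.

Theorem discrete_commutator : exists2 C : R, 0 <= C &
  forall n a b (beta : R), lp_bounded n 2 A a ->
    far_bounded n kp A' a -> far_bounded n kp A' (tr a) ->
    0 <= beta -> discrete_bmo b beta ->
    forall f, \sum_(x <- box n) `|comm n b a f x| `^ p <=
      C * beta `^ p * \sum_(x <- box n) `|f x| `^ p.
Proof.
have [Aq Aq0 LAq] := lp_all q1 kp1 A0 A'0.
have [Ap Ap0 LAp] := lp_all p1 kp1 A0 A'0.
pose D1 := (Cosc q kp Aq A' * C1) `^ q^-1.
pose s' := s / (s - 1).
have s'1 : 1 < s' by exact: ss1.
have s'0 : 0 < s' by exact: lt_trans s'1.
have ss' : s'^-1 + s^-1 = 1 by rewrite invf_div; field; rewrite gt_eqF.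
pose D2 := 32 * s' * ((5 `^ kp) ^+ 2 * Cweight kp ^+ 2) `^ s^-1.
have D10 : 0 <= D1 by exact: powR_ge0.
have D20 : 0 <= D2 by rewrite mulr_ge0 ?powR_ge0// mulr_ge0// ltW.
pose D := CFS p * (2 `^ p * ((D1 `^ p + D2 `^ p * Ap) * Cmax (p / s) ^+ 2)).
have D0 : 0 <= D.
  apply: mulr_ge0; first exact: CFS_ge0.
  apply: mulr_ge0; first exact: powR_ge0.
  by apply: mulr_ge0; rewrite ?sqr_ge0// addr_ge0 ?mulr_ge0 ?powR_ge0.
exists D => // n a b beta L2 Fa Fta beta0 bmo f.
have Lq := LAq n a L2 Fa Fta; have Lp := LAp n a L2 Fa Fta.
have p0 : 0 < p by exact: lt_trans p1.
pose Tf := app n a f.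
pose g x := beta * (D1 * SM n f x `^ s^-1 + D2 * SM n Tf x `^ s^-1).
have g0 x : 0 <= g x by rewrite mulr_ge0// addr_ge0// mulr_ge0// powR_ge0.
have osc c k : subbox n c k -> exists m : R,
    (all (near_sqr c (2 ^ k)) (box n) -> m = 0) /\
    forall x, x \in sqr c (2 ^ k) ->
      \sum_(y <- sqr c (2 ^ k)) `|comm n b a f y - m| <= 4 ^+ k * g x.
  (* Subtracting the constant b_Q from b does not change the commutator, which on Q equals (b - b_Q)
     Tf minus the matrix applied to h. The second term goes to [oscillation] at exponent q, the
     first to Hölder with [john_nirenberg] at the exponent conjugate to s. The sign of the second
     term explains the centre - m. *)
  move=> sub; pose bQ := savg b c k; pose h j := (b j - bQ) * f j.
  have [m [m0 hm]] := oscillation h q1 kp1 Aq0 A'0 Lq Fa sub.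
  exists (- m); split => [/m0 ->|x xQ]; first by rewrite oppr0.
  have four0 : 0 < 4 ^+ k :> R by rewrite exprn_gt0.
  have SM0 F : 0 <= SM n F x by exact: strong_max_ge0.
  apply: (@le_trans _ _ (\sum_(y <- sqr c (2 ^ k)) `|b y - bQ| * `|Tf y| +
      \sum_(y <- sqr c (2 ^ k)) `|app n a h y - m|)).
    rewrite -big_split/=; apply: ler_sum => y _; rewrite -normrM.
    have -> : comm n b a f y - - m = (b y - bQ) * Tf y - (app n a h y - m).
      rewrite opprB opprK addrCA addrC; congr (_ + _).
      rewrite /Tf /app mulr_sumr -sumrB; apply: eq_bigr => j _.
      by rewrite /h; ring.
    exact: ler_normB.
  rewrite /g mulrDr mulrDr [leLHS]addrC; apply: lerD.
    apply: (@ler_powR_inv _ q) => //; first exact: sumr_ge0.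
      by rewrite !mulr_ge0 ?powR_ge0// ltW.
    apply: le_trans hm _.
    have qE : q = s * (1 - t^-1) by [].
    have rE : r = q * t by [].
    have := weighted_bmo_product f s0 t1 qE rE r1 kE k11 k25 beta0 bmo sub xQ.
    set Z := \sum_(j <- _) _; set y1 := (strong_max _ _ _ _) `^ s^-1 => hZ.
    have y10 : 0 <= y1 by exact: powR_ge0.
    have CO0 : 0 <= Cosc q kp Aq A' by exact: Cosc_ge0.
    apply: le_trans (ler_wpM2l _ hZ) _; first by rewrite mulr_ge0 ?powR_ge0.
    rewrite [X in _ <= X](_ : _ = (4 ^+ k) `^ q * (beta `^ q * (D1 `^ q * y1 `^ q))); last first.
      by rewrite powRM ?(ltW four0) ?mulr_ge0// powRM ?mulr_ge0// powRM.
    rewrite /D1 powR_invK ?gt_eqF//; last exact: (mulr_ge0 CO0 C1_ge0).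
    rewrite -(mulr_powRB1 (ltW four0) q0) /C1.
    by rewrite le_eqVlt; apply/orP; left; apply/eqP; ring.
  apply: le_trans (sum_holder _ s'0 s0 ss' (fun=> normr_ge0 _) (fun=> normr_ge0 _)) _.
  have jn := john_nirenberg beta0 s'1 bmo c k.
  have nb := @sum_near_le n c k kp 0 (fun y => `|Tf y| `^ s) x kp1 sub xQ
     (fun=> powR_ge0 _ _).
  apply: le_trans (ler_pM (powR_ge0 _ _) (powR_ge0 _ _)
    (ler_powR2r _ _ jn) (ler_powR2r _ _ nb)) _.
  - by rewrite invr_ge0 ltW.
  - by apply: sumr_ge0 => *; exact: powR_ge0.
  - by rewrite invr_ge0 ltW.
  - by apply: sumr_ge0 => *; exact: powR_ge0.
  have c0 : 0 <= (5 `^ kp) ^+ 2 * Cweight kp ^+ 2 by rewrite mulr_ge0 ?sqr_ge0.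
  have s320 : 0 <= 32 * s' by rewrite mulr_ge0// ltW.
  have SMT := SM0 Tf.
  rewrite [X in X * _](_ : _ = 32 * s' * ((4 ^+ k) `^ s'^-1 * beta)); last first.
    rewrite (powRM _ (powR_ge0 _ _) (mulr_ge0 (ltW four0) (powR_ge0 _ _))).
    rewrite (powRM _ (ltW four0) (powR_ge0 _ _)).
    by rewrite (powRK (lt0r_neq0 s'0) s320) (powRK (lt0r_neq0 s'0) beta0).
  rewrite [X in _ * X](_ : _ = (4 ^+ k) `^ s^-1 *
     (((5 `^ kp) ^+ 2 * Cweight kp ^+ 2) `^ s^-1 * SM n Tf x `^ s^-1)); last first.
    by rewrite (powRM _ (ltW four0) (mulr_ge0 c0 SMT)) (powRM _ c0 SMT).
  have four1 : (4 ^+ k) `^ s'^-1 * (4 ^+ k) `^ s^-1 = 4 ^+ k :> R.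
    by rewrite -powRD ?ss' ?powRr1 ?(ltW four0)// oner_eq0.
  rewrite -[in leRHS]four1 /D2.
  move: (32 * s') (_ `^ s'^-1) (_ `^ s^-1) (_ `^ s^-1) (_ `^ s^-1) => z1 z2 z3 z4 z5.
  by rewrite le_eqVlt; apply/orP; left; apply/eqP; ring.
apply: le_trans (fefferman_stein_box p1 g0 osc) _.
rewrite /D; move: (CFS p) (CFS_ge0 p) => CF CF0.
set S := \sum_(x <- box n) `|f x| `^ p.
rewrite [leRHS](_ : _ = CF * (beta `^ p * (2 `^ p *
   (D1 `^ p * (Cmax (p / s) ^+ 2 * S) +
    D2 `^ p * (Cmax (p / s) ^+ 2 * (Ap * S)))))); last by ring.
rewrite ler_wpM2l//.
apply: (@le_trans _ _ (\sum_(x <- box n) beta `^ p * (2 `^ p *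
   (D1 `^ p * (SM n f x `^ s^-1) `^ p + D2 `^ p * (SM n Tf x `^ s^-1) `^ p)))).
  apply: ler_sum => x _; rewrite /g.
  have v1 : 0 <= D1 * SM n f x `^ s^-1 by rewrite (mulr_ge0 D10) ?powR_ge0.
  have v2 : 0 <= D2 * SM n Tf x `^ s^-1 by rewrite (mulr_ge0 D20) ?powR_ge0.
  rewrite (powRM _ beta0 (addr_ge0 v1 v2)); apply: ler_wpM2l; first exact: powR_ge0.
  rewrite -(powRM _ D10 (powR_ge0 _ _)) -(powRM _ D20 (powR_ge0 _ _)).
  exact: powR_add_le (ltW p0) v1 v2.
rewrite -mulr_sumr ler_wpM2l ?powR_ge0// -mulr_sumr ler_wpM2l ?powR_ge0//.
have e1 := strong_max_root n f s0 sp.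
have e2 := strong_max_root n Tf s0 sp.
have e3 := Lp f.
apply: ler_sum_lincomb; rewrite ?powR_ge0//.
by apply: le_trans e2 _; apply: ler_wpM2l; [exact: sqr_ge0|exact: e3].
Qed.

End exponents.

End discrete_commutator.

(** * Averages of the kernel over cells *)

Section integral_without_measurability.
Context d (X : measurableType d) (R : realType) (mu : {measure set X -> \bar R}).
Implicit Types (D : set X).

(* The integral of an arbitrary function is monotone: it is a difference of
   suprema over the simple functions lying below the positive and negative
   parts. *)
Lemma integral_monotone D (f g : X -> \bar R) :
  (forall x, D x -> (f x <= g x)%E) ->
  (\int[mu]_(x in D) f x <= \int[mu]_(x in D) g x)%E.
Proof.
move=> fg; have fgD x : ((f \_ D) x <= (g \_ D) x)%E.
  by rewrite !patchE; case: ifPn => // /set_mem; exact: fg.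
rewrite /integral; apply: leeB; apply: le_ereal_sup => _ [h hle <-] /=;
  exists h => //= x; apply: le_trans (hle x) _.
- by rewrite !funeposE ge_max !le_max fgD/= lexx orbT.
- by rewrite !funenegE ge_max !le_max leeN2 fgD/= lexx orbT.
Qed.

(** Two applications of monotonicity, against H and - H, stand in for the triangle inequality, whose
    usual proof needs an additive integral and hence a measurable f. *)
Lemma Rintegral_abs_le D (f : X -> R) (H : X -> \bar R) :
  (forall x, D x -> (`|f x|%:E <= H x)%E) ->
  (\int[mu]_(x in D) H x < +oo)%E ->
  `|\int[mu]_(x in D) f x| <= fine (\int[mu]_(x in D) H x).
Proof.
move=> fH Hfin.
have H0 x : D x -> (0 <= H x)%E.
  by move=> /fH; apply: le_trans; rewrite lee_fin.
have IH0 : (0 <= \int[mu]_(x in D) H x)%E by exact: integral_ge0.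
have IHf : (\int[mu]_(x in D) H x)%E \is a fin_num by rewrite ge0_fin_numE.
have up : (\int[mu]_(x in D) (f x)%:E <= \int[mu]_(x in D) H x)%E.
  apply: integral_monotone => x Dx; apply: le_trans (fH x Dx).
  by rewrite lee_fin ler_norm.
have lo : (- (\int[mu]_(x in D) H x) <= \int[mu]_(x in D) (f x)%:E)%E.
  rewrite -integral_ge0N//; apply: integral_monotone => x Dx.
  rewrite leeNl; apply: le_trans (fH x Dx).
  by rewrite -EFinN lee_fin -normrN ler_norm.
have If : (\int[mu]_(x in D) (f x)%:E)%E \is a fin_num.
  rewrite fin_numE; apply/andP; split.
    by apply/eqP => E; move: lo; rewrite E leeNy_eq -(fineK IHf).
  by apply/eqP => E; move: up; rewrite E leye_eq -(fineK IHf).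
by rewrite /Rintegral ler_norml -!lee_fin EFinN !fineK// lo up.
Qed.

Lemma Rintegral_monotone D (f g : X -> R) :
  (forall x, D x -> f x <= g x) ->
  (\int[mu]_(x in D) (f x)%:E)%E \is a fin_num ->
  (\int[mu]_(x in D) (g x)%:E)%E \is a fin_num ->
  \int[mu]_(x in D) f x <= \int[mu]_(x in D) g x.
Proof.
move=> fg If Ig; rewrite /Rintegral fine_le//.
by apply: integral_monotone => x Dx; rewrite lee_fin fg.
Qed.

(* If [f] oscillates by at most [eta] around [k] on [E] and vanishes elsewhere,
   its integral is close to [k * mu E], even if [f] is not measurable. *)
Lemma Rintegral_near_cst D E (f : X -> R) (k eta : R) :
  measurable D -> measurable E -> E `<=` D -> (mu E < +oo)%E -> 0 <= eta ->
  (forall x, E x -> `|f x - k| <= eta) -> (forall x, D x -> ~ E x -> f x = 0) ->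
  `|\int[mu]_(x in D) f x - k * fine (mu E)| <= eta * fine (mu E).
Proof.
move=> mD mE ED Efin eta0 fk f0.
have muE : mu E \is a fin_num by rewrite ge0_fin_numE.
have cstE r : (\int[mu]_(x in D) (r * \1_E x)%:E)%E = (r * fine (mu E))%:E.
  under eq_integral do rewrite EFinM.
  rewrite integralZl//; last first.
    apply/integrableP; split; first exact/measurable_EFinP.
    under eq_integral do rewrite gee0_abs ?lee_fin//.
    by rewrite integral_indic// setIidl.
  by rewrite integral_indic// setIidl// -[mu E]fineK.
have bnd x : D x -> (k - eta) * \1_E x <= f x <= (k + eta) * \1_E x.
  move=> Dx; rewrite indicE; case: (boolP (x \in E)) => xE.
    move: (fk x (set_mem xE)); rewrite ler_norml => /andP[h1 h2].
    by apply/andP; split; rewrite mulr1; lra.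
  have fx0 : f x = 0 by apply: f0 => // Ex; move: xE; rewrite (mem_set Ex).
  by rewrite fx0 !mulr0 lexx.
have If : (\int[mu]_(x in D) (f x)%:E)%E \is a fin_num.
  have lo : (((k - eta) * fine (mu E))%:E <= \int[mu]_(x in D) (f x)%:E)%E.
    rewrite -cstE; apply: integral_monotone => x Dx.
    by rewrite lee_fin; case/andP: (bnd x Dx).
  have up : (\int[mu]_(x in D) (f x)%:E <= ((k + eta) * fine (mu E))%:E)%E.
    rewrite -cstE; apply: integral_monotone => x Dx.
    by rewrite lee_fin; case/andP: (bnd x Dx).
  rewrite fin_numE; apply/andP; split.
    by apply/eqP => E'; move: lo; rewrite E' leeNy_eq.
  by apply/eqP => E'; move: up; rewrite E' leye_eq.
have cstR r : \int[mu]_(x in D) (r * \1_E x) = r * fine (mu E).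
  by rewrite /Rintegral cstE.
have fin r : (\int[mu]_(x in D) (r * \1_E x)%:E)%E \is a fin_num by rewrite cstE.
have h1 : (k - eta) * fine (mu E) <= \int[mu]_(x in D) f x.
  rewrite -cstR; apply: Rintegral_monotone => // x Dx.
  by case/andP: (bnd x Dx).
have h2 : \int[mu]_(x in D) f x <= (k + eta) * fine (mu E).
  rewrite -cstR; apply: Rintegral_monotone => // x Dx.
  by case/andP: (bnd x Dx).
by rewrite ler_norml; apply/andP; split; lra.
Qed.

End integral_without_measurability.

Section area_of_squares.
Context (R : realType).
Implicit Types (a : plane R) (l : R).

Lemma measurable_square a l : measurable (square a l).
Proof. by apply: measurableX; exact: measurable_itv. Qed.

Lemma lebesgue_measure_itvco (u l : R) : 0 <= l ->
  @lebesgue_measure R `[u, u + l[%classic = l%:E.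
Proof.
move=> l0; rewrite lebesgue_measure_itv/= lte_fin ltrDl.
move: l0; rewrite le_eqVlt => /predU1P[<-|->]; first by rewrite ltxx.
by rewrite -EFinB addrAC subrr add0r.
Qed.

Lemma area_square a l : 0 <= l -> area R (square a l) = (l ^+ 2)%:E.
Proof.
move=> l0; rewrite /area /square product_measure1E//.
rewrite [X in (X * _)%E](_ : _ = l%:E); last exact: lebesgue_measure_itvco.
rewrite [X in (_ * X)%E](_ : _ = l%:E); last exact: lebesgue_measure_itvco.
by rewrite -EFinM.
Qed.

Lemma area_square_fin a l : 0 <= l -> (area R (square a l) < +oo)%E.
Proof. by move=> l0; rewrite area_square// ltry. Qed.

Lemma squareP a l x : square a l x <->
  (a.1 <= x.1 < a.1 + l) /\ (a.2 <= x.2 < a.2 + l).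
Proof. by rewrite /square /=; split => -[]; rewrite /= !in_itv/=. Qed.

End area_of_squares.

(** * Pointwise estimates of the kernel *)

Section kernel_estimates.
Context (R : realType).
Implicit Types (x y w : plane R).

Lemma powR_lt1_antitone (a u v : R) : 0 < a <= 1 -> u <= v -> a `^ v <= a `^ u.
Proof. by move=> a1 uv; exact: ger_powR. Qed.

Lemma powRV (a u : R) : 0 <= a -> a^-1 `^ u = a `^ (- u).
Proof. by move=> a0; rewrite -powR_inv1// -powRrM mulN1r. Qed.

(* Here [a] and [b] stand for the ratios of the side of a square to the two
   coordinates of the distance between the arguments of the kernel. *)
Lemma scaled_decay (t1 t2 e a b D : R) :
  0 < a <= 1 -> 0 < b <= 1 -> 0 < e -> 2 * e <= t1 -> 2 * e <= t2 -> 0 <= D ->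
  D <= (b / a) `^ t2 -> D <= (a / b) `^ t2 ->
  a `^ (1 + t1) * b * D <= (a * b) `^ (1 + e).
Proof.
move=> /andP[a0 a1] /andP[b0 b1] e0 et1 et2 D0 D1 D2.
have ab0 : 0 <= a * b by rewrite mulr_ge0 ?ltW.
have e1 : 0 <= 2 * e by lra.
suff h : a `^ t1 * D <= (a * b) `^ e.
  have anz : a != 0 by rewrite gt_eqF.
  have abnz : a * b != 0 by rewrite mulf_neq0// gt_eqF.
  rewrite !powRD ?anz ?abnz ?implybT// !powRr1 ?(ltW a0)//.
  rewrite [leLHS](_ : _ = a * b * (a `^ t1 * D)); last by ring.
  by rewrite ler_wpM2l.
(* If b is the smaller ratio, D converts a^(2e) into b^(2e); otherwise a^(2e) is already small
   enough and D <= 1. Either way the square of the smaller ratio is at most a b, which is why e is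
   half of an exponent. *)
have [ba|ab] := leP b a.
  apply: (@le_trans _ _ (a `^ (2 * e) * (b / a) `^ (2 * e))).
    apply: ler_pM; rewrite ?powR_ge0//.
      by apply: powR_lt1_antitone => //; rewrite a0.
    apply: le_trans D1 _; apply: powR_lt1_antitone => //.
    by rewrite divr_gt0// ler_pdivrMr// mul1r.
  rewrite -powRM ?divr_ge0 ?(ltW a0) ?(ltW b0)// mulrC divfK ?gt_eqF//.
  rewrite powRrM; apply: ler_powR2r; rewrite ?powR_ge0 ?(ltW e0)//.
  by rewrite powR_mulrn ?(ltW b0)// expr2 ler_wpM2r// ltW.
apply: (@le_trans _ _ (a `^ (2 * e) * 1)).
  apply: ler_pM; rewrite ?powR_ge0//.
    by apply: powR_lt1_antitone => //; rewrite a0.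
  apply: le_trans D2 _; rewrite -[leRHS](powRr0 (a / b)).
  apply: powR_lt1_antitone; last by apply: le_trans et2.
  by rewrite divr_gt0// ler_pdivrMr// mul1r ltW.
rewrite mulr1 powRrM; apply: ler_powR2r; rewrite ?powR_ge0 ?(ltW e0)//.
by rewrite powR_mulrn ?(ltW a0)// expr2 ler_wpM2l ?(ltW a0)// ltW.
Qed.

Lemma decay_le (t u v : R) : 0 < u -> 0 < v -> 0 < t ->
  (u / v + v / u) `^ (- t) <= (u / v) `^ t.
Proof.
move=> u0 v0 t0.
have uv0 : 0 < u / v by rewrite divr_gt0.
have vu0 : 0 < v / u by rewrite divr_gt0.
rewrite powRN -[leRHS]invrK lef_pV2 ?posrE ?invr_gt0 ?powR_gt0 ?addr_gt0//.
rewrite -powRN -powRV ?(ltW uv0)// invf_div.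
by apply: ler_powR2r; rewrite ?(ltW t0) ?(ltW vu0)// lerDr ltW.
Qed.

Lemma decay_le' (t u v : R) : 0 < u -> 0 < v -> 0 < t ->
  (u / v + v / u) `^ (- t) <= (v / u) `^ t.
Proof. by move=> u0 v0 t0; rewrite addrC; exact: decay_le. Qed.

(* [L] is the side of a square, [u, v] the coordinates of the distance, which
   are comparable to [N1, N2], and [t <= L] is the displacement. *)
Lemma kernel_move (th1 th2 e L u v N1 N2 t : R) :
  0 < th1 -> 0 < th2 -> 0 < e -> e <= 1 -> 2 * e <= th1 -> 2 * e <= th2 ->
  0 < L -> 5 * L <= N1 -> 5 * L <= N2 ->
  3 / 5 * N1 <= u -> 3 / 5 * N2 <= v -> 0 <= t <= L ->
  (t `^ th1 / u `^ (1 + th1)) * (1 / v) * (u / v + v / u) `^ (- th2) <=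
  9 * L ^- 2 * ((L / N1) `^ (1 + e) * (L / N2) `^ (1 + e)).
Proof.
move=> th10 th20 e0 e1 et1 et2 L0 LN1 LN2 uN vN /andP[t0 tL].
have N10 : 0 < N1 by lra.
have N20 : 0 < N2 by lra.
have u0 : 0 < u by lra.
have v0 : 0 < v by lra.
pose a := L / u; pose b := L / v.
have a01 : 0 < a <= 1 by rewrite divr_gt0//= ler_pdivrMr// mul1r; lra.
have b01 : 0 < b <= 1 by rewrite divr_gt0//= ler_pdivrMr// mul1r; lra.
have ba : b / a = u / v by rewrite /a /b; field; rewrite !gt_eqF.
have ab : a / b = v / u by rewrite /a /b; field; rewrite !gt_eqF.
have := @scaled_decay th1 th2 e a b ((u / v + v / u) `^ (- th2)) a01 b01 e0 et1 et2.
rewrite ba ab => /(_ (powR_ge0 _ _) (decay_le u0 v0 th20) (decay_le' u0 v0 th20)) h.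
apply: (@le_trans _ _ (L ^- 2 * (a * b) `^ (1 + e))).
  apply: le_trans (_ : L ^- 2 * (a `^ (1 + th1) * b *
     (u / v + v / u) `^ (- th2)) <= _); last first.
    by rewrite ler_wpM2l// invr_ge0 exprn_ge0// ltW.
  rewrite !mulrA ler_wpM2r ?powR_ge0//.
  have -> : a `^ (1 + th1) = L * L `^ th1 / u `^ (1 + th1).
    rewrite /a powRM ?(ltW L0) ?invr_ge0 ?(ltW u0)//.
    rewrite powRV ?(ltW u0)// powRN [L `^ _]powRD ?(lt0r_neq0 L0) ?implybT//.
    by rewrite powRr1 ?(ltW L0).
  rewrite /b [leRHS](_ : _ = L `^ th1 / u `^ (1 + th1) / v); last first.
    by field; rewrite !gt_eqF ?powR_gt0.
  rewrite mulr1 ler_wpM2r ?invr_ge0 ?(ltW v0)// ler_wpM2r ?invr_ge0 ?powR_ge0//.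
  by apply: ler_powR2r; rewrite ?(ltW th10).
rewrite [leRHS](_ : _ = L ^- 2 * (9 * ((L / N1) `^ (1 + e) *
  (L / N2) `^ (1 + e)))); last by ring.
rewrite ler_wpM2l ?invr_ge0 ?exprn_ge0 ?(ltW L0)//.
have q1 : 0 <= L / N1 by rewrite divr_ge0 ?(ltW L0) ?(ltW N10).
have q2 : 0 <= L / N2 by rewrite divr_ge0 ?(ltW L0) ?(ltW N20).
rewrite -(powRM _ q1 q2).
have LN0 : 0 <= L / N1 * (L / N2) by exact: mulr_ge0.
(* Each distance loses a factor 5/3; 25/9 <= 3 and 1 + e <= 2 give the 9 of the statement. *)
apply: (@le_trans _ _ ((3 * (L / N1 * (L / N2))) `^ (1 + e))).
  apply: ler_powR2r; first by lra.
    by rewrite mulr_ge0// divr_ge0 ?(ltW L0) ?(ltW u0) ?(ltW v0).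
  apply: (@le_trans _ _ ((5 / 3 * (L / N1)) * (5 / 3 * (L / N2)))).
    have one (N z : R) : 0 < N -> 0 < z -> 3 / 5 * N <= z -> L / z <= 5 / 3 * (L / N).
      move=> N0 z0 Nz; have -> : 5 / 3 * (L / N) = L / (3 / 5 * N).
        by field; rewrite gt_eqF.
      rewrite ler_wpM2l ?(ltW L0)// lef_pV2 ?posrE//.
      by rewrite mulr_gt0// divr_gt0.
    by apply: ler_pM; rewrite ?divr_ge0 ?(ltW L0) ?(ltW u0) ?(ltW v0)//; exact: one.
  by move: LN0; lra.
rewrite powRM// ler_wpM2r ?powR_ge0//.
apply: (@le_trans _ _ (3 `^ 2)).
  by apply: ler_powR; rewrite ?ler1n//; lra.
by rewrite powR_mulrn//; lra.
Qed.

End kernel_estimates.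

Section nneseries_bound.
Context (R : realType).

Lemma nneseries_le (a : nat -> R) (B : R) : (forall n, 0 <= a n) ->
  (forall n, \sum_(i < n) a i <= B) -> (\sum_(i <oo) (a i)%:E <= B%:E)%E.
Proof.
move=> a0 aB; apply: lime_le.
  by apply: is_cvg_nneseries => i _ _; rewrite lee_fin.
by apply: nearW => n; rewrite sumEFin lee_fin big_mkord.
Qed.

Lemma nneseries_term (a : nat -> \bar R) m : (forall n, (0 <= a n)%E) ->
  (a m <= \sum_(i <oo) a i)%E.
Proof.
move=> a0; apply: le_trans (nneseries_lim_ge m.+1 _); last by move=> *; exact: a0.
by rewrite big_nat_recr//= leeDr// sume_ge0.
Qed.

Lemma dyadic_layer (u rho : R) : 0 < u -> u < rho ->
  exists m : nat, 2^-1 ^+ m.+1 * rho <= u < 2^-1 ^+ m * rho.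
Proof.
move=> u0 ur; have r0 : 0 < rho by exact: lt_trans ur.
have ex : exists n, 2^-1 ^+ n * rho <= u.
  exists (Num.bound (rho / u)); set n := Num.bound _.
  have h : rho / u < n%:R by apply: archi_boundP; rewrite divr_ge0 ?(ltW r0) ?(ltW u0).
  rewrite exprVn mulrC ler_pdivrMr ?exprn_gt0//.
  rewrite ltr_pdivrMr// in h; rewrite mulrC; apply: le_trans (ltW h) _.
  rewrite ler_wpM2r ?(ltW u0)// -natrX ler_nat.
  by apply: ltnW; exact: ltn_expl.
case: (ex_minnP ex) => -[|m] hm min.
  by move: hm; rewrite expr0 mul1r leNgt ur.
exists m; rewrite hm ltNge; apply/negP => /min; by rewrite ltnn.
Qed.

End nneseries_bound.

Section product_sections.
Local Open Scope ereal_scope.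
Context d1 d2 (X : measurableType d1) (Y : measurableType d2) (R : realType).
Variables (m1 : {sigma_finite_measure set X -> \bar R}).
Variables (m2 : {sigma_finite_measure set Y -> \bar R}).

Lemma product_measure_le1 (E : set (X * Y)) (J : set X) (V : X -> set Y) (c : R) :
  measurable E -> measurable J -> (0 <= c)%R ->
  (forall x y, E (x, y) -> J x /\ V x y) ->
  (forall x, J x -> measurable (V x) /\ m2 (V x) <= c%:E) ->
  (m1 \x m2) E <= c%:E * m1 J.
Proof.
move=> mE mJ c0 EV hV.
have -> : c%:E * m1 J = \int[m1]_x (c%:E * (\1_J x)%:E).
  rewrite ge0_integralZl//; first by rewrite integral_indic// setIT.
  by apply/measurable_EFinP; exact: measurable_indic.
apply: integral_monotone => x _ /=.
  rewrite indicE; case: (boolP (x \in J)) => xJ.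
    have [mV Vc] := hV x (set_mem xJ).
    rewrite mule1; apply: le_trans Vc; apply: le_measure; rewrite ?inE//.
      exact: measurable_xsection.
    by move=> y; rewrite /xsection/= inE => /EV[].
  rewrite mule0 (_ : xsection E x = set0) ?measure0//.
  apply/seteqP; split => y //; rewrite /xsection/= inE => /EV[Jx].
  by move: xJ; rewrite (mem_set Jx).
Qed.

Lemma product_measure_le2 (E : set (X * Y)) (J : set Y) (V : Y -> set X) (c : R) :
  measurable E -> measurable J -> (0 <= c)%R ->
  (forall x y, E (x, y) -> J y /\ V y x) ->
  (forall y, J y -> measurable (V y) /\ m1 (V y) <= c%:E) ->
  (m1 \x m2) E <= c%:E * m2 J.
Proof.
move=> mE mJ c0 EV hV.
rewrite (@product_measure_unique _ _ _ _ _ m1 m2 (m1 \x^ m2)%E)//; last first.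
  by move=> A B mA mB; exact: product_measure2E.
have -> : c%:E * m2 J = \int[m2]_y (c%:E * (\1_J y)%:E).
  rewrite ge0_integralZl//; first by rewrite integral_indic// setIT.
  by apply/measurable_EFinP; exact: measurable_indic.
apply: integral_monotone => y _ /=.
  rewrite indicE; case: (boolP (y \in J)) => yJ.
    have [mV Vc] := hV y (set_mem yJ).
    rewrite mule1; apply: le_trans Vc; apply: le_measure; rewrite ?inE//.
      exact: measurable_ysection.
    by move=> x; rewrite /ysection/= inE => /EV[].
  rewrite mule0 (_ : ysection E y = set0) ?measure0//.
  apply/seteqP; split => x //; rewrite /ysection/= inE => /EV[Jy].
  by move: yJ; rewrite (mem_set Jy).
Qed.

End product_sections.

(** * Integration of a power singularity *)

Section singular_integral.
Context d (X : measurableType d) (R : realType) (mu : {measure set X -> \bar R}).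

Definition Csing (th : R) : R := 2 `^ (1 - th) / (1 - 2 `^ (- th)).

Lemma two_powRN01 (th : R) : 0 < th -> 0 <= 2 `^ (- th) < 1.
Proof.
move=> th0; rewrite powR_ge0/= powRN invf_lt1 ?powR_gt0//.
by rewrite -[ltLHS](powRr0 (2 : R)) /powR pnatr_eq0/= ltr_expR ltr_pM2r ?ln_gt0 ?ltr1n.
Qed.

Lemma Csing_ge0 th : 0 < th -> 0 <= Csing th.
Proof.
move=> th0; rewrite divr_ge0 ?powR_ge0// subr_ge0.
by have /andP[_ /ltW] := two_powRN01 th0.
Qed.

(** Layer m, where u is about 2^(-m) rho, contributes at most c (2^(-m-1) rho)^(th-1) B 2^(-m) rho.
    This is a geometric series of ratio 2^(-th), whence [Csing]. As h may fail to be measurable, it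
    is compared pointwise with the measurable series H. *)
Lemma singular_integral_le (D E : set X) (u : X -> R) (h : X -> R) (c B rho th : R) :
  0 < th <= 1 -> 0 <= c -> 0 <= B -> 0 < rho -> measurable D ->
  (forall r, measurable (E `&` [set z | u z < r])) ->
  (forall r, 0 < r -> (mu (E `&` [set z | (u z < r)%R]) <= (B * r)%:E)%E) ->
  (forall z, D z -> 0 < u z) -> (forall z, E z -> u z < rho) ->
  (forall z, D z -> E z -> `|h z| <= c * u z `^ (th - 1)) ->
  (forall z, D z -> ~ E z -> h z = 0) ->
  `|\int[mu]_(z in D) h z| <= Csing th * c * B * rho `^ th.
Proof.
move=> /andP[th0 th1] c0 B0 r0 mD mE muE uD uE hE h0.
pose Em m := E `&` [set z | u z < 2^-1 ^+ m * rho].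
pose cm m := c * (2^-1 ^+ m.+1 * rho) `^ (th - 1).
have cm0 m : 0 <= cm m by rewrite mulr_ge0 ?powR_ge0.
pose H z := (\sum_(m <oo) (cm m)%:E * (\1_(Em m) z)%:E)%E.
have t0 m z : (0 <= (cm m)%:E * (\1_(Em m) z)%:E :> \bar R)%E.
  by rewrite -EFinM lee_fin mulr_ge0.
have hH z : D z -> (`|h z|%:E <= H z)%E.
  move=> Dz; have [Ez|nEz] := pselect (E z); last first.
    by rewrite h0// normr0; apply: nneseries_ge0.
  have [m /andP[lo hi]] := dyadic_layer (uD z Dz) (uE z Ez).
  have mem : z \in Em m by apply/mem_set; split.
  apply: le_trans (nneseries_term m (fun m => t0 m z)) => //.
  rewrite indicE mem mule1 lee_fin; apply: le_trans (hE z Dz Ez) _.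
  rewrite /cm ler_wpM2l// -opprB !powRN lef_pV2 ?posrE ?powR_gt0 ?uD ?mulr_gt0 ?exprn_gt0//.
  apply: ler_powR2r => //; first by rewrite subr_ge0.
  by rewrite mulr_ge0 ?exprn_ge0 ?(ltW r0).
have IH : (\int[mu]_(z in D) H z <= (Csing th * c * B * rho `^ th)%:E)%E.
  rewrite integral_nneseries//; last first.
    move=> m; apply: measurable_funeM; apply/measurable_EFinP.
    exact: measurable_funTS (measurable_indic (mE _)).
  pose am m := cm m * (B * (2^-1 ^+ m * rho)).
  apply: (@le_trans _ _ (\sum_(m <oo) (am m)%:E)%E).
    apply: lee_nneseries => [m _ _|m _]; first by apply: integral_ge0 => z _.
    rewrite ge0_integralZl//; last 2 first.
    - by apply/measurable_EFinP; exact: measurable_funTS (measurable_indic (mE _)).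
    - by rewrite lee_fin.
    rewrite integral_indic//; last exact: mE.
    rewrite /am (EFinM (cm m)); apply: lee_wpmul2l; first by rewrite lee_fin.
    apply: le_trans (muE _ _); last by rewrite mulr_gt0 ?exprn_gt0.
    apply: le_measure; last exact: subIsetl.
      by rewrite inE; apply: measurableI => //; exact: mE.
    by rewrite inE; exact: mE.
  apply: nneseries_le => [m|n].
    by rewrite /am !mulr_ge0 ?powR_ge0 ?exprn_ge0 ?(ltW r0).
  have amE m : am m = c * B * rho `^ th * 2 `^ (1 - th) * (2 `^ (- th)) ^+ m.
    have p0 : 0 <= 2^-1 ^+ m.+1 :> R by rewrite exprn_ge0.
    rewrite /am /cm powRM ?(ltW r0)//.
    have e1 : rho `^ (th - 1) * rho = rho `^ th.
      by rewrite mulrC mulr_powRB1 ?(ltW r0).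
    have e2 : (2^-1 ^+ m.+1) `^ (th - 1) * 2^-1 ^+ m =
        2 `^ (1 - th) * (2 `^ (- th)) ^+ m :> R.
      have half k : 2^-1 ^+ k = 2 `^ (- k%:R) :> R by rewrite powR_invn// exprVn.
      rewrite !half -powRrM -powRD ?pnatr_eq0 ?implybT//.
      rewrite -[in RHS]powR_mulrn ?powR_ge0// -powRrM -powRD ?pnatr_eq0 ?implybT//.
      by congr (_ `^ _); rewrite -natr1; ring.
    by rewrite -e1 -[in RHS]mulrA -e2; ring.
  under eq_bigr do rewrite amE.
  rewrite -mulr_sumr /Csing.
  rewrite [leRHS](_ : _ = c * B * rho `^ th * 2 `^ (1 - th) * (1 - 2 `^ (- th))^-1);
    last by ring.
  rewrite ler_wpM2l ?mulr_ge0 ?powR_ge0//.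
  exact/geometric_le/two_powRN01.
have Hfin : (\int[mu]_(z in D) H z < +oo)%E by apply: le_lt_trans IH _; rewrite ltry.
apply: le_trans (Rintegral_abs_le hH Hfin) _.
rewrite -lee_fin fineK// ge0_fin_numE//; apply: integral_ge0 => z _.
by apply: nneseries_ge0.
Qed.

End singular_integral.

Section complex_parts.
Context (R : realType).
Implicit Types (z w : R[i]) (c : bool).

(** A Boolean selector, so that each real estimate is proved once for real and imaginary parts. *)
Definition part c z : R := if c then complex.Re z else complex.Im z.

Lemma part_normc c z : `|part c z| <= normc z.
Proof.
case: z => x y; rewrite /part /normc -sqrtr_sqr.
by case: c; apply: ler_wsqrtr; rewrite ?lerDl ?lerDr sqr_ge0.
Qed.

Lemma partB c z w : part c (z - w) = part c z - part c w.
Proof. by case: z w => x y [u v]; rewrite /part; case: c. Qed.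

Lemma partD c z w : part c (z + w) = part c z + part c w.
Proof. by case: z w => x y [u v]; rewrite /part; case: c. Qed.

Lemma part_sum c I (s : seq I) (F : I -> R[i]) :
  part c (\sum_(i <- s) F i) = \sum_(i <- s) part c (F i).
Proof.
elim: s => [|i s IH]; first by rewrite !big_nil /part; case: c.
by rewrite !big_cons partD IH.
Qed.

Lemma partZ c (r : R) z : part c (r%:C * z) = r * part c z.
Proof.
by case: z => x y; rewrite /part; case: c; rewrite /= mul0r ?subr0 ?addr0.
Qed.

Lemma normc_tri z1 z2 z3 : normc (z1 - z3) <= normc (z1 - z2) + normc (z2 - z3).
Proof. by have := le_normcD (z1 - z2) (z2 - z3); rewrite addrA subrK. Qed.

End complex_parts.

(** * The grid of cells *)

Section cells.
Context (R : realType).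
Variables (o : plane R) (delta : R).
Hypothesis delta0 : 0 < delta.

Definition corner (c : nat * nat) : plane R :=
  (o.1 + delta * c.1%:R, o.2 + delta * c.2%:R).
Definition cube c (l : nat) := square (corner c) (delta * l%:R).
Definition cell i := square (corner i) delta.

Lemma cell_cube i c l x : i \in sqr c l -> cell i x -> cube c l x.
Proof.
case: i c x => i1 i2 [c1 c2] [x1 x2].
rewrite mem_sqr/= => /andP[/andP[h1 h2] /andP[h3 h4]].
have aux (a b : nat) (w : R) : (a <= b)%N -> w + delta * a%:R <= w + delta * b%:R.
  by move=> ab; rewrite lerD2l ler_wpM2l ?ler_nat// ltW.
have aux' (a b : nat) (w : R) : (a < b)%N ->
    w + delta * a%:R + delta <= w + delta * b%:R.
  move=> ab; have := aux _ _ w ab; rewrite -natr1; lra.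
move=> /squareP/=[/andP[k1 k2] /andP[k3 k4]]; apply/squareP => /=.
have := aux _ _ o.1 h1; have := aux _ _ o.2 h3.
have := aux' _ _ o.1 h2; have := aux' _ _ o.2 h4.
rewrite !natrD; move=> *; split; apply/andP; split; lra.
Qed.

Lemma cell_disjoint i j x : cell i x -> cell j x -> i = j.
Proof.
case: i j x => i1 i2 [j1 j2] [x1 x2].
move=> /squareP/=[/andP[k1 k2] /andP[k3 k4]].
move=> /squareP/=[/andP[m1 m2] /andP[m3 m4]].
have aux (a b : nat) (w y : R) : w + delta * a%:R <= y -> y < w + delta * b%:R + delta ->
    (a <= b)%N.
  move=> h1 h2; have : delta * a%:R < delta * b.+1%:R by rewrite -natr1; lra.
  by rewrite ltr_pM2l// ltr_nat ltnS.
congr (_, _); apply/eqP; rewrite eqn_leq; apply/andP; split.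
- exact: aux k1 m2.
- exact: aux m1 k2.
- exact: aux k3 m4.
- exact: aux m3 k4.
Qed.

(** In units of delta the distance is at least d - l for d the distance of the indices, and d >= 4 l
    makes this at least 3/5 of d + l, with equality at d = 4 l. *)
Lemma far_dist (w x y : R) (c l j : nat) : (0 < l)%N ->
  w + delta * c%:R <= x < w + delta * c%:R + delta * l%:R ->
  w + delta * j%:R <= y < w + delta * j%:R + delta ->
  (4 * l <= ndist j c)%N ->
  3 / 5 * (delta * (l + ndist j c)%:R) <= `|x - y|.
Proof.
move=> l0 /andP[x1 x2] /andP[y1 y2] h.
have hl : 1 <= l%:R :> R by rewrite ler1n.
have dl : delta <= delta * l%:R by rewrite ler_peMr// ltW.
move: h; rewrite /ndist; have [jc h|jc h] := leqP j c.
  have [d cE] : exists d, c = (j + d)%N by exists (c - j)%N; rewrite subnKC.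
  have dE : (j - c + (c - j) = d)%N by lia.
  rewrite dE in h *; subst c.
  have h' : delta * (4 * l%:R) <= delta * d%:R.
    by rewrite ler_pM2l// -natrM ler_nat.
  rewrite ger0_norm; move: x1 x2 y1 y2 h'; rewrite !natrD !mulrDr; lra.
have [d jE] : exists d, j = (c + d)%N by exists (j - c)%N; rewrite subnKC// ltnW.
have dE : (j - c + (c - j) = d)%N by lia.
rewrite dE in h *; subst j.
have h' : delta * (4 * l%:R) <= delta * d%:R.
  by rewrite ler_pM2l// -natrM ler_nat.
rewrite ler0_norm; move: x1 x2 y1 y2 h'; rewrite !natrD !mulrDr; lra.
Qed.

Lemma near_dist (w x y : R) (c l j : nat) : (0 < l)%N ->
  w + delta * c%:R <= x < w + delta * c%:R + delta * l%:R ->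
  w + delta * j%:R <= y < w + delta * j%:R + delta ->
  (ndist j c < 4 * l)%N -> `|x - y| < delta * (5 * l)%:R.
Proof.
move=> l0 /andP[x1 x2] /andP[y1 y2]; rewrite /ndist => h.
have aux (a b : nat) : (a <= b)%N -> delta * a%:R <= delta * b%:R.
  by move=> ab; rewrite ler_wpM2l ?ler_nat// ltW.
have h1 : (j.+1 <= c + 5 * l)%N by lia.
have h2 : (c + l <= j + 5 * l)%N by lia.
move: (aux _ _ h1) (aux _ _ h2) x1 x2 y1 y2.
rewrite -natr1 !natrD !mulrDr mulr1 ltr_norml => *; apply/andP; split; lra.
Qed.

End cells.

Section kernel_oscillation.
Context (R : realType).
Variables (K : plane R -> plane R -> R[i]) (th1 th2 CK : R).
Hypotheses (th1P : 0 < th1 <= 1) (th2P : 0 < th2 <= 1) (CK0 : 0 <= CK).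
Hypotheses (mb : mixed_bound th1 th2 CK K).
Hypotheses (mbt : mixed_bound th1 th2 CK (fun x y => K y x)).

(** The pair (x, y) is moved to (x0, y0) one coordinate at a time, and each of the four moves costs
    9 by [kernel_move], hence 36. The separation hypotheses range over mixed choices because the
    intermediate pairs mix coordinates of both. *)
Lemma kernel_osc (e L N1 N2 : R) (x x0 y y0 : plane R) :
  0 < e -> e <= 1 -> 2 * e <= th1 -> 2 * e <= th2 ->
  0 < L -> 5 * L <= N1 -> 5 * L <= N2 ->
  `|x.1 - x0.1| <= L -> `|x.2 - x0.2| <= L ->
  `|y.1 - y0.1| <= L -> `|y.2 - y0.2| <= L ->
  (forall u v, (u == x.1) || (u == x0.1) -> (v == y.1) || (v == y0.1) ->
     3 / 5 * N1 <= `|u - v|) ->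
  (forall u v, (u == x.2) || (u == x0.2) -> (v == y.2) || (v == y0.2) ->
     3 / 5 * N2 <= `|u - v|) ->
  normc (K x y - K x0 y0) <=
    36 * CK * L ^- 2 * ((L / N1) `^ (1 + e) * (L / N2) `^ (1 + e)).
Proof.
move=> e0 e1 et1 et2 L0 LN1 LN2 dx1 dx2 dy1 dy2 f1 f2.
have /andP[th10 _] := th1P; have /andP[th20 _] := th2P.
set w := (_ `^ _ * _).
have km1 (u v t : R) : 3 / 5 * N1 <= u -> 3 / 5 * N2 <= v -> 0 <= t <= L ->
    CK * (t `^ th1 / u `^ (1 + th1)) * (1 / v) * (u / v + v / u) `^ (- th2) <=
    9 * CK * L ^- 2 * w.
  move=> hu hv ht.
  have := kernel_move th10 th20 e0 e1 et1 et2 L0 LN1 LN2 hu hv ht.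
  rewrite -/w => h.
  rewrite -mulrA -mulrA [leRHS](_ : _ = CK * (9 * L ^- 2 * w)); last by ring.
  by rewrite ler_wpM2l//; move: h; rewrite -[X in X <= _]mulrA.
have km2 (u v t : R) : 3 / 5 * N1 <= u -> 3 / 5 * N2 <= v -> 0 <= t <= L ->
    CK * (1 / u) * (t `^ th1 / v `^ (1 + th1)) * (u / v + v / u) `^ (- th2) <=
    9 * CK * L ^- 2 * w.
  move=> hu hv ht.
  have := kernel_move th10 th20 e0 e1 et1 et2 L0 LN2 LN1 hv hu ht.
  rewrite [X in _ <= _ * X]mulrC -/w (addrC (v / u)) => h.
  rewrite -mulrA -mulrA [leRHS](_ : _ = CK * (9 * L ^- 2 * w)); last by ring.
  rewrite ler_wpM2l//; move: h; rewrite [X in X * _ <= _]mulrC -[X in X <= _]mulrA; exact: id.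
have off u v : (u.1 == x.1) || (u.1 == x0.1) -> (v.1 == y.1) || (v.1 == y0.1) ->
   (u.2 == x.2) || (u.2 == x0.2) -> (v.2 == y.2) || (v.2 == y0.2) -> off_axes u v.
  move=> h1 h2 h3 h4; have g1 := f1 _ _ h1 h2; have g2 := f2 _ _ h3 h4.
  split; rewrite -subr_eq0 -normr_gt0; lra.
have half (u v : R) : 3 / 5 * N1 <= `|u - v| -> L <= `|u - v| / 2 by lra.
have half2 (u v : R) : 3 / 5 * N2 <= `|u - v| -> L <= `|u - v| / 2 by lra.
have s1 : normc (K x y - K (x0.1, x.2) y) <= 9 * CK * L ^- 2 * w.
  have g1 : 3 / 5 * N1 <= `|x.1 - y.1| by apply: f1; rewrite eqxx.
  have g2 : 3 / 5 * N2 <= `|x.2 - y.2| by apply: f2; rewrite eqxx.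
  apply: le_trans (mb.1 x y x0.1 _ _) (km1 _ _ _ g1 g2 _).
  - by apply: off; rewrite eqxx.
  - exact: le_trans dx1 (half _ _ g1).
  - by rewrite normr_ge0.
have s2 : normc (K (x0.1, x.2) y - K x0 y) <= 9 * CK * L ^- 2 * w.
  have g1 : 3 / 5 * N1 <= `|x0.1 - y.1| by apply: f1; rewrite eqxx ?orbT.
  have g2 : 3 / 5 * N2 <= `|x.2 - y.2| by apply: f2; rewrite eqxx.
  have -> : x0 = ((x0.1, x.2).1, x0.2) by case: (x0).
  apply: le_trans (mb.2 (x0.1, x.2) y x0.2 _ _) (km2 _ _ _ g1 g2 _).
  - by apply: off; rewrite eqxx ?orbT.
  - exact: le_trans dx2 (half2 _ _ g2).
  - by rewrite normr_ge0.
have s3 : normc (K x0 y - K x0 (y0.1, y.2)) <= 9 * CK * L ^- 2 * w.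
  have g1 : 3 / 5 * N1 <= `|y.1 - x0.1| by rewrite distrC; apply: f1; rewrite eqxx ?orbT.
  have g2 : 3 / 5 * N2 <= `|y.2 - x0.2| by rewrite distrC; apply: f2; rewrite eqxx ?orbT.
  apply: le_trans (mbt.1 y x0 y0.1 _ _) (km1 _ _ _ g1 g2 _).
  - have [h1 h2] : off_axes x0 y by apply: off; rewrite eqxx ?orbT.
    by split; rewrite eq_sym.
  - exact: le_trans dy1 (half _ _ g1).
  - by rewrite normr_ge0.
have s4 : normc (K x0 (y0.1, y.2) - K x0 y0) <= 9 * CK * L ^- 2 * w.
  have g1 : 3 / 5 * N1 <= `|y0.1 - x0.1| by rewrite distrC; apply: f1; rewrite eqxx ?orbT.
  have g2 : 3 / 5 * N2 <= `|y.2 - x0.2| by rewrite distrC; apply: f2; rewrite eqxx ?orbT.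
  have {2}-> : y0 = ((y0.1, y.2).1, y0.2) by case: (y0).
  apply: le_trans (mbt.2 (y0.1, y.2) x0 y0.2 _ _) (km2 _ _ _ g1 g2 _).
  - have [h1 h2] : off_axes x0 (y0.1, y.2) by apply: off; rewrite eqxx ?orbT.
    by split; rewrite eq_sym.
  - exact: le_trans dy2 (half2 _ _ g2).
  - by rewrite normr_ge0.
have t1 := normc_tri (K x y) (K (x0.1, x.2) y) (K x0 y0).
have t2 := normc_tri (K (x0.1, x.2) y) (K x0 y) (K x0 y0).
have t3 := normc_tri (K x0 y) (K x0 (y0.1, y.2)) (K x0 y0).
apply: le_trans t1 _.
have -> : 36 * CK * L ^- 2 * w = 9 * CK * L ^- 2 * w + (9 * CK * L ^- 2 * w +
  (9 * CK * L ^- 2 * w + 9 * CK * L ^- 2 * w)) by ring.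
by apply: lerD s1 (le_trans t2 (lerD s2 (le_trans t3 (lerD s3 s4)))).
Qed.

End kernel_oscillation.

Section coordinates.
Context (R : realType).

(* [pr] tells which argument of a pair of points runs over the large square, so
   that a kernel and its transpose are treated together. *)
Definition sel (pr : bool) (z : plane R * plane R) := if pr then z.1 else z.2.
Definition crd (k : bool) (x : plane R) : R := if k then x.1 else x.2.

Lemma measurable_sel pr : measurable_fun setT (sel pr).
Proof. by case: pr; [exact: measurable_fst|exact: measurable_snd]. Qed.

Lemma measurable_crd k : measurable_fun setT (crd k).
Proof. by case: k; [exact: measurable_fst|exact: measurable_snd]. Qed.

Lemma measurable_selcrd pr k : measurable_fun setT (fun z => crd k (sel pr z)).
Proof. exact: measurableT_comp (measurable_crd k) (measurable_sel pr). Qed.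

Lemma measurable_sel_set pr (A : set (plane R)) : measurable A ->
  measurable [set z | A (sel pr z)].
Proof. by move=> mA; rewrite -[X in measurable X]setTI; exact: measurable_sel. Qed.

Lemma measurable_off_axes :
  measurable [set xy : plane R * plane R | off_axes xy.1 xy.2].
Proof.
have m (k : bool) : measurable [set z | crd k (sel true z) != crd k (sel false z)].
  rewrite (_ : [set _ | _] = setT `&`
    (fun z => crd k (sel true z) - crd k (sel false z)) @^-1` [set~ 0]).
    have mf : measurable_fun setT (fun z => crd k (sel true z) - crd k (sel false z)).
      by apply: measurable_funB; exact: measurable_selcrd.
    by apply: mf => //; apply: measurableC; exact: measurable_set1.
  rewrite setTI; apply/seteqP; split => z /=; rewrite -subr_eq0; first by move=> /eqP.
  by move=> /eqP.
exact: measurableI (m true) (m false).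
Qed.

Lemma measurable_strip k (z0 : bool) r :
  measurable [set z | `|crd k (sel z0 z) - crd k (sel (~~ z0) z)| < r].
Proof.
rewrite (_ : [set _ | _] = setT `&`
  (fun z => `|crd k (sel z0 z) - crd k (sel (~~ z0) z)|) @^-1` `]-oo, r[).
  have mf : measurable_fun setT (fun z => `|crd k (sel z0 z) - crd k (sel (~~ z0) z)|).
    by apply: measurableT_comp => //; apply: measurable_funB; exact: measurable_selcrd.
  by apply: mf => //; exact: measurable_itv.
by rewrite setTI; apply/seteqP; split => z /=; rewrite in_itv/=.
Qed.

(** Fubini by sections, in whichever argument the large square sits. *)
Lemma product_measure_sel pr (E : set (plane R * plane R)) (J : set (plane R))
    (V : plane R -> set (plane R)) (c : R) :
  measurable E -> measurable J -> 0 <= c ->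
  (forall z, E z -> J (sel (~~ pr) z) /\ V (sel (~~ pr) z) (sel pr z)) ->
  (forall y, J y -> measurable (V y) /\ (area R (V y) <= c%:E)%E) ->
  ((area R \x area R) E <= c%:E * area R J)%E.
Proof.
case: pr => mE mJ c0 EV hV.
  by apply: (@product_measure_le2 _ _ _ _ _ (area R) (area R) E J V c) => // x y /EV.
by apply: (@product_measure_le1 _ _ _ _ _ (area R) (area R) E J V c) => // x y /EV.
Qed.

Lemma area_strip (a : plane R) (l : R) k (y : plane R) (r : R) : 0 <= l -> 0 <= r ->
  let V := [set x | square a l x /\ `|crd k x - crd k y| < r] in
  measurable V /\ (area R V <= (2 * r * l)%:E)%E.
Proof.
move=> l0 r0 V.
have mV : measurable V.
  apply: (@measurableI _ _ (square a l)); first exact: measurable_square.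
  rewrite (_ : (fun _ => _) = setT `&` (fun x => `|crd k x - crd k y|) @^-1` `]-oo, r[).
    have mf : measurable_fun setT (fun x => `|crd k x - crd k y|).
      by apply: measurableT_comp => //; apply: measurable_funB => //; exact: measurable_crd.
    by apply: mf => //; exact: measurable_itv.
  by rewrite setTI; apply/seteqP; split => z /=; rewrite in_itv/=.
split => //.
pose I1 : set R := if k then `[y.1 - r, (y.1 - r) + 2 * r[%classic
  else `[a.1, a.1 + l[%classic.
pose I2 : set R := if k then `[a.2, a.2 + l[%classic
  else `[y.2 - r, (y.2 - r) + 2 * r[%classic.
have VI : V `<=` I1 `*` I2.
  move=> x [/squareP[x1 x2]]; rewrite /I1 /I2 /crd; case: k {mV V I1 I2} => /=.
    rewrite !in_itv/= x2 => h; split => //; move: h; rewrite ltr_norml => /andP[u v].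
    by apply/andP; split; lra.
  rewrite !in_itv/= x1 => h; split => //; move: h; rewrite ltr_norml => /andP[u v].
  by apply/andP; split; lra.
have mI1 : measurable (I1 : set (measurableTypeR R)) by rewrite /I1; case: ifP.
have mI2 : measurable (I2 : set (measurableTypeR R)) by rewrite /I2; case: ifP.
apply: (@le_trans _ _ (area R (I1 `*` I2))).
  by apply: le_measure; rewrite ?inE//; exact: measurableX.
have A1 : @lebesgue_measure R I1 = (if k then 2 * r else l)%:E.
  by rewrite /I1; case: ifP => _; apply: lebesgue_measure_itvco; rewrite ?mulr_ge0.
have A2 : @lebesgue_measure R I2 = (if k then l else 2 * r)%:E.
  by rewrite /I2; case: ifP => _; apply: lebesgue_measure_itvco; rewrite ?mulr_ge0.
rewrite /area product_measure1E//.
rewrite [X in (X * _)%E]A1 [X in (_ * X)%E]A2 -EFinM lee_fin.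
by case: ifP => _; lra.
Qed.

End coordinates.

Section kernel_arithmetic.
Context (R : realType).

Lemma near_size (th u v N : R) : 0 < th -> 0 < u -> 0 < N -> N <= v ->
  1 / u * (1 / v) * (u / v + v / u) `^ (- th) <=
  N `^ (- (1 + th)) * u `^ (th - 1).
Proof.
move=> th0 u0 N0 Nv; have v0 : 0 < v by exact: lt_le_trans Nv.
apply: (@le_trans _ _ (1 / u * (1 / v) * (u / v) `^ th)).
  apply: ler_wpM2l; first by rewrite mulr_ge0 ?divr_ge0 ?ltW.
  exact: decay_le.
have -> : 1 / u * (1 / v) * (u / v) `^ th = v `^ (- (1 + th)) * u `^ (th - 1).
  rewrite powRM ?invr_ge0 ?(ltW u0) ?(ltW v0)// powRV ?(ltW v0)//.
  have -> : - (1 + th) = - 1 - th by lra.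
  rewrite !powRD ?(gt_eqF u0) ?(gt_eqF v0) ?implybT//.
  by rewrite !powR_inv1 ?(ltW u0) ?(ltW v0)// !mul1r; ring.
rewrite ler_wpM2r ?powR_ge0// !powRN lef_pV2 ?posrE ?powR_gt0//.
by apply: ler_powR2r; rewrite ?(ltW N0)//; lra.
Qed.

(** 700 = 2 * 14 * 25: the 2 is that of the strip area, 14 exceeds 5/3 * (25/3)^th for th <= 1, and
    (L / N1)^(1+e) is at least 1/25 since N1 <= 5 L and e <= 1. *)
Lemma near_arith (S CK th e L delta N1 N : R) : 0 <= S -> 0 <= CK ->
  0 < th <= 1 -> 0 < e <= th -> 0 < L -> 0 < delta -> L <= N1 -> N1 <= 5 * L ->
  5 * L <= N ->
  delta ^- 2 * (S * (CK * (3 / 5 * N) `^ (- (1 + th))) * (2 * L * delta ^+ 2) *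
     (5 * L) `^ th) <=
  700 * S * CK * ((L / N1) `^ (1 + e) * (L / N) `^ (1 + e)).
Proof.
move=> S0 CK0 /andP[th0 th1] /andP[e0 eth] L0 d0 LN1 NL1 LN.
have N0 : 0 < N by lra.
have N10 : 0 < N1 by lra.
have N3 : 0 < 3 / 5 * N by lra.
have LNr : 0 < L / N by rewrite divr_gt0.
have LN1' : L / N <= 1 by rewrite ler_pdivrMr// mul1r; lra.
have -> : delta ^- 2 * (S * (CK * (3 / 5 * N) `^ (- (1 + th))) *
    (2 * L * delta ^+ 2) * (5 * L) `^ th) =
    S * CK * (2 * (L * (3 / 5 * N) `^ (- (1 + th)) * (5 * L) `^ th)).
  by field; rewrite gt_eqF.
have -> : 700 * S * CK * ((L / N1) `^ (1 + e) * (L / N) `^ (1 + e)) =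
  S * CK * (700 * ((L / N1) `^ (1 + e) * (L / N) `^ (1 + e))) by ring.
rewrite ler_wpM2l ?mulr_ge0//.
have h1 : 1 / 25 <= (L / N1) `^ (1 + e).
  apply: (@le_trans _ _ ((1 / 5) `^ 2)).
    by rewrite powR_mulrn// expr2; lra.
  apply: (@le_trans _ _ ((1 / 5) `^ (1 + e))).
    by apply: ger_powR; lra.
  apply: ler_powR2r; [lra|lra|].
  by rewrite ler_pdivlMr//; lra.
have h2 : L * (3 / 5 * N) `^ (- (1 + th)) * (5 * L) `^ th <= 14 * (L / N) `^ (1 + th).
  have -> : L * (3 / 5 * N) `^ (- (1 + th)) * (5 * L) `^ th =
      5 / 3 * (25 / 3) `^ th * (L / N) `^ (1 + th).
    have -> : 5 * L = 25 / 3 * (L / N) * (3 / 5 * N) by field; rewrite gt_eqF.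
    rewrite (powRM _ _ (ltW N3)); last by apply: mulr_ge0; lra.
    rewrite (powRM _ _ (ltW LNr)); last by lra.
    have -> : - (1 + th) = - 1 - th by lra.
    rewrite (@powRD _ (3 / 5 * N) (- 1)) ?(gt_eqF N3) ?implybT// (@powRD _ (L / N) 1) ?(gt_eqF LNr) ?implybT//.
    rewrite powR_inv1 ?(ltW N3)// powRr1 ?(ltW LNr)//.
    rewrite [in LHS]powRN.
    have := lt0r_neq0 (powR_gt0 th N3); move: (_ `^ th) (_ `^ th) (_ `^ th) => z1 z2 z3 z0.
    by field; rewrite z0 gt_eqF.
  rewrite ler_wpM2r ?powR_ge0//.
  have : (25 / 3) `^ th <= (25 / 3) `^ 1 :> R.
    by apply: ler_powR => //; lra.
  by rewrite powRr1; lra.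
have h3 : (L / N) `^ (1 + th) <= (L / N) `^ (1 + e).
  by apply: ger_powR; [rewrite LNr|lra].
have h4 := powR_ge0 (L / N) (1 + e).
have h5 : 1 / 25 * (L / N) `^ (1 + e) <= (L / N1) `^ (1 + e) * (L / N) `^ (1 + e).
  by rewrite ler_wpM2r.
lra.
Qed.

End kernel_arithmetic.

Section step_functions.
Context (R : realType).
Variables (o : plane R) (delta : R).
Hypothesis delta0 : 0 < delta.
Implicit Types (s : nat * nat -> R) (c i : nat * nat).

Definition stepf (r : seq (nat * nat)) s (x : plane R) : R :=
  \sum_(i <- r) s i * \1_(cell o delta i) x.

Lemma stepf_cell r s i x : uniq r -> i \in r -> cell o delta i x ->
  stepf r s x = s i.
Proof.
move=> ur ir ix; rewrite /stepf (bigD1_seq i)//= big1 => [|k ki].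
  by rewrite addr0 indicE mem_set// mulr1.
rewrite indicE memNset ?mulr0// => kx.
by move: ki; rewrite (cell_disjoint delta0 kx ix) eqxx.
Qed.

Lemma stepf_out r s x : (forall i, i \in r -> ~ cell o delta i x) ->
  stepf r s x = 0.
Proof.
move=> h; rewrite /stepf big_seq big1// => i /h ix.
by rewrite indicE memNset// mulr0.
Qed.

Lemma stepf_le r s x (M : R) : uniq r -> 0 <= M -> (forall i, `|s i| <= M) ->
  `|stepf r s x| <= M.
Proof.
move=> ur M0 sM; have [[i ir ix]|h] := pselect (exists2 i, i \in r & cell o delta i x).
  by rewrite (stepf_cell _ ur ir ix).
by rewrite stepf_out ?normr0// => i ir ix; apply: h; exists i.
Qed.

Lemma stepf_cube c l s x : ~ cube o delta c l x -> stepf (sqr c l) s x = 0.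
Proof.
by move=> h; apply: stepf_out => i ir ix; apply: h; exact: cell_cube ir ix.
Qed.

End step_functions.

(** * Oscillation of rows and columns of the matrix *)

Section kernel_far_bounds.
Context (R : realType).
Variables (o : plane R) (delta : R).
Hypothesis delta0 : 0 < delta.
Variables (K : plane R -> plane R -> R[i]) (th1 th2 CK e : R).
Hypotheses (th1P : 0 < th1 <= 1) (th2P : 0 < th2 <= 1) (CK0 : 0 <= CK).
Hypotheses (e0 : 0 < e) (et1 : 2 * e <= th1) (et2 : 2 * e <= th2).
Hypothesis sb : size_bound th2 CK K.
Hypothesis mb : mixed_bound th1 th2 CK K.
Hypothesis mbt : mixed_bound th1 th2 CK (fun x y => K y x).
Variables (pr P : bool).
Implicit Types (s : nat * nat -> R) (c i j : nat * nat).

Local Notation m2 := (area R \x area R)%E.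
Local Notation cell := (cell o delta).
Local Notation stepf := (stepf o delta).

Definition off_set := [set xy : plane R * plane R | off_axes xy.1 xy.2].

Lemma off_setP z : off_set z -> off_axes (sel pr z) (sel (~~ pr) z).
Proof. by case: z => x y [h1 h2]; case: pr; split; rewrite // eq_sym. Qed.

(** Up to delta^-2, the column j of the matrix summed against s, or of its transpose when [pr] is
    false and the kernel is transposed. The combination stays under one integral, since integrals of
    a non-measurable kernel cannot be added cell by cell. *)
Definition step_form r s j := \int[m2]_(z in off_set)
  (part P (K (sel pr z) (sel (~~ pr) z)) *
   (stepf r s (sel pr z) * \1_(cell j) (sel (~~ pr) z))).

Let th2_gt0 : 0 < th2. Proof. by case/andP: th2P. Qed.

Lemma crd_size k x y : off_axes x y ->
  normc (K x y) <= CK * (1 / `|crd k x - crd k y| * (1 / `|crd (~~ k) x - crd (~~ k) y|) *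
    (`|crd k x - crd k y| / `|crd (~~ k) x - crd (~~ k) y| +
     `|crd (~~ k) x - crd (~~ k) y| / `|crd k x - crd k y|) `^ (- th2)).
Proof.
move=> xy; have := sb xy; rewrite /decay -!mulrA /crd; case: k => //=.
by rewrite !mul1r (addrC (`|x.2 - y.2| / _)) (mulrCA `|x.2 - y.2|^-1).
Qed.

Definition ncrd (k : bool) (i : nat * nat) : nat := if k then i.1 else i.2.

Lemma crd_cube k c l x : cube o delta c l x ->
  crd k o + delta * (ncrd k c)%:R <= crd k x <
  crd k o + delta * (ncrd k c)%:R + delta * l%:R.
Proof. by case: k => /squareP[]. Qed.

Lemma crd_cell k j x : cell j x ->
  crd k o + delta * (ncrd k j)%:R <= crd k x <
  crd k o + delta * (ncrd k j)%:R + delta.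
Proof. by case: k => /squareP[]. Qed.

(** Coordinate k is near, the other one far: the size bound is integrated over the strip. The
    coefficients s are arbitrary in [-1, 1] so that the signs of the entries can be inserted. *)
Lemma near_far_bound k c l j s : (0 < l)%N -> (forall i, `|s i| <= 1) ->
  (ndist (ncrd k j) (ncrd k c) < 4 * l)%N ->
  (4 * l <= ndist (ncrd (~~ k) j) (ncrd (~~ k) c))%N ->
  delta ^- 2 * `|step_form (sqr c l) s j| <=
  700 * Csing th2 * CK *
   ((l%:R / (l + ndist (ncrd k j) (ncrd k c))%:R) `^ (1 + e) *
    (l%:R / (l + ndist (ncrd (~~ k) j) (ncrd (~~ k) c))%:R) `^ (1 + e)).
Proof.
move=> l0 s1 hn hf.
set d1 := ndist (ncrd k j) _ in hn *; set d2 := ndist _ _ in hf *.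
have [le1 le2] : (l + d1 <= 5 * l)%N /\ (5 * l <= l + d2)%N.
  by clear -hn hf; clearbody d1 d2; lia.
pose L := delta * l%:R.
have lR : 0 < l%:R :> R by rewrite ltr0n.
have L0 : 0 < L by rewrite mulr_gt0.
pose N1 := delta * (l + d1)%:R; pose N := delta * (l + d2)%:R.
have -> : l%:R / (l + d1)%:R = L / N1 :> R.
  by rewrite /L /N1 -mulf_div divff ?mul1r// gt_eqF.
have -> : l%:R / (l + d2)%:R = L / N :> R.
  by rewrite /L /N -mulf_div divff ?mul1r// gt_eqF.
have LN1 : L <= N1 by rewrite /L /N1 ler_pM2l// ler_nat leq_addr.
have N1L : N1 <= 5 * L.
  by rewrite /L /N1 mulrCA ler_pM2l// -natrM ler_nat.
have LN : 5 * L <= N.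
  by rewrite /L /N mulrCA ler_pM2l// -natrM ler_nat.
have N0 : 0 < N by lra.
have N3 : 0 < 3 / 5 * N by lra.
have eth : 0 < e <= th2 by move: e0 et2 => e1 e2; apply/andP; split; lra.
apply: le_trans (@near_arith _ (Csing th2) CK th2 e L delta N1 N (Csing_ge0 th2_gt0)
  CK0 th2P eth L0 delta0 LN1 N1L LN).
rewrite ler_wpM2l ?invr_ge0 ?exprn_ge0 ?(ltW delta0)//.
pose E := [set z | cube o delta c l (sel pr z) /\ cell j (sel (~~ pr) z)].
have mE : measurable E.
  apply: (@measurableI _ _ [set z | cube o delta c l (sel pr z)]
    [set z | cell j (sel (~~ pr) z)]); apply: measurable_sel_set;
    exact: measurable_square.
pose u (z : plane R * plane R) : R := `|crd k (sel pr z) - crd k (sel (~~ pr) z)|.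
rewrite /step_form.
(* The far coordinate is at least 3/5 N, which gives c. For each point of the cell, of area delta^2,
   the strip of half-width r meets the square in area at most 2 r L, which gives B. Near coordinates
   differ by less than 5 L, which gives rho. *)
apply: (@singular_integral_le _ _ _ m2 off_set E u _
  (CK * (3 / 5 * N) `^ (- (1 + th2))) (2 * L * delta ^+ 2) (5 * L)) => //.
- by rewrite mulr_ge0 ?powR_ge0.
- by rewrite mulr_ge0 ?exprn_ge0 ?(ltW delta0)// mulr_ge0 ?(ltW L0).
- by lra.
- exact: measurable_off_axes.
- by move=> r; apply: measurableI => //; exact: measurable_strip.
- move=> r r0.
  have [l0' r0'] : 0 <= L /\ 0 <= r by rewrite !ltW.
  have := @product_measure_sel R pr (E `&` [set z | u z < r]) (cell j)
    (fun y => [set x | square (corner o delta c) L x /\ `|crd k x - crd k y| < r])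
    (2 * r * L).
  rewrite [area R (cell j)]area_square ?(ltW delta0)// -EFinM => h.
  rewrite (_ : 2 * L * delta ^+ 2 * r = 2 * r * L * delta ^+ 2); last by ring.
  apply: h.
  + by apply: measurableI => //; exact: measurable_strip.
  + exact: measurable_square.
  + by apply: mulr_ge0 => //; apply: mulr_ge0.
  + by move=> z [[hz1 hz2] hz3].
  + by move=> y _; exact: area_strip.
- move=> z /off_setP[h1 h2]; rewrite /u normr_gt0 subr_eq0.
  by rewrite /crd; case: (k).
- move=> z [hz1 hz2]; rewrite /u (_ : 5 * L = delta * (5 * l)%:R); last first.
    by rewrite natrM /L; ring.
  exact: (near_dist delta0 l0 (crd_cube k hz1) (crd_cell k hz2)).
- move=> z Dz [hz1 hz2]; rewrite normrM.
  have h1 : `|stepf (sqr c l) s (sel pr z) * \1_(cell j) (sel (~~ pr) z)| <= 1.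
    rewrite normrM -[leRHS]mulr1; apply: ler_pM => //.
      by apply: stepf_le => //; exact: sqr_uniq.
    by rewrite indicE; case: (_ \in _); rewrite ?normr1 ?normr0.
  apply: (@le_trans _ _ (normc (K (sel pr z) (sel (~~ pr) z)) * 1)).
    by apply: ler_pM => //; exact: part_normc.
  rewrite mulr1; have oz := off_setP Dz.
  apply: le_trans (crd_size k oz) _.
  rewrite -[leRHS]mulrA ler_wpM2l//; apply: near_size => //.
    by rewrite normr_gt0 subr_eq0; case: oz; rewrite /crd; case: (k).
  exact: (far_dist delta0 l0 (crd_cube _ hz1) (crd_cell _ hz2) hf).
- move=> z Dz nE; have [hz|hz] := pselect (cube o delta c l (sel pr z)).
    rewrite indicE memNset ?mulr0// => hz2; exact: nE.
  by rewrite stepf_cube// mul0r mulr0.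
Qed.

(** Over two cells K stays close to its value at the corners of the square and of cell j. The entry
    is therefore close to delta^2 times that value, a centre that does not depend on i. *)
Lemma far_far_bound c l j : (0 < l)%N ->
  (4 * l <= ndist j.1 c.1)%N -> (4 * l <= ndist j.2 c.2)%N ->
  exists m : R, forall i, i \in sqr c l ->
  `|delta ^- 2 * step_form (sqr c l) (fun i' => (i' == i)%:R) j - m| <=
  36 * CK * (l%:R ^- 2) *
   ((l%:R / (l + ndist j.1 c.1)%:R) `^ (1 + e) *
    (l%:R / (l + ndist j.2 c.2)%:R) `^ (1 + e)).
Proof.
move=> l0 f1 f2.
set d1 := ndist j.1 _ in f1 *; set d2 := ndist _ _ in f2 *.
have [le1 le2] : (5 * l <= l + d1)%N /\ (5 * l <= l + d2)%N.
  by clear -f1 f2; clearbody d1 d2; lia.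
pose L := delta * l%:R.
have lR : 0 < l%:R :> R by rewrite ltr0n.
have L0 : 0 < L by rewrite mulr_gt0.
pose N1 := delta * (l + d1)%:R; pose N2 := delta * (l + d2)%:R.
have -> : l%:R / (l + d1)%:R = L / N1 :> R.
  by rewrite /L /N1 -mulf_div divff ?mul1r// gt_eqF.
have -> : l%:R / (l + d2)%:R = L / N2 :> R.
  by rewrite /L /N2 -mulf_div divff ?mul1r// gt_eqF.
have LN1 : 5 * L <= N1.
  by rewrite /L /N1 mulrCA ler_pM2l// -natrM ler_nat.
have LN2 : 5 * L <= N2.
  by rewrite /L /N2 mulrCA ler_pM2l// -natrM ler_nat.
have dL : delta <= L by rewrite /L ler_peMr ?(ltW delta0)// ler1n.
set w := (_ `^ _ * _).
pose x0 := corner o delta c; pose y0 := corner o delta j.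
have x0c : cube o delta c l x0 by apply/squareP; rewrite !lexx !ltrDl.
have y0c : cell j y0 by apply/squareP; rewrite !lexx !ltrDl.
pose k0 := part P (K x0 y0).
exists (delta ^+ 2 * k0) => i ic.
pose E := [set z | cell i (sel pr z) /\ cell j (sel (~~ pr) z)].
have dist (k : bool) x y : cube o delta c l x -> cell j y ->
    3 / 5 * (if k then N1 else N2) <= `|crd k x - crd k y|.
  move=> hx hy.
  have := far_dist delta0 l0 (crd_cube k hx) (crd_cell k hy).
  by rewrite /ncrd; case: k => h; exact: h.
have mE : measurable E.
  apply: (@measurableI _ _ [set z | cell i (sel pr z)]
    [set z | cell j (sel (~~ pr) z)]); apply: measurable_sel_set;
    exact: measurable_square.
have EmE : m2 E = (delta ^+ 4)%:E.
  have -> : E = (if pr then cell i else cell j) `*` (if pr then cell j else cell i).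
    rewrite /E /sel; case: (pr); apply/seteqP; split => -[x y] /= [] //.
  rewrite product_measure1E; [|by case: ifP => _; exact: measurable_square..].
  rewrite (_ : (delta ^+ 4)%:E = (delta ^+ 2)%:E * (delta ^+ 2)%:E)%E; last first.
    by rewrite -EFinM -exprD.
  by congr (_ * _)%E; case: (pr); apply: area_square; exact: ltW.
have ED : E `<=` off_set.
  move=> z [hz1 hz2]; have hc := cell_cube delta0 ic hz1.
  have g (k : bool) : crd k (sel pr z) != crd k (sel (~~ pr) z).
    rewrite -subr_eq0 -normr_gt0; apply: lt_le_trans (dist k _ _ hc hz2).
    by case: k; lra.
  have := g true; have := g false; rewrite /crd /sel.
  by case: (pr) => /= h1 h2; split; rewrite // eq_sym.
have near_k0 z : E z -> `|part P (K (sel pr z) (sel (~~ pr) z)) *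
   (stepf (sqr c l) (fun i' => (i' == i)%:R) (sel pr z) *
    \1_(cell j) (sel (~~ pr) z)) - k0| <= 36 * CK * L ^- 2 * w.
  move=> [hz1 hz2]; have hc := cell_cube delta0 ic hz1.
  rewrite (stepf_cell delta0 _ (sqr_uniq _ _) ic hz1) eqxx indicE mem_set// !mulr1.
  rewrite -partB; apply: le_trans (part_normc _ _) _.
  move: (sel pr z) (sel (~~ pr) z) hc hz2 => x y hx hy.
  have e1 : e <= 1 by case/andP: th1P => _ h; move: h e0 et1; lra.
  have dx k : `|crd k x - crd k x0| <= L.
    move: (crd_cube k hx) (crd_cube k x0c) => /andP[a1 a2] /andP[a3 a4].
    by move: a1 a2 a3 a4; rewrite ler_norml /L => *; apply/andP; split; lra.
  have dy k : `|crd k y - crd k y0| <= L.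
    move: (crd_cell k hy) (crd_cell k y0c) => /andP[a1 a2] /andP[a3 a4].
    by move: a1 a2 a3 a4; rewrite ler_norml => *; apply/andP; split; lra.
  have dd (k : bool) (u v : R) : (u == crd k x) || (u == crd k x0) ->
      (v == crd k y) || (v == crd k y0) ->
      3 / 5 * (if k then N1 else N2) <= `|u - v|.
    by move=> /orP[]/eqP-> /orP[]/eqP->; exact: dist.
  exact: (kernel_osc th1P th2P CK0 mb mbt e0 e1 et1 et2 L0 LN1 LN2
    (dx true) (dx false) (dy true) (dy false) (dd true) (dd false)).
have eta0 : 0 <= 36 * CK * L ^- 2 * w.
  by rewrite !mulr_ge0 ?powR_ge0// invr_ge0 exprn_ge0 ?(ltW L0).
have out z : off_set z -> ~ E z -> part P (K (sel pr z) (sel (~~ pr) z)) *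
   (stepf (sqr c l) (fun i' => (i' == i)%:R) (sel pr z) *
    \1_(cell j) (sel (~~ pr) z)) = 0.
  move=> _ nE; have [hz|hz] := pselect (cell j (sel (~~ pr) z)); last first.
    by rewrite indicE memNset ?mulr0.
  rewrite (_ : stepf _ _ _ = 0) ?mul0r ?mulr0//.
  rewrite /stepf (bigD1_seq i) ?sqr_uniq//= big1 => [|i' /negbTE ->]; last by rewrite mul0r.
  by rewrite indicE memNset ?mulr0 ?addr0// => hi; exact: nE.
have := Rintegral_near_cst (mu := m2) (@measurable_off_axes R) mE ED _ eta0 near_k0 out.
rewrite /= EmE ltry => /(_ isT) h.
rewrite (_ : _ - _ = delta ^- 2 * (step_form (sqr c l) (fun i' => (i' == i)%:R) j -
  k0 * delta ^+ 4)); last by field; rewrite gt_eqF.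
rewrite normrM ger0_norm ?invr_ge0 ?exprn_ge0 ?(ltW delta0)//.
apply: le_trans (_ : delta ^- 2 * (36 * CK * L ^- 2 * w * delta ^+ 4) <= _).
  by rewrite ler_wpM2l ?invr_ge0 ?exprn_ge0 ?(ltW delta0).
by rewrite /L le_eqVlt; apply/orP; left; apply/eqP; field; rewrite !gt_eqF.
Qed.

Definition Cfar := 36 * CK + 700 * Csing th2 * CK.

Lemma Cfar_ge0 : 0 <= Cfar.
Proof.
exact: addr_ge0 (mulr_ge0 (ler0n R 36) CK0)
  (mulr_ge0 (mulr_ge0 (ler0n R 700) (Csing_ge0 th2_gt0)) CK0).
Qed.

(** Stated for any sequence with the right sums against bounded s, hence for columns of the matrix
    and of its transpose. If one coordinate is near, the centre is 0 and s is the sign of the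
    sequence; if both are far, s singles out one entry, and the l^2 entries cancel the factor
    l^-2. *)
Lemma step_form_far c l j : (0 < l)%N -> ~~ near_sqr c l j ->
  exists m : R, forall a : nat * nat -> R,
  (forall s, (forall i, `|s i| <= 1) ->
     \sum_(i <- sqr c l) s i * a i = delta ^- 2 * step_form (sqr c l) s j) ->
  \sum_(i <- sqr c l) `|a i - m| <= Cfar * weight (1 + e) c l j.
Proof.
move=> l0; rewrite /near_sqr /weight /decayw.
have lR : 0 < l%:R :> R by rewrite ltr0n.
have near_case k : (ndist (ncrd k j) (ncrd k c) < 4 * l)%N ->
    (4 * l <= ndist (ncrd (~~ k) j) (ncrd (~~ k) c))%N ->
    exists m : R, forall a : nat * nat -> R,
    (forall s, (forall i, `|s i| <= 1) ->
      \sum_(i <- sqr c l) s i * a i = delta ^- 2 * step_form (sqr c l) s j) ->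
    \sum_(i <- sqr c l) `|a i - m| <= Cfar *
     ((l%:R / (l + ndist (ncrd k j) (ncrd k c))%:R) `^ (1 + e) *
    (l%:R / (l + ndist (ncrd (~~ k) j) (ncrd (~~ k) c))%:R) `^ (1 + e)).
  move=> hn hf; exists 0 => a ha.
  have sg i : `|Num.sg (a i)| <= 1.
    by rewrite normr_sg; case: (_ != _); rewrite ?ler01.
  under eq_bigr do rewrite subr0 normrEsg.
  rewrite (ha (fun i => Num.sg (a i)) sg).
  apply: le_trans (ler_norm _) _.
  rewrite normrM ger0_norm ?invr_ge0 ?exprn_ge0 ?(ltW delta0)//.
  apply: le_trans (near_far_bound l0 sg hn hf) _.
  by rewrite ler_wpM2r// /Cfar lerDr; exact: mulr_ge0 (ler0n R 36) CK0.
rewrite negb_and -!leqNgt => h.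
have [h1|h1] := ltnP (ndist j.1 c.1) (4 * l).
  by apply: (near_case true) => //; move: h; rewrite leqNgt h1.
have [h2|h2] := ltnP (ndist j.2 c.2) (4 * l).
  by rewrite [X in _ * X]mulrC; exact: (near_case false).
have [m hm] := far_far_bound l0 h1 h2.
exists m => a ha.
set w := (_ `^ _ * _).
have w0 : 0 <= w by rewrite mulr_ge0 ?powR_ge0.
apply: (@le_trans _ _ (\sum_(i <- sqr c l) 36 * CK * l%:R ^- 2 * w)).
  rewrite big_seq [leRHS]big_seq; apply: ler_sum => i ic.
  have s1 i' : `|((i' == i)%:R : R)| <= 1.
    by case: (_ == _); rewrite ?normr0 ?normr1.
  have -> : a i = delta ^- 2 * step_form (sqr c l) (fun i' => (i' == i)%:R) j.
    rewrite -(ha _ s1) (bigD1_seq i) ?sqr_uniq//= eqxx mul1r big1 ?addr0//.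
    by move=> i' /negbTE ->; rewrite mul0r.
  exact: hm.
rewrite big_const_seq count_predT size_sqr iter_addr_0 -[_ *+ _]mulr_natr natrM.
rewrite [leLHS](_ : _ = 36 * CK * w); last by field; rewrite gt_eqF.
rewrite ler_wpM2r// /Cfar lerDl.
exact: mulr_ge0 (mulr_ge0 (ler0n R 700) (Csing_ge0 th2_gt0)) CK0.
Qed.

End kernel_far_bounds.

(** * Lebesgue spaces *)

Section complex_measurability.
Context d (X : measurableType d) (R : realType).
Implicit Types f g : X -> R[i].

Lemma cmeasurableP f :
  cmeasurable f <-> forall c, measurable_fun setT (fun x => part c (f x)).
Proof. by split=> [[h1 h2] [|]//|h]; split; [exact: (h true)|exact: (h false)]. Qed.

Lemma partM c (z w : R[i]) : part c (z * w) =
  if c then part true z * part true w - part false z * part false w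
  else part true z * part false w + part false z * part true w.
Proof. by case: z w c => a b [u v] [] /=; rewrite /part. Qed.

Lemma cmeasurableD f g : cmeasurable f -> cmeasurable g ->
  cmeasurable (fun x => f x + g x).
Proof.
move=> /cmeasurableP mf /cmeasurableP mg; apply/cmeasurableP => c.
by under eq_fun do rewrite partD; exact: measurable_funD.
Qed.

Lemma cmeasurableM f g : cmeasurable f -> cmeasurable g ->
  cmeasurable (fun x => f x * g x).
Proof.
move=> /cmeasurableP mf /cmeasurableP mg; apply/cmeasurableP => c.
under eq_fun do rewrite partM.
by case: c; [apply: measurable_funB|apply: measurable_funD]; apply: measurable_funM.
Qed.

Lemma cmeasurable_cst (z : R[i]) : cmeasurable (fun _ : X => z).
Proof. by split; exact: measurable_cst. Qed.

Lemma cmeasurableZ (z : R[i]) f : cmeasurable f -> cmeasurable (fun x => z * f x).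
Proof. by move=> mf; apply: cmeasurableM => //; exact: cmeasurable_cst. Qed.

Lemma cmeasurableB f g : cmeasurable f -> cmeasurable g ->
  cmeasurable (fun x => f x - g x).
Proof.
move=> mf mg; have := cmeasurableD mf (cmeasurableZ (-1) mg).
by under eq_fun do rewrite mulN1r.
Qed.

Lemma cmeasurable_real (u : X -> R) : measurable_fun setT u ->
  cmeasurable (fun x => (u x)%:C).
Proof. by move=> mu; split => //=; exact: measurable_cst. Qed.

Lemma cmeasurable_part c f : cmeasurable f -> measurable_fun setT (fun x => part c (f x)).
Proof. by move=> /cmeasurableP. Qed.

Lemma measurable_normc f : cmeasurable f -> measurable_fun setT (fun x => normc (f x)).
Proof.
move=> [m1 m2]; have -> : (fun x => normc (f x)) =
    (fun x => (complex.Re (f x) ^+ 2 + complex.Im (f x) ^+ 2) `^ 2^-1).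
  by apply/funext => x; case: (f x) => a b /=; rewrite powR12_sqrt// addr_ge0 ?sqr_ge0.
apply: (measurableT_comp (measurable_powR _)).
by apply: measurable_funD; exact: measurable_funX.
Qed.

Lemma normc_ge0 (z : R[i]) : 0 <= normc z.
Proof. by case: z => a b; exact: sqrtr_ge0. Qed.

Lemma normc_real (u : R) : normc u%:C = `|u|.
Proof. by rewrite /normc /= expr0n addr0 sqrtr_sqr. Qed.

Lemma normc_parts (z : R[i]) : normc z <= `|part true z| + `|part false z|.
Proof.
case: z => a b; rewrite /part /= -[leRHS]ger0_norm ?addr_ge0// -sqrtr_sqr.
apply: ler_wsqrtr; rewrite sqrrD !real_normK ?num_real//.
have : 0 <= `|a| * `|b| by rewrite mulr_ge0.
by rewrite mulr2n; lra.
Qed.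

End complex_measurability.

Lemma ler_poweR2r (R : realType) (r : R) (x y : \bar R) :
  0 <= r -> (0 <= x)%E -> (x <= y)%E -> (x `^ r <= y `^ r)%E.
Proof.
move=> r0 x0 xy; apply: gt0_ler_poweR => //; rewrite in_itv/= leey ?andbT//.
exact: le_trans xy.
Qed.

Section Lp_toolkit.
Context (R : realType).
Implicit Types (f g : plane R -> R[i]) (p q : R).

Definition Npow p f : \bar R := \int[area R]_x ((normc (f x)) `^ p)%:E.

Lemma Npow_ge0 p f : (0 <= Npow p f)%E.
Proof. by apply: integral_ge0 => x _; rewrite lee_fin powR_ge0. Qed.

Lemma LpnormE p f : 0 < p -> Lpnorm p f = (Npow p f `^ p^-1)%E.
Proof.
move=> p0; have := @powR_Lnorm _ _ _ (area R) (fun x => (normc (f x))%:E) p (lt0r_neq0 p0).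
rewrite (_ : (\int[_]_x _)%E = Npow p f).
  move=> <-; rewrite -poweRrM mulfV ?gt_eqF// poweRe1//; exact: Lnorm_ge0.
by apply: eq_integral => x _; rewrite /= ger0_norm ?normc_ge0.
Qed.

Lemma Lpnorm_ge0 p f : (0 <= Lpnorm p f)%E. Proof. exact: Lnorm_ge0. Qed.

Lemma powR_Lpnorm p f : 0 < p -> (Lpnorm p f `^ p)%E = Npow p f.
Proof.
move=> p0; rewrite LpnormE// -poweRrM mulVf ?gt_eqF// poweRe1//; exact: Npow_ge0.
Qed.

Lemma Lpnorm_le_fin p f (c : R) : 0 < p -> 0 <= c ->
  (Lpnorm p f <= c%:E)%E <-> (Npow p f <= (c `^ p)%:E)%E.
Proof.
move=> p0 c0; have c0' : (0 <= c%:E)%E by rewrite lee_fin.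
have cp : (0 <= (c `^ p)%:E)%E by rewrite lee_fin powR_ge0.
split=> h.
  rewrite -powR_Lpnorm// -poweR_EFin; apply: ler_poweR2r => //; first exact: ltW.
  exact: Lpnorm_ge0.
rewrite LpnormE// (_ : c%:E = ((c `^ p)%:E `^ p^-1)%E); last first.
  by rewrite poweR_EFin -powRrM mulfV ?gt_eqF// powRr1.
apply: ler_poweR2r => //; first by rewrite invr_ge0 ltW.
exact: Npow_ge0.
Qed.

Lemma Lpnorm_le p f g : 0 < p -> (forall x, normc (f x) <= normc (g x)) ->
  (Lpnorm p f <= Lpnorm p g)%E.
Proof.
move=> p0 fg; rewrite (LpnormE f p0) (LpnormE g p0); apply: ler_poweR2r; first by rewrite invr_ge0 ltW.
  exact: Npow_ge0.
apply: integral_monotone => x _; rewrite lee_fin; apply: ler_powR2r => //.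
  exact: ltW.
exact: normc_ge0.
Qed.

Lemma eq_Lpnorm p f g : (forall x, normc (f x) = normc (g x)) ->
  Lpnorm p f = Lpnorm p g.
Proof. by move=> h; apply: eq_Lnorm => x /=; rewrite h. Qed.

Lemma Lpnorm_triangle p f g : 1 <= p -> cmeasurable f -> cmeasurable g ->
  (Lpnorm p (fun x => (f x + g x)%R) <= Lpnorm p f + Lpnorm p g)%E.
Proof.
move=> p1 mf mg; have p0 : 0 < p by exact: lt_le_trans p1.
apply: le_trans (minkowski_EFin (area R) (measurable_normc mf) (measurable_normc mg) p1).
pose h x : R[i] := (normc (f x) + normc (g x))%:C.
have hE x : normc (h x) = normc (f x) + normc (g x).
  by rewrite normc_real ger0_norm ?addr_ge0 ?normc_ge0.
apply: (@le_trans _ _ (Lpnorm p h)).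
  by apply: Lpnorm_le => // x; rewrite hE; exact: le_normcD.
rewrite le_eqVlt; apply/orP; left; apply/eqP/eq_Lnorm => x.
by rewrite (hE x).
Qed.

Lemma LpnormZ p (z : R[i]) f : 0 < p -> cmeasurable f ->
  Lpnorm p (fun x => z * f x) = ((normc z)%:E * Lpnorm p f)%E.
Proof.
move=> p0 mf; rewrite (LpnormE _ p0) (LpnormE f p0).
have -> : Npow p (fun x => z * f x) = (((normc z) `^ p)%:E * Npow p f)%E.
  rewrite /Npow -ge0_integralZl//.
  - by apply: eq_integral => x _; rewrite normcM powRM ?normc_ge0// EFinM.
  - apply/measurable_EFinP; apply: (measurableT_comp (measurable_powR _)).
    exact: measurable_normc.
  - by move=> x _; rewrite lee_fin powR_ge0.
  - by rewrite lee_fin powR_ge0.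
rewrite poweRM ?Npow_ge0// ?lee_fin ?powR_ge0//.
by rewrite poweR_EFin -powRrM mulfV ?gt_eqF// powRr1 ?normc_ge0.
Qed.

Lemma LpD p f g : 1 <= p -> Lp p f -> Lp p g -> Lp p (fun x => f x + g x).
Proof.
move=> p1 [mf ff] [mg fg]; split; first exact: cmeasurableD.
by apply: le_lt_trans (Lpnorm_triangle p1 mf mg) _; exact: lte_add_pinfty.
Qed.

Lemma LpZ p (z : R[i]) f : 0 < p -> Lp p f -> Lp p (fun x => z * f x).
Proof.
move=> p0 [mf ff]; split; first exact: cmeasurableZ.
rewrite LpnormZ//; apply: lte_mul_pinfty => //; first by rewrite lee_fin normc_ge0.
Qed.

Lemma LpB p f g : 1 <= p -> Lp p f -> Lp p g -> Lp p (fun x => f x - g x).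
Proof.
move=> p1 lf lg; have p0 : 0 < p by exact: lt_le_trans p1.
have := LpD p1 lf (LpZ (-1) p0 lg).
by under eq_fun do rewrite mulN1r.
Qed.

Lemma Lp_le p f g : 0 < p -> cmeasurable f -> (forall x, normc (f x) <= normc (g x)) ->
  Lp p g -> Lp p f.
Proof.
by move=> p0 mf fg [_ h]; split => //; apply: le_lt_trans h; exact: Lpnorm_le.
Qed.

Lemma cHoelder p q f g : 0 < p -> 0 < q -> p^-1 + q^-1 = 1 ->
  cmeasurable f -> cmeasurable g ->
  (\int[area R]_x (normc (f x * g x))%:E <= Lpnorm p f * Lpnorm q g)%E.
Proof.
move=> p0 q0 pq mf mg.
apply: le_trans (hoelder (area R) (measurable_normc mf) (measurable_normc mg) p0 q0 pq).
rewrite Lnorm1; apply: integral_monotone => x _ /=.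
by rewrite ger0_norm ?mulr_ge0 ?normc_ge0// normcM.
Qed.

Definition csummable f := forall c, (area R).-integrable setT (fun x => (part c (f x))%:E).

Lemma csummable_normc f : cmeasurable f ->
  (\int[area R]_x (normc (f x))%:E < +oo)%E -> csummable f.
Proof.
move=> mf ff c; apply/integrableP; split.
  by apply/measurable_EFinP; exact: cmeasurable_part.
apply: le_lt_trans ff; apply: integral_monotone => x _.
by rewrite /= lee_fin; exact: part_normc.
Qed.

Lemma part_cintegral c f : part c (cintegral (area R) setT f) =
  \int[area R]_x part c (f x).
Proof. by case: c. Qed.

Lemma complexP (z w : R[i]) : (forall c, part c z = part c w) -> z = w.
Proof. by case: z w => a b [u v] h; have := h true; have := h false; rewrite /part /= => -> ->. Qed.

Lemma cintegralD f g : csummable f -> csummable g ->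
  cintegral (area R) setT (fun x => f x + g x) =
  cintegral (area R) setT f + cintegral (area R) setT g.
Proof.
move=> sf sg; apply: complexP => c; rewrite partD !part_cintegral.
rewrite -RintegralD//; first by under eq_Rintegral do rewrite partD.
- exact: sf.
- exact: sg.
Qed.

Lemma cintegralZ (z : R[i]) f : csummable f ->
  cintegral (area R) setT (fun x => z * f x) = z * cintegral (area R) setT f.
Proof.
move=> sf; apply: complexP => c; rewrite partM !part_cintegral.
under eq_Rintegral do rewrite partM.
have i (r : R) c' : (area R).-integrable setT (fun x => (r * part c' (f x))%:E).
  by under eq_fun do rewrite EFinM; apply: integrableZl => //; exact: sf.
case: c.
  by rewrite RintegralB ?i// !RintegralZl//; exact: sf.
by rewrite RintegralD ?i// !RintegralZl//; exact: sf.
Qed.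

Lemma part_cintegral_le c f :
  (`|part c (cintegral (area R) setT f)|%:E <= \int[area R]_x (normc (f x))%:E)%E.
Proof.
have [h|h] := ltP (\int[area R]_x (normc (f x))%:E)%E +oo%E; last first.
  by move: h; rewrite leye_eq => /eqP ->; rewrite leey.
have h0 : (0 <= \int[area R]_x (normc (f x))%:E)%E.
  by apply: integral_ge0 => x _; rewrite lee_fin normc_ge0.
rewrite part_cintegral -[leRHS]fineK ?ge0_fin_numE// lee_fin.
apply: Rintegral_abs_le => // x _; rewrite lee_fin; exact: part_normc.
Qed.

Lemma csummable_prod p q f g : 0 < p -> 0 < q -> p^-1 + q^-1 = 1 ->
  Lp p f -> Lp q g -> csummable (fun x => f x * g x).
Proof.
move=> p0 q0 pq [mf ff] [mg fg]; apply: csummable_normc; first exact: cmeasurableM.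
apply: le_lt_trans (cHoelder p0 q0 pq mf mg) _.
by apply: lte_mul_pinfty => //; [exact: Lpnorm_ge0|rewrite ge0_fin_numE//; exact: Lpnorm_ge0].
Qed.

Lemma pairing_part_le p q c f g : 0 < p -> 0 < q -> p^-1 + q^-1 = 1 ->
  cmeasurable f -> cmeasurable g ->
  (`|part c (pairing f g)|%:E <= Lpnorm p f * Lpnorm q g)%E.
Proof.
move=> p0 q0 pq mf mg; apply: le_trans (part_cintegral_le _ _) _; exact: cHoelder.
Qed.

Lemma half_conj : 2^-1 + 2^-1 = 1 :> R. Proof. lra. Qed.

Lemma csummable2 f g : Lp 2 f -> Lp 2 g -> csummable (fun x => f x * g x).
Proof. by apply: csummable_prod => //; exact: half_conj. Qed.

Lemma pairing_linr (z : R[i]) f g h : Lp 2 f -> Lp 2 g -> Lp 2 h ->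
  pairing f (fun x => z * g x + h x) = z * pairing f g + pairing f h.
Proof.
move=> lf lg lh; have lzg : Lp 2 (fun x => z * g x) by exact: LpZ.
rewrite /pairing -cintegralZ; last exact: csummable2.
rewrite -cintegralD; first by congr cintegral; apply/funext => x; ring.
- under [X in csummable X]eq_fun do rewrite mulrCA; exact: csummable2.
- exact: csummable2.
Qed.

Lemma pairing_linl (z : R[i]) f f' g : Lp 2 f -> Lp 2 f' -> Lp 2 g ->
  pairing (fun x => z * f x + f' x) g = z * pairing f g + pairing f' g.
Proof.
have pC (u v : plane R -> R[i]) : pairing u v = pairing v u.
  by rewrite /pairing; congr cintegral; apply/funext => x; exact: mulrC.
by move=> lf lf' lg; rewrite pC pairing_linr// (pC g f) (pC g f').
Qed.

(** T is linear only almost everywhere, so its identities are used through pairings, which do not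
    see null sets. *)
Lemma pairing_ae f f' g : cmeasurable f -> cmeasurable f' -> cmeasurable g ->
  ae_equal f f' -> pairing f g = pairing f' g.
Proof.
move=> mf mf' mg ff'; apply: complexP => c; rewrite !part_cintegral /Rintegral.
congr fine; apply: ae_eq_integral => //.
- by apply/measurable_EFinP; exact: cmeasurable_part (cmeasurableM mf mg).
- by apply/measurable_EFinP; exact: cmeasurable_part (cmeasurableM mf' mg).
by move: ff'; apply: filterS => x /= -> _.
Qed.

End Lp_toolkit.

Section complex_step_functions.
Context (R : realType).
Variables (o : plane R) (delta : R).
Hypothesis delta0 : 0 < delta.
Implicit Types (s : nat * nat -> R) (r : seq (nat * nat)) (q : R).

Definition cstep r s (x : plane R) : R[i] := (stepf o delta r s x)%:C.
Definition cind i (x : plane R) : R[i] := (\1_(cell o delta i) x)%:C.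

Lemma cstep_cons j r s : cstep (j :: r) s = fun x => (s j)%:C * cind j x + cstep r s x.
Proof. by apply/funext => x; rewrite /cstep /stepf big_cons rmorphD rmorphM. Qed.

Lemma cstep_nil s : cstep [::] s = fun=> 0.
Proof. by apply/funext => x; rewrite /cstep /stepf big_nil. Qed.

Lemma measurable_cell i : measurable (cell o delta i).
Proof. exact: measurable_square. Qed.

Lemma measurable_stepf r s : measurable_fun setT (stepf o delta r s).
Proof.
apply: measurable_sum => i; apply: measurable_funM => //.
by apply: measurable_indic; exact: measurable_cell.
Qed.

Lemma stepf_powR r s q x : 0 < q -> uniq r ->
  `|stepf o delta r s x| `^ q = \sum_(i <- r) `|s i| `^ q * \1_(cell o delta i) x.
Proof.
move=> q0 ur; have [[i ir ix]|h] := pselect (exists2 i, i \in r & cell o delta i x).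
  rewrite (stepf_cell delta0 s ur ir ix).
  exact/esym/(stepf_cell delta0 (fun i => `|s i| `^ q) ur ir ix).
have no i : i \in r -> ~ cell o delta i x by move=> ir ix; apply: h; exists i.
rewrite stepf_out// normr0 powR0 ?gt_eqF// big_seq big1// => i /no ix.
by rewrite indicE memNset// mulr0.
Qed.

Lemma Npow_cstep r s q : 0 < q -> uniq r ->
  Npow q (cstep r s) = (delta ^+ 2 * \sum_(i <- r) `|s i| `^ q)%:E.
Proof.
move=> q0 ur; rewrite /Npow.
transitivity (\int[area R]_x \sum_(i <- r) (`|s i| `^ q)%:E * (\1_(cell o delta i) x)%:E)%E.
  by apply: eq_integral => x _; rewrite normc_real stepf_powR// -sumEFin.
rewrite ge0_integral_sum//; last first.
  move=> i; apply: measurable_funeM; apply/measurable_EFinP.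
  by apply: measurable_indic; exact: measurable_cell.
rewrite mulr_sumr -sumEFin; apply: eq_bigr => i _.
rewrite ge0_integralZl//; last first.
  by apply/measurable_EFinP; apply: measurable_indic; exact: measurable_cell.
rewrite integral_indic//; last exact: measurable_cell.
rewrite setIT [X in (_ * X)%E](_ : _ = (delta ^+ 2)%:E); last first.
  by apply: area_square; exact: ltW.
by rewrite -EFinM mulrC.
Qed.

Lemma cmeasurable_cstep r s : cmeasurable (cstep r s).
Proof. by apply: cmeasurable_real; exact: measurable_stepf. Qed.

Lemma Lpnorm_cstep r s q : 0 < q -> uniq r ->
  Lpnorm q (cstep r s) = ((delta ^+ 2 * \sum_(i <- r) `|s i| `^ q) `^ q^-1)%:E.
Proof. by move=> q0 ur; rewrite LpnormE// Npow_cstep// poweR_EFin. Qed.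

Lemma Lp_cstep r s q : 0 < q -> uniq r -> Lp q (cstep r s).
Proof.
by move=> q0 ur; split; [exact: cmeasurable_cstep|rewrite Lpnorm_cstep// ltry].
Qed.

Lemma cind_cstep i : cind i = cstep [:: i] (fun=> 1).
Proof. by apply/funext => x; rewrite /cind /cstep /stepf big_seq1 mul1r. Qed.

Lemma Lp_cind i q : 0 < q -> Lp q (cind i).
Proof. by move=> q0; rewrite cind_cstep; exact: Lp_cstep. Qed.

Lemma square_step_cstep r s : square_step (cstep r s).
Proof.
exists [seq ((s i)%:C, (corner o delta i, delta)) | i <- r]; split.
  by move=> q /mapP[i _ ->].
move=> x; rewrite big_map /cstep /stepf rmorph_sum /=.
by apply: eq_bigr => i _; rewrite rmorphM.
Qed.

End complex_step_functions.

(** * Discretization of the operator *)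

Section bilinear_form.
Context (R : realType).
Variable T : (plane R -> R[i]) -> plane R -> R[i].
Hypothesis Tb : L2_bounded T.
Implicit Types (f g h : plane R -> R[i]).

Definition opform f g := pairing (T f) g.

Lemma form_linr (z : R[i]) f g h : Lp 2 f -> Lp 2 g -> Lp 2 h ->
  opform f (fun x => z * g x + h x) = z * opform f g + opform f h.
Proof. by have [[TL _] _] := Tb; move=> lf lg lh; apply: pairing_linr => //; exact: TL. Qed.

Lemma form_linl (z : R[i]) f g h : Lp 2 f -> Lp 2 g -> Lp 2 h ->
  opform (fun x => z * f x + g x) h = z * opform f h + opform g h.
Proof.
have [[TL Tlin] _] := Tb; move=> lf lg lh.
have lzf : Lp 2 (fun x => z * f x) by exact: LpZ.
have lzg : Lp 2 (fun x => z * f x + g x) by apply: LpD => //; exact: ler1n.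
have lTz : Lp 2 (fun x => z * T f x + T g x).
  by apply: LpD; [exact: ler1n|apply: LpZ => //; exact: TL|exact: TL].
rewrite /opform (pairing_ae _ _ _ (Tlin z f g lf lg)).
- by apply: pairing_linl => //; exact: TL.
- by case: (TL _ lzg).
- by case: lTz.
- by case: lh.
Qed.

Lemma form0r f : opform f (fun=> 0) = 0.
Proof.
by apply: complexP => c; rewrite part_cintegral; under eq_Rintegral do rewrite mulr0;
  case: c; rewrite /part /= Rintegral_cst// mul0r.
Qed.

Lemma Lp0 (q : R) : 0 < q -> Lp q (fun _ : plane R => 0 : R[i]).
Proof.
move=> q0; split; first exact: cmeasurable_cst.
rewrite (_ : (fun _ => 0) = (fun x => 0 * (0 : R[i]))); last by apply/funext => x; rewrite mul0r.
by rewrite LpnormZ// normc0 mul0e ltry.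
Qed.

Lemma form0l g : Lp 2 g -> opform (fun=> 0) g = 0.
Proof.
move=> lg; have l0 : Lp 2 (fun _ : plane R => 0 : R[i]) by exact: Lp0.
have := form_linl 1 l0 l0 lg.
under [X in opform X _]eq_fun do rewrite mulr0 addr0.
by rewrite mul1r => /eqP; rewrite -subr_eq0 opprD addNKr oppr_eq0 => /eqP.
Qed.

Lemma form_bound : exists2 M : R, 0 <= M & forall c f g, Lp 2 f -> Lp 2 g ->
  (`|part c (opform f g)|%:E <= M%:E * Lpnorm 2 f * Lpnorm 2 g)%E.
Proof.
have [[TL _] [M hM]] := Tb.
exists `|M| => // c f g lf lg.
have lTf := TL f lf.
apply: le_trans (pairing_part_le c _ _ (@half_conj R) lTf.1 lg.1) _ => //.
apply: lee_wpmul2r; first exact: Lpnorm_ge0.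
apply: le_trans (hM f lf) _.
apply: lee_wpmul2r; first exact: Lpnorm_ge0.
by rewrite lee_fin ler_norm.
Qed.

Variables (o : plane R) (delta : R).
Hypothesis delta0 : 0 < delta.
Local Notation cstep := (cstep o delta).
Local Notation cind := (cind o delta).

Lemma form_cstepl r s g : uniq r -> Lp 2 g ->
  opform (cstep r s) g = \sum_(i <- r) (s i)%:C * opform (cind i) g.
Proof.
move=> + lg; elim: r => [|j r IH]; first by rewrite big_nil cstep_nil form0l.
move=> /[dup] ujr /= /andP[jr ur].
rewrite cstep_cons big_cons form_linl//; first by rewrite IH.
  exact: Lp_cind.
exact: Lp_cstep.
Qed.

Lemma form_cstepr r s f : uniq r -> Lp 2 f ->
  opform f (cstep r s) = \sum_(i <- r) (s i)%:C * opform f (cind i).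
Proof.
move=> + lf; elim: r => [|j r IH]; first by rewrite big_nil cstep_nil form0r.
move=> /[dup] ujr /= /andP[jr ur].
rewrite cstep_cons big_cons form_linr//; first by rewrite IH.
  exact: Lp_cind.
exact: Lp_cstep.
Qed.

(** The step functions tested below have real coefficients, so the real and imaginary parts of the
    form act as two real matrices. The factor delta^-2 makes their l^2 bound that of T, uniformly in
    the mesh. *)
Definition entry (P : bool) (i j : nat * nat) : R :=
  delta ^- 2 * part P (opform (cind j) (cind i)).

Lemma entry_suml P r s j : uniq r ->
  \sum_(i <- r) s i * entry P i j = delta ^- 2 * part P (opform (cind j) (cstep r s)).
Proof.
move=> ur; rewrite form_cstepr//; last exact: Lp_cind.
rewrite part_sum mulr_sumr; apply: eq_bigr => i _.
by rewrite partZ /entry mulrCA.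
Qed.

Lemma entry_sumr P r s i : uniq r ->
  \sum_(j <- r) entry P i j * s j = delta ^- 2 * part P (opform (cstep r s) (cind i)).
Proof.
move=> ur; rewrite form_cstepl//; last exact: Lp_cind.
rewrite part_sum mulr_sumr; apply: eq_bigr => j _.
by rewrite partZ /entry -mulrA; congr (_ * _); exact: mulrC.
Qed.

Lemma form_steps P n s t :
  part P (opform (cstep (box n) s) (cstep (box n) t)) =
  delta ^+ 2 * \sum_(i <- box n) t i * app n (entry P) s i.
Proof.
have ub : uniq (box n) by exact: sqr_uniq.
rewrite form_cstepr//; last exact: Lp_cstep.
rewrite part_sum mulr_sumr; apply: eq_bigr => i _.
rewrite partZ /app entry_sumr// [RHS]mulrCA; congr (_ * _).
by rewrite mulrA divff ?mul1r// expf_neq0// gt_eqF.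
Qed.

(** The form is tested on f and on the output u itself: X <= M sqrt(Y) sqrt(X), and sqrt(X)
    cancels. *)
Lemma entry_lp_bounded (M : R) P n : 0 <= M ->
  (forall c f g, Lp 2 f -> Lp 2 g ->
    (`|part c (opform f g)|%:E <= M%:E * Lpnorm 2 f * Lpnorm 2 g)%E) ->
  lp_bounded n 2 (M ^+ 2) (entry P).
Proof.
move=> M0 hM f; set u := app n (entry P) f.
have ub : uniq (box n) by exact: sqr_uniq.
set X := \sum_(i <- box n) `|u i| `^ 2; set Y := \sum_(j <- box n) `|f j| `^ 2.
have X0 : 0 <= X by apply: sumr_ge0 => i _; exact: powR_ge0.
have Y0 : 0 <= Y by apply: sumr_ge0 => i _; exact: powR_ge0.
have d0 : 0 <= delta by exact: ltW.
have two0 : 0 < 2 :> R by [].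
have := hM P (cstep (box n) f) (cstep (box n) u)
  (Lp_cstep _ delta0 _ two0 ub) (Lp_cstep _ delta0 _ two0 ub).
rewrite form_steps !Lpnorm_cstep// -!EFinM lee_fin -/X -/Y.
have -> : \sum_(i <- box n) u i * app n (entry P) f i = X.
  by apply: eq_bigr => i _; rewrite -/u powR_mulrn// real_normK ?num_real// expr2.
rewrite ger0_norm ?mulr_ge0 ?sqr_ge0// !powR12_sqrt ?mulr_ge0 ?sqr_ge0//.
rewrite !(sqrtrM _ (sqr_ge0 delta)) sqrtr_sqr (ger0_norm d0) => h.
have {}h : X <= M * Num.sqrt Y * Num.sqrt X.
  rewrite -(ler_pM2l (exprn_gt0 2 delta0)); apply: le_trans h _.
  by rewrite le_eqVlt; apply/orP; left; apply/eqP; ring.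
have [X00|Xn0] := eqVneq X 0; first by rewrite X00 mulr_ge0 ?sqr_ge0.
have sX : 0 < Num.sqrt X by rewrite sqrtr_gt0 lt_def Xn0.
have h2 : Num.sqrt X <= M * Num.sqrt Y.
  by rewrite -(ler_pM2r sX) -expr2 sqr_sqrtr.
rewrite -(sqr_sqrtr X0) -(sqr_sqrtr Y0) -exprMn.
by rewrite ler_pXn2r ?nnegrE ?sqrtr_ge0 ?mulr_ge0 ?sqrtr_ge0.
Qed.

End bilinear_form.

Section discretized_operator.
Context (R : realType).
Variables (T : (plane R -> R[i]) -> plane R -> R[i]) (K : plane R -> plane R -> R[i]).
Hypothesis Tb : L2_bounded T.
Hypothesis TK : associated T K.
Variables (th1 th2 CK e : R).
Hypotheses (th1P : 0 < th1 <= 1) (th2P : 0 < th2 <= 1) (CK0 : 0 <= CK).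
Hypotheses (e0 : 0 < e) (et1 : 2 * e <= th1) (et2 : 2 * e <= th2).
Hypothesis sb : size_bound th2 CK K.
Hypothesis mb : mixed_bound th1 th2 CK K.
Hypothesis mbt : mixed_bound th1 th2 CK (fun x y => K y x).

Lemma size_bound_tr : size_bound th2 CK (fun x y => K y x).
Proof.
move=> x y [h1 h2]; have := @sb y x; rewrite /decay.
rewrite (distrC y.1) (distrC y.2); apply.
by split; rewrite eq_sym.
Qed.

Variables (o : plane R) (delta : R).
Hypothesis delta0 : 0 < delta.
Local Notation cstep := (cstep o delta).
Local Notation cind := (cind o delta).

Lemma disjoint_supports c l s j : (0 < l)%N -> ~~ near_sqr c l j ->
  [set x | cind j x != 0] `&` [set x | cstep (sqr c l) s x != 0] = set0.
Proof.
move=> l0 nj; apply/seteqP; split => x //= -[hj]; apply/negP; rewrite negbK.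
have jx : cell o delta j x.
  apply: contrapT => h; move: hj; rewrite /cind indicE memNset// eqxx; exact.
rewrite /cstep stepf_out// => i ir ix.
have ij := cell_disjoint delta0 ix jx; rewrite {}ij in ir.
move/negP: nj; apply; move: ir; rewrite mem_sqr /near_sqr /ndist.
by case: (j) (c) => j1 j2 [c1 c2] /=; lia.
Qed.

Lemma entry_far P n : far_bounded n (1 + e) (Cfar th2 CK) (entry T o delta P).
Proof.
move=> c k j _ _ nj; have l0 : (0 < 2 ^ k)%N by rewrite expn_gt0.
have [m hm] := step_form_far o delta0 th1P th2P CK0 e0 et1 et2 sb mb mbt true P l0 nj.
exists m; apply: hm => s _; rewrite entry_suml ?sqr_uniq//; congr (_ * _).
rewrite /opform TK; last exact: disjoint_supports.
- rewrite /step_form /cintegral; case: P; apply: eq_Rintegral => z _;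
  rewrite /cind /cstep /part; case: (K _ _) => a b /=; ring.
- by rewrite cind_cstep; exact: square_step_cstep.
- exact: square_step_cstep.
Qed.

Lemma entry_far_tr P n : far_bounded n (1 + e) (Cfar th2 CK) (tr (entry T o delta P)).
Proof.
move=> c k j _ _ nj; have l0 : (0 < 2 ^ k)%N by rewrite expn_gt0.
have [m hm] := step_form_far o delta0 th1P th2P CK0 e0 et1 et2 size_bound_tr mbt mb false P l0 nj.
exists m; apply: hm => s _; rewrite /tr.
under eq_bigr do rewrite mulrC.
rewrite entry_sumr ?sqr_uniq//; congr (_ * _).
rewrite /opform TK; last by rewrite setIC; exact: disjoint_supports.
- rewrite /step_form /cintegral; case: P; apply: eq_Rintegral => z _;
  rewrite /cind /cstep /part; case: (K _ _) => a b /=; ring.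
- exact: square_step_cstep.
- by rewrite cind_cstep; exact: square_step_cstep.
Qed.

End discretized_operator.

Section discretized_commutator.
Context (R : realType).
Variables (T : (plane R -> R[i]) -> plane R -> R[i]) (K : plane R -> plane R -> R[i]).
Hypothesis Tb : L2_bounded T.
Hypothesis TK : associated T K.
Hypothesis czx : CZX_kernel K.

Lemma app_comm n (b : nat * nat -> R) a f i :
  comm n b a f i = b i * app n a f i - app n a (fun j => b j * f j) i.
Proof.
rewrite /comm /app mulr_sumr -sumrB; apply: eq_bigr => j _; ring.
Qed.

Lemma form_step_commutator (p q : R) : 1 < p -> p^-1 + q^-1 = 1 ->
  exists2 C : R, 0 <= C & forall (o : plane R) (delta : R), 0 < delta ->
  forall P n (b : nat * nat -> R) beta (s t : nat * nat -> R),
  0 <= beta -> discrete_bmo b beta ->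
  `|part P (opform T (cstep o delta (box n) s)
                   (cstep o delta (box n) (fun i => b i * t i)) -
            opform T (cstep o delta (box n) (fun i => b i * s i))
                   (cstep o delta (box n) t))| <=
  C * beta * ((delta ^+ 2 * \sum_(i <- box n) `|s i| `^ p) `^ p^-1 *
              (delta ^+ 2 * \sum_(i <- box n) `|t i| `^ q) `^ q^-1).
Proof.
move=> p1 pq; have p0 : 0 < p by exact: lt_trans p1.
have q0 : 0 < q.
  rewrite -invr_gt0; have -> : q^-1 = 1 - p^-1 by rewrite -pq addrC addKr.
  by rewrite subr_gt0 invf_lt1.
case: czx => th1 [th2 [CK0 [th1P th2P sb0 mb0 mbt0]]].
(* The definition of the kernel class does not prescribe the sign of the constant. *)
pose CK := `|CK0|.
have CKP : 0 <= CK by exact: normr_ge0.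
have sb : size_bound th2 CK K.
  move=> x y /sb0 h; apply: le_trans h _; rewrite -!mulrA; apply: ler_wpM2r.
    by rewrite !mulr_ge0 ?powR_ge0 ?invr_ge0.
  exact: ler_norm.
have mbE L : mixed_bound th1 th2 CK0 L -> mixed_bound th1 th2 CK L.
  move=> [h1 h2]; split=> x y w xy wx.
    apply: le_trans (h1 x y w xy wx) _; rewrite -!mulrA; apply: ler_wpM2r.
      by rewrite !mulr_ge0 ?powR_ge0 ?invr_ge0 ?powR_ge0.
    exact: ler_norm.
  apply: le_trans (h2 x y w xy wx) _; rewrite -!mulrA; apply: ler_wpM2r.
    by rewrite !mulr_ge0 ?powR_ge0 ?invr_ge0 ?powR_ge0.
  exact: ler_norm.
have mb := mbE _ mb0; have mbt := mbE _ mbt0.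
(* [scaled_decay] spends half of the Hölder exponent and half of the decay exponent, so 2 e may not
   exceed either. *)
pose e := Num.min th1 th2 / 2.
have m0 : 0 < Num.min th1 th2.
  by rewrite lt_min; case/andP: th1P => -> _; case/andP: th2P => ->.
have e0 : 0 < e by rewrite divr_gt0.
have e2 : 2 * e = Num.min th1 th2 by rewrite /e mulrC divfK.
have et1 : 2 * e <= th1 by rewrite e2 ge_min lexx.
have et2 : 2 * e <= th2 by rewrite e2 ge_min lexx orbT.
have [M M0 hM] := form_bound Tb.
have th20 : 0 < th2 by case/andP: th2P.
have kp1 : 1 < 1 + e by rewrite ltrDl.
have [C C0 hC] := @discrete_commutator R p (1 + e) (M ^+ 2) (Cfar th2 CK) p1 kp1
  (sqr_ge0 M) (Cfar_ge0 th2P CKP).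
exists (C `^ p^-1); first exact: powR_ge0.
move=> o delta delta0 P n b beta s t beta0 hb.
set a := entry T o delta P.
have h := hC n a b beta (entry_lp_bounded Tb o delta0 P n M0 hM)
  (entry_far Tb TK th1P th2P CKP e0 et1 et2 sb mb mbt o delta0 P (n := n))
  (entry_far_tr Tb TK th1P th2P CKP e0 et1 et2 sb mb mbt o delta0 P (n := n)) beta0 hb s.
have d2 : 0 <= delta ^+ 2 by exact: sqr_ge0.
rewrite partB !form_steps//.
set S := \sum_(i <- _) `|s i| `^ p; set U := \sum_(i <- _) `|t i| `^ q.
have S0 : 0 <= S by apply: sumr_ge0 => i _; exact: powR_ge0.
have U0 : 0 <= U by apply: sumr_ge0 => i _; exact: powR_ge0.
rewrite -mulrBr -sumrB.
under eq_bigr => i _.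
  rewrite (_ : _ - _ = t i * comm n b a s i); last first.
    by rewrite app_comm -/a; ring.
  over.
rewrite normrM (ger0_norm d2).
apply: (@le_trans _ _ (delta ^+ 2 * (C `^ p^-1 * beta * S `^ p^-1 * U `^ q^-1))).
  rewrite ler_wpM2l//; apply: le_trans (ler_norm_sum _ _ _) _.
  under eq_bigr do rewrite normrM mulrC.
  apply: le_trans (sum_holder _ p0 q0 pq _ _) _ => //.
  rewrite ler_wpM2r ?powR_ge0//.
  have -> : C `^ p^-1 * beta * S `^ p^-1 = (C * beta `^ p * S) `^ p^-1.
    by rewrite !powRM ?mulr_ge0 ?powR_ge0// powRK// gt_eqF.
  apply: ler_powR2r => //; first by rewrite invr_ge0 ltW.
  by apply: sumr_ge0 => i _; exact: powR_ge0.
rewrite !(powRM _ d2)//.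
(* The cell area is shared between the two norms according to 1/p + 1/q = 1; this removes delta from
   the constant. *)
have dd : delta ^+ 2 = (delta ^+ 2) `^ p^-1 * (delta ^+ 2) `^ q^-1.
  by rewrite -powRD ?pq ?powRr1// oner_eq0.
rewrite [in leLHS]dd.
move: (C `^ _) (S `^ _) (U `^ _) ((delta ^+ 2) `^ p^-1) ((delta ^+ 2) `^ q^-1) => v1 v2 v3 v4 v5.
by rewrite le_eqVlt; apply/orP; left; apply/eqP; ring.
Qed.

End discretized_commutator.

(** * Approximation by cell averages *)

Section cells_cover.
Context (R : realType).
Variables (o : plane R) (delta : R).
Hypothesis delta0 : 0 < delta.

Lemma interval_cell (w x : R) (c l : nat) :
  w + delta * c%:R <= x < w + delta * c%:R + delta * l%:R ->
  exists i, (c <= i < c + l)%N /\ w + delta * i%:R <= x < w + delta * i%:R + delta.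
Proof.
move=> /andP[h1 h2]; pose y := (x - w) / delta.
have c0 : 0 <= c%:R :> R by exact: ler0n.
have xw : delta * c%:R <= x - w by lra.
have cy : c%:R <= y by rewrite ler_pdivlMr// mulrC.
have y0 : 0 <= y by exact: le_trans cy.
have yl : y < (c + l)%:R by rewrite ltr_pdivrMr// natrD mulrC mulrDr; lra.
have /andP[t1 t2] := truncn_itv y0.
set i := Num.trunc y in t1 t2.
have yE : delta * y = x - w by rewrite /y mulrC divfK// gt_eqF.
exists i; split.
  apply/andP; split.
    by rewrite -ltnS -(ltr_nat R); exact: le_lt_trans t2.
  by rewrite -(ltr_nat R); exact: le_lt_trans yl.
have e1 : delta * i%:R <= delta * y by rewrite ler_pM2l.
have e2 : delta * y < delta * i.+1%:R by rewrite ltr_pM2l.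
by move: e1 e2; rewrite yE -natr1 mulrDr mulr1 => *; apply/andP; split; lra.
Qed.

Lemma cube_cell c l x : cube o delta c l x ->
  exists2 i, i \in sqr c l & cell o delta i x.
Proof.
move=> /squareP[/interval_cell[i1 [h1 h2]] /interval_cell[i2 [h3 h4]]].
by exists (i1, i2); [rewrite mem_sqr/= h1 h3|apply/squareP].
Qed.

Lemma cube_bigU c l : cube o delta c l = \big[setU/set0]_(i <- sqr c l) cell o delta i.
Proof.
apply/seteqP; split => x.
  by move=> /cube_cell[i ic ix]; rewrite -bigcup_seq; exists i.
by rewrite -bigcup_seq => -[i /= ic ix]; exact: cell_cube ic ix.
Qed.

Lemma trivIset_cell (A : set (nat * nat)) : trivIset A (cell o delta).
Proof. by move=> i j _ _ [x [ix jx]]; exact: (cell_disjoint delta0 ix jx). Qed.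

Lemma ge0_integral_cells c l (f : plane R -> \bar R) :
  measurable_fun setT f -> (forall x, (0 <= f x)%E) ->
  (\int[area R]_(x in cube o delta c l) f x =
   \sum_(i <- sqr c l) \int[area R]_(x in cell o delta i) f x)%E.
Proof.
move=> mf f0; rewrite cube_bigU ge0_integral_bigsetU//.
- by move=> i; exact: measurable_cell.
- exact: sqr_uniq.
- exact: trivIset_cell.
- exact: measurable_funTS.
Qed.

End cells_cover.

(** * Approximation of Borel sets by unions of cells *)

Section cell_approximation.
Context (R : realType).
Variables (A0 : plane R) (L : R).
Hypothesis L0 : 0 < L.

Definition mesh n : R := L / 2 ^+ n.
(** The shift by L cancels the offset of the box, whose indices start at 2^n = L / [mesh n], so that
    its cells fill exactly S. *)
Definition origin : plane R := (A0.1 - L, A0.2 - L).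
Definition gstep n (s : nat * nat -> R) := stepf origin (mesh n) (box n) s.
Local Notation S := (square A0 L).

Lemma mesh_gt0 n : 0 < mesh n. Proof. by rewrite divr_gt0 ?exprn_gt0. Qed.

Lemma box_cube n : cube origin (mesh n) (2 ^ n, 2 ^ n)%N (2 ^ n) = S.
Proof.
rewrite /cube /corner /origin /mesh /= natrX divfK ?expf_neq0 ?pnatr_eq0//.
by rewrite !subrK; case: (A0).
Qed.

Lemma square_cell n x : S x -> exists2 i, i \in box n & cell origin (mesh n) i x.
Proof. by rewrite -(box_cube n) => /(cube_cell (mesh_gt0 n)). Qed.

Lemma cell_square n i x : i \in box n -> cell origin (mesh n) i x -> S x.
Proof. by rewrite -(box_cube n) => ib; exact: (cell_cube (mesh_gt0 n) ib). Qed.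

Lemma gstep_cell n s i x : i \in box n -> cell origin (mesh n) i x -> gstep n s x = s i.
Proof. by apply: (stepf_cell (mesh_gt0 n)); exact: sqr_uniq. Qed.

Lemma measurable_gstep n s : measurable_fun setT (gstep n s).
Proof. exact: measurable_stepf. Qed.

Lemma mesh_small (eps : R) : 0 < eps -> exists N, forall n, (N <= n)%N -> mesh n <= eps.
Proof.
move=> e0; exists (Num.bound (L / eps)) => n hn.
have h : L / eps < (Num.bound (L / eps))%:R.
  by apply: archi_boundP; rewrite divr_ge0 ?ltW.
rewrite /mesh ler_pdivrMr ?exprn_gt0// mulrC -ler_pdivrMr//.
apply: le_trans (ltW h) _; rewrite -natrX ler_nat.
by apply: leq_trans hn _; apply: ltnW; exact: ltn_expl.
Qed.

(** The union of the selected cells of S, written as a level set of a step function to make it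
    measurable at once. *)
Definition cunion n (s : nat * nat -> bool) : set (plane R) :=
  [set x | gstep n (fun i => (s i)%:R) x = 1].

Lemma measurable_cunion n s : measurable (cunion n s).
Proof.
rewrite (_ : cunion n s = setT `&` gstep n (fun i => (s i)%:R) @^-1` [set 1]).
  by apply: measurable_gstep => //; exact: measurable_set1.
by rewrite setTI.
Qed.

Lemma cunionP n s i x : i \in box n -> cell origin (mesh n) i x -> (cunion n s x <-> s i).
Proof.
move=> ib ix; rewrite /cunion/= (gstep_cell _ ib ix).
by case: (s i); split => // /eqP; rewrite eq_sym oner_eq0.
Qed.

Definition mismatch (E F : set (plane R)) := S `&` ((E `\` F) `|` (F `\` E)).

Lemma measurable_mismatch E F : measurable E -> measurable F -> measurable (mismatch E F).
Proof.
move=> mE mF; apply: measurableI; first exact: measurable_square.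
by apply: measurableU; exact: measurableD.
Qed.

(** Every fine enough mesh has to work, so that two sets can be approximated on a common one. *)
Definition approximable (E : set (plane R)) := measurable E /\
  forall eps : R, 0 < eps -> exists N, forall n, (N <= n)%N ->
  exists s, (area R (mismatch E (cunion n s)) <= eps%:E)%E.

Lemma areaU_le (E F : set (plane R)) (u v : R) : measurable E -> measurable F ->
  (area R E <= u%:E)%E -> (area R F <= v%:E)%E -> (area R (E `|` F) <= (u + v)%:E)%E.
Proof.
move=> mE mF Eu Fv; apply: le_trans (@measureU2 _ _ _ (area R) E F mE mF) _.
by rewrite EFinD; exact: leeD.
Qed.

Lemma approximableC E : approximable E -> approximable (~` E).
Proof.
move=> [mE aE]; split; first exact: measurableC.
move=> eps e0; have [N hN] := aE eps e0; exists N => n /hN[s hs].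
exists (fun i => ~~ s i); apply: le_trans hs.
apply: le_measure; rewrite ?inE; [|by apply: measurable_mismatch => //;
  exact: measurable_cunion|].
  by apply: measurable_mismatch; [exact: measurableC|exact: measurable_cunion].
move=> x [Sx]; have [i ib ix] := square_cell n Sx.
have h1 := cunionP s ib ix; have h2 := cunionP (fun i => ~~ s i) ib ix.
move=> [[a b]|[a b]]; split => //.
- right; split => //; apply/h1; apply: contrapT => si; apply: b; apply/h2.
  by apply/negP.
- left; split; first exact: contrapT.
  by move=> /h1 si; move/h2: a; rewrite si.
Qed.

Lemma approximableI E F : approximable E -> approximable F -> approximable (E `&` F).
Proof.
move=> [mE aE] [mF aF]; split; first exact: measurableI.
move=> eps e0; have e20 : 0 < eps / 2 by rewrite divr_gt0.
have [N1 h1] := aE _ e20; have [N2 h2] := aF _ e20.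
exists (maxn N1 N2) => n; rewrite geq_max => /andP[/h1[s hs] /h2[t ht]].
exists (fun i => s i && t i).
have mm E' u : measurable E' -> measurable (mismatch E' (cunion n u)).
  by move=> mE'; apply: measurable_mismatch => //; exact: measurable_cunion.
apply: (@le_trans _ _ (area R (mismatch E (cunion n s) `|` mismatch F (cunion n t)))).
  apply: le_measure; rewrite ?inE; [by apply: mm; exact: measurableI|
    by apply: measurableU; exact: mm|].
  move=> x [Sx]; have [i ib ix] := square_cell n Sx.
  have hs' := cunionP s ib ix; have ht' := cunionP t ib ix.
  have hst := cunionP (fun i => s i && t i) ib ix.
  move=> [[[a b] c]|[a b]].
    have [xs|xs] := pselect (cunion n s x).
      right; split => //; left; split => // xt; apply: c; apply/hst.
      by apply/andP; split; [apply/hs'|apply/ht'].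
    by left; split => //; left.
  move/hst/andP: a => [/hs' xs /ht' xt].
  have [xE|xE] := pselect (E x).
    by right; split => //; right; split => // xF; exact: b.
  by left; split => //; right.
by rewrite [eps]splitr; apply: areaU_le => //; exact: mm.
Qed.

Lemma approximableU E F : approximable E -> approximable F -> approximable (E `|` F).
Proof.
move=> aE aF; rewrite -[E `|` F]setCK setCU.
by apply: approximableC; apply: approximableI; exact: approximableC.
Qed.

Lemma approximable0 : approximable set0.
Proof.
split => // eps e0; exists 0%N => n _; exists (fun=> false).
rewrite (_ : mismatch _ _ = set0) ?measure0 ?lee_fin ?ltW//.
apply/seteqP; split => x // [Sx [[]//|[+ _]]].
have [i ib ix] := square_cell n Sx.
by move=> /(cunionP (fun=> false) ib ix).
Qed.

(** The part of S missed by the first k sets decreases to the empty set, and S has finite area;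
    hence some finite union misses little area. *)
Lemma approximable_bigcup (E : nat -> set (plane R)) :
  (forall k, approximable (E k)) -> approximable (\bigcup_k E k).
Proof.
move=> aE; have mU : measurable (\bigcup_k E k).
  by apply: bigcupT_measurable => k; case: (aE k).
pose B k := \big[setU/set0]_(j < k) E j.
have aB k : approximable (B k).
  rewrite /B; elim: k => [|k IH]; first by rewrite big_ord0; exact: approximable0.
  by rewrite big_ord_recr/=; exact: approximableU.
have BP k x : B k x <-> exists2 j, (j < k)%N & E j x.
  rewrite /B -bigcup_mkord; split => [[j /= jk Ej]|[j jk Ej]]; by exists j.
split => // eps e0; have e20 : 0 < eps / 2 by rewrite divr_gt0.
pose D k := S `&` (\bigcup_k E k `\` B k).
have mD k : measurable (D k).
  apply: measurableI; first exact: measurable_square.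
  by apply: measurableD => //; case: (aB k).
have D0 : \bigcap_k D k = set0.
  apply/seteqP; split => x // h; have [_ [[j _ Ej] _]] := h 0%N I.
  by have [_ [_ nB]] := h j.+1 I; apply: nB; apply/BP; exists j.
have cvgD : (area R \o D) @ \oo --> area R (\bigcap_k D k).
  apply: nonincreasing_cvg_mu => //.
  - apply: le_lt_trans (area_square_fin A0 (ltW L0)).
    by apply: le_measure; rewrite ?inE//; [exact: measurable_square|exact: subIsetl].
  - by rewrite D0.
  - move=> m n mn; apply/subsetPset => x [Sx [xU nB]]; split => //; split => //.
    by move=> /BP[j jm Ej]; apply: nB; apply/BP; exists j => //; exact: leq_trans mn.
rewrite D0 measure0 in cvgD.
have [k hk] : exists k, (area R (D k) <= (eps / 2)%:E)%E.
  have := cvgD; move=> /fine_cvgP[[k1 _ fin] /cvgrPdist_le/(_ _ e20)[k2 _ hk]].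
  exists (maxn k1 k2); have := hk (maxn k1 k2) (leq_maxr _ _).
  rewrite /= sub0r normrN => h.
  have f : area R (D (maxn k1 k2)) \is a fin_num by apply: fin; rewrite /= leq_maxl.
  by rewrite -(fineK f) lee_fin; apply: le_trans h; exact: ler_norm.
have [_ /(_ _ e20)[N hN]] := aB k.
exists N => n /hN[s hs]; exists s.
apply: (@le_trans _ _ (area R (mismatch (B k) (cunion n s) `|` D k))).
  apply: le_measure; rewrite ?inE.
  - by apply: measurable_mismatch => //; exact: measurable_cunion.
  - apply: measurableU => //; apply: measurable_mismatch; last exact: measurable_cunion.
    by case: (aB k).
  move=> x [Sx [[xU ns]|[xs nU]]].
    have [xB|xB] := pselect (B k x); last by right.
    by left; split => //; left.
  left; split => //; right; split => // /BP[j _ Ej]; apply: nU; by exists j.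
rewrite [eps]splitr; apply: areaU_le => //.
apply: measurable_mismatch; last exact: measurable_cunion.
by case: (aB k).
Qed.

(** The cells lying inside the half-plane are selected. The mismatch sits in cells that meet the
    boundary line, inside a strip of area at most 4 d L. *)
Lemma approximable_halfplane k (u : R) : approximable [set x | crd k x < u].
Proof.
have mh : measurable [set x : plane R | crd k x < u].
  rewrite (_ : [set _ | _] = setT `&` (@crd R k) @^-1` `]-oo, u[).
    by apply: measurable_crd => //; exact: measurable_itv.
  by rewrite setTI; apply/seteqP; split => x /=; rewrite in_itv.
split => // eps e0.
have e1 : 0 < eps / (4 * L) by rewrite divr_gt0// mulr_gt0.
have [N hN] := mesh_small e1; exists N => n /hN hn.
pose d := mesh n; have d0 : 0 < d by exact: mesh_gt0.
pose s i := crd k origin + d * (ncrd k i)%:R + d <= u.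
exists s.
have [mV hV] := area_strip A0 k (u, u) (ltW L0) (ltW (mulr_gt0 (ltr0Sn R 1) d0)).
apply: (@le_trans _ _ (2 * (2 * d) * L)%:E); last first.
  rewrite lee_fin; have : d * (4 * L) <= eps by rewrite -ler_pdivlMr// mulr_gt0.
  lra.
apply: le_trans hV; apply: le_measure; rewrite ?inE//.
  by apply: measurable_mismatch => //; exact: measurable_cunion.
move=> x [Sx]; have [i ib ix] := square_cell n Sx.
have h := cunionP s ib ix; have := crd_cell k ix; rewrite -/d => /andP[x1 x2].
have -> : crd k (u, u) = u by case: (k).
move=> [[/= xu ns]|[/h/= si /= nu]]; split => //.
  have : u < crd k origin + d * (ncrd k i)%:R + d.
    by rewrite ltNge; apply/negP => si; apply: ns; apply/h.
  move=> hu; rewrite ltr_norml; apply/andP; split; lra.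
by exfalso; apply: nu; apply: lt_le_trans x2 _.
Qed.

(** Approximable sets form a sigma-algebra containing the half-planes. So they contain the preimages
    of Borel sets under each coordinate, which generate the product sigma-algebra. *)
Lemma measurable_approximable E : measurable E -> approximable E.
Proof.
have sa : sigma_algebra setT approximable.
  split; first exact: approximable0.
    by move=> A aA; rewrite setTD; exact: approximableC.
  exact: approximable_bigcup.
have ray k (B : set R) : measurable (B : set (measurableTypeR R)) ->
    approximable (@crd R k @^-1` B).
  have sk : sigma_algebra setT (fun B : set R => approximable (@crd R k @^-1` B)).
    split; first by rewrite preimage_set0; exact: approximable0.
      by move=> A aA; rewrite setTD preimage_setC; exact: approximableC.
    by move=> F aF; rewrite preimage_bigcup; exact: approximable_bigcup.
  move=> mB; have : <<s @RGenCInfty.G R >> B.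
    have h := congr1 (fun X : set (set R) => X B) (RGenCInfty.measurableE R).
    exact: (@eq_ind Prop _ (fun X : Prop => X) mB _ h).
  move: B {mB}; apply: smallest_sub => // B [x ->].
  rewrite (_ : _ @^-1` _ = ~` [set y | crd k y < x]).
    exact: approximableC (approximable_halfplane k x).
  apply/seteqP; split => y /=; rewrite in_itv/= andbT leNgt; first by move/negP.
  by move=> h; apply/negP.
move: E; apply: smallest_sub => // E [[B mB <-]|[B mB <-]]; rewrite setTI.
  exact: (ray true).
exact: (ray false).
Qed.

End cell_approximation.

Section bounded_functions.
Context (R : realType).
Implicit Types (f g : plane R -> R) (D : set (plane R)).

Lemma bounded_integrable D f (B : R) : measurable D -> (area R D < +oo)%E ->
  measurable_fun setT f -> (forall x, `|f x| <= B) -> (area R).-integrable D (EFin \o f).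
Proof.
move=> mD Dfin mf fB; apply/integrableP; split.
  by apply/measurable_EFinP; exact: measurable_funTS.
apply: (@le_lt_trans _ _ (\int[area R]_(x in D) (cst B%:E) x)%E).
  by apply: integral_monotone => x _; rewrite /= lee_fin.
rewrite integral_cst//; apply: lte_mul_pinfty => //.
by rewrite lee_fin; apply: le_trans (fB (0, 0)).
Qed.

Lemma measurable_abs_EFin f : measurable_fun setT f ->
  measurable_fun setT (fun x => `|f x|%:E).
Proof. by move=> mf; apply/measurable_EFinP; exact: measurableT_comp. Qed.

Lemma integral_abs_triangle D f g (u v : R) : measurable D ->
  measurable_fun setT f -> measurable_fun setT g ->
  (\int[area R]_(x in D) `|f x|%:E <= u%:E)%E ->
  (\int[area R]_(x in D) `|g x|%:E <= v%:E)%E ->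
  (\int[area R]_(x in D) `|f x + g x|%:E <= (u + v)%:E)%E.
Proof.
move=> mD mf mg fu gv.
apply: (@le_trans _ _ (\int[area R]_(x in D) (`|f x|%:E + `|g x|%:E))%E).
  by apply: integral_monotone => x _; rewrite -EFinD lee_fin; exact: ler_normD.
rewrite ge0_integralD//.
- by rewrite EFinD; exact: leeD.
- by apply: measurable_funTS; exact: measurable_abs_EFin.
- by apply: measurable_funTS; exact: measurable_abs_EFin.
Qed.

End bounded_functions.

(** * Cell averages of bounded functions *)

Section cell_averages.
Context (R : realType).
Variables (A0 : plane R) (L : R).
Hypothesis L0 : 0 < L.
Local Notation S := (square A0 L).
Local Notation mesh := (mesh L).
Local Notation gstep := (gstep A0 L).
Local Notation gcell n := (cell (origin A0 L) (mesh n)).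
Implicit Types (f g : plane R -> R).

Let mS : measurable S. Proof. exact: measurable_square. Qed.

Definition fapprox f := forall eps : R, 0 < eps -> exists N, forall n, (N <= n)%N ->
  exists s, (\int[area R]_(x in S) `|f x - gstep n s x|%:E <= eps%:E)%E.

Lemma fapprox_indic (E : set (plane R)) : measurable E -> fapprox \1_E.
Proof.
move=> mE eps e0; have [_ /(_ _ e0)[N hN]] := measurable_approximable A0 L0 mE.
exists N => n /hN[s hs]; exists (fun i => (s i)%:R).
have mm : measurable (mismatch A0 L E (cunion A0 L n s)).
  by apply: measurable_mismatch => //; exact: measurable_cunion.
apply: le_trans hs.
apply: (@le_trans _ _ (\int[area R]_(x in S) (\1_(mismatch A0 L E (cunion A0 L n s)) x)%:E)%E).
  apply: integral_monotone => x Sx; rewrite lee_fin.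
  have [i ib ix] := square_cell L0 n Sx.
  have h := cunionP L0 s ib ix.
  rewrite (gstep_cell L0 _ ib ix) !indicE.
  have [Ex|Ex] := pselect (E x).
    rewrite (mem_set Ex); case: (boolP (s i)) => si; first by rewrite subrr normr0.
    rewrite mem_set ?subr0 ?normr1//; split => //; left; split => //.
    by move/h; apply/negP.
  rewrite (memNset Ex); case: (boolP (s i)) => si; last by rewrite subrr normr0.
  rewrite mem_set ?sub0r ?normrN ?normr1//; split => //; right; split => //.
  exact/h.
rewrite integral_indic//; apply: le_measure; rewrite ?inE//.
exact: measurableI.
Qed.

Lemma gstepD n s t x : gstep n (fun i => s i + t i) x = gstep n s x + gstep n t x.
Proof. by rewrite /gstep /stepf -big_split/=; apply: eq_bigr => i _; rewrite mulrDl. Qed.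

Lemma gstepZ n (r : R) s x : gstep n (fun i => r * s i) x = r * gstep n s x.
Proof. by rewrite /gstep /stepf mulr_sumr; apply: eq_bigr => i _; rewrite mulrA. Qed.

Lemma fapproxD f g : measurable_fun setT f -> measurable_fun setT g ->
  fapprox f -> fapprox g -> fapprox (fun x => f x + g x).
Proof.
move=> mf mg af ag eps e0; have e20 : 0 < eps / 2 by rewrite divr_gt0.
have [N1 h1] := af _ e20; have [N2 h2] := ag _ e20.
exists (maxn N1 N2) => n; rewrite geq_max => /andP[/h1[s hs] /h2[t ht]].
exists (fun i => s i + t i); rewrite [eps]splitr.
rewrite [leLHS](_ : _ = \int[area R]_(x in S)
    `|(f x - gstep n s x) + (g x - gstep n t x)|%:E)%E; last first.
  by apply: eq_integral => x _; congr (`|_|%:E); rewrite gstepD; ring.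
by apply: integral_abs_triangle => //; apply: measurable_funB => //; exact: measurable_gstep.
Qed.

Lemma fapproxZ (r : R) f : measurable_fun setT f -> fapprox f -> fapprox (fun x => r * f x).
Proof.
move=> mf af eps e0; have r0 : 0 < `|r| + 1 by rewrite ltr_wpDl.
have [N hN] := af _ (divr_gt0 e0 r0).
exists N => n /hN[s hs]; exists (fun i => r * s i).
apply: (@le_trans _ _ (`|r|%:E * (eps / (`|r| + 1))%:E)%E); last first.
  rewrite -EFinM lee_fin mulrCA ler_piMr ?(ltW e0)// ler_pdivrMr// mul1r.
  by rewrite lerDl.
apply: le_trans (lee_wpmul2l _ hs); last by rewrite lee_fin.
rewrite -ge0_integralZl//.
- apply: integral_monotone => x _.
  by rewrite gstepZ -EFinM lee_fin -normrM mulrBr.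
- apply: measurable_funTS; apply: measurable_abs_EFin; apply: measurable_funB => //.
  exact: measurable_gstep.
Qed.

Lemma fapprox_sfun (g : {sfun plane R >-> R}) : fapprox g.
Proof.
have mI (y : R) : measurable (g @^-1` [set y]) by exact: measurable_funPTI.
have H (r : seq R) : fapprox (fun x => \sum_(y <- r) y * \1_(g @^-1` [set y]) x).
  elim: r => [|y r IH].
    move=> eps e0; exists 0%N => n _; exists (fun=> 0).
    rewrite integral0_eq ?lee_fin ?(ltW e0)// => x _.
    rewrite big_nil /gstep /stepf big1 ?subr0 ?normr0// => i _; by rewrite mul0r.
  under eq_fun do rewrite big_cons.
  apply: fapproxD => //.
  - by apply: measurable_funM => //; exact: measurable_indic.
  - by apply: measurable_sum => z; apply: measurable_funM => //; exact: measurable_indic.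
  - by apply: fapproxZ; [exact: measurable_indic|exact: fapprox_indic].
rewrite (_ : (g : _ -> _) = fun x =>
    \sum_(y <- finmap.enum_fset (fset_set (range g))) y * \1_(g @^-1` [set y]) x)//.
by apply/funext => x; rewrite [LHS]fimfunE fsbig_finite.
Qed.

Lemma fapprox_bounded f (B : R) : measurable_fun setT f -> (forall x, `|f x| <= B) ->
  fapprox f.
Proof.
move=> mf fB eps e0; have e20 : 0 < eps / 2 by rewrite divr_gt0.
have If := bounded_integrable mS (area_square_fin A0 (ltW L0)) mf fB.
have [g [Ig _ cg]] := approximation_sfun_integrable mS If.
have [k hk] : exists k, (\int[area R]_(x in S) `|f x - g k x|%:E <= (eps / 2)%:E)%E.
  move: cg => /fine_cvgP[[k1 _ fin] /cvgrPdist_le/(_ _ e20)[k2 _ hk]].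
  exists (maxn k1 k2); have := hk (maxn k1 k2) (leq_maxr _ _).
  have := fin (maxn k1 k2) (leq_maxl _ _); rewrite /= sub0r normrN => h1 h2.
  by rewrite -(fineK h1) lee_fin; apply: le_trans h2; exact: ler_norm.
have [N hN] := fapprox_sfun (g k) e20.
exists N => n /hN[s hs]; exists s; rewrite [eps]splitr.
rewrite [leLHS](_ : _ = \int[area R]_(x in S)
    `|(f x - g k x) + (g k x - gstep n s x)|%:E)%E; last first.
  by apply: eq_integral => x _; congr (`|_|%:E); ring.
by apply: integral_abs_triangle => //; apply: measurable_funB => //; exact: measurable_gstep.
Qed.

Definition avg n f i : R := mesh n ^- 2 * \int[area R]_(x in gcell n i) f x.

Let mesh0 n : 0 < mesh n. Proof. exact: mesh_gt0. Qed.

Lemma area_cell n i : area R (gcell n i) = (mesh n ^+ 2)%:E.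
Proof. by apply: area_square; exact: ltW. Qed.

Lemma cell_integrable n i f (B : R) : measurable_fun setT f -> (forall x, `|f x| <= B) ->
  (area R).-integrable (gcell n i) (EFin \o f).
Proof.
move=> mf fB; apply: bounded_integrable mf fB; first exact: measurable_cell.
by rewrite area_cell ltry.
Qed.

Lemma integral_cell_cst n i (r : R) :
  (\int[area R]_(x in gcell n i) r%:E = (r * mesh n ^+ 2)%:E)%E.
Proof.
rewrite integral_cst; last exact: measurable_cell.
by rewrite [X in (_ * X)%E](_ : _ = (mesh n ^+ 2)%:E)//; exact: area_cell.
Qed.

Lemma Rintegral_cell_cst n i (r : R) :
  \int[area R]_(x in gcell n i) r = r * mesh n ^+ 2.
Proof. by rewrite /Rintegral integral_cell_cst. Qed.

(** The constant m is free: 0 for bounds, the value of a step function in [avg_cvg], the centre of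
    oscillation in [avg_discrete_bmo]. *)
Lemma avg_dev n i f (B m : R) : measurable_fun setT f -> (forall x, `|f x| <= B) ->
  ((mesh n ^+ 2 * `|avg n f i - m|)%:E <= \int[area R]_(x in gcell n i) `|f x - m|%:E)%E.
Proof.
move=> mf fB; have mc : measurable (gcell n i) by exact: measurable_cell.
have mfm : measurable_fun setT (fun x => f x - m) by exact: measurable_funB.
have fBm x : `|f x - m| <= B + `|m|.
  by apply: le_trans (ler_normB _ _) _; rewrite lerD2r.
have mfa : measurable_fun setT (fun x => `|f x - m|) by exact: measurableT_comp.
have fBa x : `| `|f x - m| | <= B + `|m| by rewrite normr_id.
have I2 := cell_integrable n i mfa fBa.
have d0 := mesh0 n.
have E1 : mesh n ^+ 2 * (avg n f i - m) = \int[area R]_(x in gcell n i) (f x - m).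
  rewrite RintegralB//; last 2 first.
  - exact: cell_integrable mf fB.
  - by apply: (@cell_integrable n i (fun=> m) `|m|).
  rewrite Rintegral_cell_cst /avg; field.
  by rewrite gt_eqF.
rewrite -[X in X * _]ger0_norm ?sqr_ge0// -normrM E1.
rewrite -[leRHS](fineK (integrable_fin_num mc I2)) lee_fin.
apply: Rintegral_abs_le => //.
by have := integrable_fin_num mc I2; rewrite fin_numElt => /andP[_].
Qed.

Lemma avg_bounded n i f (B : R) : measurable_fun setT f -> (forall x, `|f x| <= B) ->
  `|avg n f i| <= B.
Proof.
move=> mf fB; have B0 : 0 <= B by apply: le_trans (fB (0, 0)).
have h := @avg_dev n i f B 0 mf fB; rewrite subr0 in h.
have {}h : mesh n ^+ 2 * `|avg n f i| <= mesh n ^+ 2 * B.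
  rewrite -lee_fin; apply: le_trans h _.
  rewrite [(mesh n ^+ 2 * B)]mulrC -(integral_cell_cst n i).
  by apply: integral_monotone => x _; rewrite lee_fin subr0.
by rewrite -(ler_pM2l (exprn_gt0 2 (mesh0 n))).
Qed.

(** Averaging fixes step functions and contracts L^1, so the averages of f are at most twice as far
    from f as any step function on the same mesh. *)
Lemma avg_cvg f (B : R) (eps : R) : measurable_fun setT f -> (forall x, `|f x| <= B) ->
  0 < eps -> exists N, forall n, (N <= n)%N ->
  (\int[area R]_(x in S) `|gstep n (avg n f) x - f x|%:E <= eps%:E)%E.
Proof.
move=> mf fB e0; have e20 : 0 < eps / 2 by rewrite divr_gt0.
have [N hN] := fapprox_bounded mf fB e20.
exists N => n /hN[s hs]; rewrite [eps]splitr.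
have mg t : measurable_fun setT (gstep n t) by exact: measurable_gstep.
rewrite [leLHS](_ : _ = \int[area R]_(x in S)
    `|(gstep n (avg n f) x - gstep n s x) + (gstep n s x - f x)|%:E)%E; last first.
  by apply: eq_integral => x _; congr (`|_|%:E); ring.
apply: integral_abs_triangle => //; [exact: measurable_funB|exact: measurable_funB| |].
  apply: le_trans hs; rewrite -(box_cube A0 L n).
  rewrite !ge0_integral_cells//; last 2 first.
  - by apply: measurable_abs_EFin; exact: measurable_funB.
  - by apply: measurable_abs_EFin; exact: measurable_funB.
  rewrite big_seq [leRHS]big_seq; apply: lee_sum => i ib.
  apply: (@le_trans _ _ (\int[area R]_(x in gcell n i) `|f x - s i|%:E)%E).
    apply: le_trans (avg_dev n i (s i) mf fB).
    rewrite le_eqVlt; apply/orP; left; apply/eqP.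
    rewrite mulrC -(integral_cell_cst n i).
    apply: eq_integral => x /set_mem ix.
    by rewrite !(gstep_cell L0 _ ib ix).
  by apply: integral_monotone => x ix; rewrite (gstep_cell L0 _ ib ix).
apply: le_trans hs; rewrite le_eqVlt; apply/orP; left; apply/eqP.
by apply: eq_integral => x _; rewrite distrC.
Qed.

(** The tangent inequality [young_powR] at a, the modulus of the average, is integrated over the
    cell; the linear term is then bounded below by a times the area. *)
Lemma avg_jensen n i f (B p : R) : 1 < p ->
  measurable_fun setT f -> (forall x, `|f x| <= B) ->
  ((mesh n ^+ 2 * `|avg n f i| `^ p)%:E <=
   \int[area R]_(x in gcell n i) (`|f x| `^ p)%:E)%E.
Proof.
move=> p1 mf fB; have mc : measurable (gcell n i) by exact: measurable_cell.
have p0 : 0 < p by exact: lt_trans p1.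
set a := `|avg n f i|; have a0 : 0 <= a by exact: normr_ge0.
have mfa : measurable_fun setT (fun x => `|f x|) by exact: measurableT_comp.
have mfp : measurable_fun setT (fun x => `|f x| `^ p).
  exact: measurableT_comp (measurable_powR _) mfa.
have I1 : (area R).-integrable (gcell n i) (EFin \o (fun x => `|f x|)).
  by apply: (cell_integrable n i mfa (B := B)) => x; rewrite normr_id.
have I2 : (area R).-integrable (gcell n i) (EFin \o (fun x => `|f x| `^ p)).
  apply: (cell_integrable n i mfp (B := B `^ p)) => x.
  rewrite ger0_norm ?powR_ge0//; apply: ler_powR2r => //; exact: ltW.
rewrite -[leRHS](fineK (integrable_fin_num mc I2)) lee_fin.
change (fine _) with (\int[area R]_(x in gcell n i) (`|f x| `^ p)).
have h1 : mesh n ^+ 2 * a <= \int[area R]_(x in gcell n i) `|f x|.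
  have := @avg_dev n i f B 0 mf fB; rewrite subr0.
  rewrite -lee_fin /Rintegral fineK; last exact: (integrable_fin_num mc I1).
  by move=> h; apply: le_trans h _; apply: integral_monotone => x _; rewrite subr0.
have h2 : p * a `^ (p - 1) * \int[area R]_(x in gcell n i) `|f x| <=
    \int[area R]_(x in gcell n i) (`|f x| `^ p) + (p - 1) * a `^ p * mesh n ^+ 2.
  rewrite -RintegralZl// -(Rintegral_cell_cst n i).
  have Ic : (area R).-integrable (gcell n i) (EFin \o (fun=> (p - 1) * a `^ p)).
    by apply: (@cell_integrable n i _ `|(p - 1) * a `^ p|).
  rewrite -RintegralD//.
  have Is : (area R).-integrable (gcell n i)
      (EFin \o (fun x => `|f x| `^ p + (p - 1) * a `^ p)).
    by rewrite /comp; under eq_fun do rewrite EFinD; exact: integrableD.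
  have Il : (area R).-integrable (gcell n i) (EFin \o (fun x => p * a `^ (p - 1) * `|f x|)).
    by rewrite /comp; under eq_fun do rewrite EFinM; exact: integrableZl.
  apply: Rintegral_monotone => [x _||].
  - by rewrite -mulrA (mulrC (a `^ _)); exact: young_powR.
  - exact: (integrable_fin_num mc Il).
  - exact: (integrable_fin_num mc Is).
have h3 : p * a `^ (p - 1) * (mesh n ^+ 2 * a) <=
    p * a `^ (p - 1) * \int[area R]_(x in gcell n i) `|f x|.
  by rewrite ler_wpM2l// mulr_ge0 ?powR_ge0// ltW.
have e1 : a * a `^ (p - 1) = a `^ p by rewrite mulr_powRB1.
move: h3 h2; rewrite [X in X <= _](_ : _ = p * a `^ p * mesh n ^+ 2); last first.
  by rewrite -e1; ring.
move: (\int[_]_(x in _) (`|f x| `^ p)) (\int[_]_(x in _) `|f x|) => I J; lra.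
Qed.

Lemma avg_jensen_sum n f (B p : R) : 1 < p ->
  measurable_fun setT f -> (forall x, `|f x| <= B) ->
  ((mesh n ^+ 2 * \sum_(i <- box n) `|avg n f i| `^ p)%:E <=
   \int[area R]_(x in S) (`|f x| `^ p)%:E)%E.
Proof.
move=> p1 mf fB; rewrite -(box_cube A0 L n) ge0_integral_cells//; last first.
  apply/measurable_EFinP; apply: (measurableT_comp (measurable_powR _)).
  exact: measurableT_comp.
rewrite mulr_sumr -sumEFin; apply: lee_sum => i _; exact: avg_jensen p1 mf fB.
Qed.

(** Any centre is allowed in place of the mean. Truncation then keeps the constant beta, the new
    centre being the truncated one, whereas returning to means could double it. *)
Definition real_bmo (u : plane R -> R) (beta : R) := measurable_fun setT u /\
  forall a l, 0 < l -> exists m : R,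
    (\int[area R]_(x in square a l) `|u x - m|%:E <= (beta * l ^+ 2)%:E)%E.

(** A discrete square is tiled by cells into a genuine square of the plane, and averaging does not
    increase the deviation from its centre. *)
Lemma avg_discrete_bmo n u (B beta : R) : real_bmo u beta -> (forall x, `|u x| <= B) ->
  discrete_bmo (avg n u) beta.
Proof.
move=> [mu hu] uB c k; have d0 := mesh0 n.
have l0 : 0 < mesh n * (2 ^ k)%:R by rewrite mulr_gt0// ltr0n expn_gt0.
have [m hm] := hu (corner (origin A0 L) (mesh n) c) _ l0; exists m.
rewrite -(ler_pM2l (exprn_gt0 2 d0)) -lee_fin.
apply: (@le_trans _ _ (beta * (mesh n * (2 ^ k)%:R) ^+ 2)%:E); last first.
  rewrite lee_fin exprMn natrX -exprM mulnC exprM (_ : 2 ^+ 2 = 4); last by rewrite expr2; ring.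
  by rewrite le_eqVlt; apply/orP; left; apply/eqP; ring.
apply: le_trans hm; rewrite -/(cube _ _ _ _) ge0_integral_cells//; last first.
  by apply: measurable_abs_EFin; exact: measurable_funB.
rewrite mulr_sumr -sumEFin; apply: lee_sum => i _; exact: avg_dev mu uB.
Qed.

End cell_averages.

(** * The trilinear estimate *)

Section bounded_on_square.
Context (R : realType).
Variables (A0 : plane R) (L : R).
Hypothesis L0 : 0 < L.
Local Notation S := (square A0 L).
Implicit Types (f g : plane R -> R[i]) (q B : R).

Definition bounded_on B f := [/\ cmeasurable f, forall x, normc (f x) <= B &
  forall x, ~ S x -> f x = 0].

(** Interpolation between L^1 and the uniform bound. It turns the L^1 convergence of averages into
    L^2 convergence, where T is continuous. *)
Lemma Lpnorm_small q B f (eps : R) : 1 < q -> bounded_on B f ->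
  (\int[area R]_(x in S) (normc (f x))%:E <= eps%:E)%E ->
  (Lpnorm q f <= ((B `^ (q - 1) * eps) `^ q^-1)%:E)%E.
Proof.
move=> q1 [mf fB f0] h; have q0 : 0 < q by exact: lt_trans q1.
apply/Lpnorm_le_fin => //; first exact: powR_ge0.
have B0 : 0 <= B by apply: le_trans (fB (0, 0)); exact: normc_ge0.
have e0 : 0 <= eps.
  rewrite -lee_fin; apply: le_trans h; apply: integral_ge0 => x _.
  by rewrite lee_fin normc_ge0.
rewrite powR_invK ?gt_eqF ?mulr_ge0 ?powR_ge0//.
apply: (@le_trans _ _ ((B `^ (q - 1))%:E * \int[area R]_(x in S) (normc (f x))%:E)%E);
  last by rewrite EFinM; apply: lee_wpmul2l => //; rewrite lee_fin powR_ge0.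
have mS := measurable_square A0 L.
have mfn : measurable_fun S (fun x => (normc (f x))%:E).
  by apply: measurable_funTS; apply/measurable_EFinP; exact: measurable_normc.
rewrite -ge0_integralZl//; [|by move=> x _; rewrite lee_fin normc_ge0|by rewrite lee_fin powR_ge0].
rewrite [leRHS]integral_mkcond; apply: integral_monotone => x _.
rewrite patchE; case: ifPn => [_|/negP xS].
  rewrite -EFinM lee_fin -(@mulr_powRB1 _ (normc (f x)) q)// ?normc_ge0// mulrC.
  rewrite ler_wpM2r ?normc_ge0//; apply: ler_powR2r => //; last exact: normc_ge0.
  by rewrite subr_ge0 ltW.
rewrite f0 ?normc0 ?powR0 ?gt_eqF//.
by move=> Sx; apply: xS; exact: mem_set.
Qed.

Lemma bounded_on_integral B f : bounded_on B f ->
  (\int[area R]_(x in S) (normc (f x))%:E <= (B * L ^+ 2)%:E)%E.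
Proof.
move=> [mf fB f0].
apply: (@le_trans _ _ (\int[area R]_(x in S) (cst B%:E) x)%E).
  by apply: integral_monotone => x _; rewrite lee_fin.
rewrite integral_cst; last exact: measurable_square.
by rewrite [X in (_ * X)%E](_ : _ = (L ^+ 2)%:E) -?EFinM//; apply: area_square; exact: ltW.
Qed.

Lemma bounded_on_Lp q B f : 1 < q -> bounded_on B f -> Lp q f.
Proof.
move=> q1 bf; have [mf _ _] := bf; split => //.
by apply: le_lt_trans (Lpnorm_small q1 bf (bounded_on_integral bf)) _; rewrite ltry.
Qed.

Lemma bounded_on_L2 B f : bounded_on B f -> (Lpnorm 2 f <= (B * L)%:E)%E.
Proof.
move=> bf; have two1 : 1 < 2 :> R by rewrite ltr1n.
apply: le_trans (Lpnorm_small two1 bf (bounded_on_integral bf)) _.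
have [_ fB _] := bf; have B0 : 0 <= B by apply: le_trans (fB (0, 0)); exact: normc_ge0.
rewrite (_ : 2 - 1 = 1) ?powRr1//; last by lra.
rewrite mulrA -expr2 -exprMn powR12_sqrt ?sqr_ge0// sqrtr_sqr ger0_norm//.
by rewrite mulr_ge0// ltW.
Qed.

Lemma bounded_onM B B' f g : (forall x, normc (g x) <= B') -> cmeasurable g ->
  bounded_on B f -> bounded_on (B' * B) (fun x => g x * f x).
Proof.
move=> gB mg [mf fB f0]; split; first exact: cmeasurableM.
  by move=> x; rewrite normcM; apply: ler_pM; rewrite ?normc_ge0.
by move=> x /f0 ->; rewrite mulr0.
Qed.

Lemma bounded_onB B B' f g : bounded_on B f -> bounded_on B' g ->
  bounded_on (B + B') (fun x => f x - g x).
Proof.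
move=> [mf fB f0] [mg gB g0]; split; first exact: cmeasurableB.
  move=> x; apply: le_trans (le_normcD _ _) _; rewrite normcN; exact: lerD.
by move=> x xS; rewrite f0// g0// subr0.
Qed.

Lemma bounded_on_le B B' f : B <= B' -> bounded_on B f -> bounded_on B' f.
Proof. by move=> BB [mf fB f0]; split=> // x; exact: le_trans (fB x) BB. Qed.

Lemma bounded_on_real B (h : plane R -> R) : measurable_fun setT h ->
  (forall x, `|h x| <= B) -> (forall x, ~ S x -> h x = 0) ->
  bounded_on B (fun x => (h x)%:C).
Proof.
move=> mh hB h0; split; first exact: cmeasurable_real.
  by move=> x; rewrite normc_real.
by move=> x /h0 ->.
Qed.

Lemma bounded_on_gstep n B s : (forall i, `|s i| <= B) ->
  bounded_on B (fun x => (gstep A0 L n s x)%:C).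
Proof.
move=> sB; apply: bounded_on_real; first exact: measurable_gstep.
  move=> x; apply: stepf_le => //; [exact: mesh_gt0|exact: sqr_uniq|].
  by apply: le_trans (sB (0, 0)%N).
move=> x Sx; apply: stepf_out => i ib ix; apply: Sx; exact: cell_square ib ix.
Qed.

Lemma gstepM n s t x : gstep A0 L n (fun i => s i * t i) x = gstep A0 L n s x * gstep A0 L n t x.
Proof.
have [Sx|Sx] := pselect (S x); last first.
  have out s' : gstep A0 L n s' x = 0.
    by apply: stepf_out => i ib ix; apply: Sx; exact: cell_square ib ix.
  by rewrite !out mul0r.
by have [i ib ix] := square_cell L0 n Sx; rewrite !(gstep_cell L0 _ ib ix).
Qed.

End bounded_on_square.

Lemma dist_perturb (R : realType) (x1 x2 y1 y2 W c eta : R) :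
  `|x1 - y1| <= c -> `|x2 - y2| <= c -> 2 * c <= eta -> `|y1 - y2| <= W ->
  `|x1 - x2| <= W + eta.
Proof.
rewrite !ler_norml => /andP[a1 a2] /andP[b1 b2] h /andP[c1 c2].
by apply/andP; split; lra.
Qed.

Section real_trilinear_bound.
Context (R : realType).
Variables (T : (plane R -> R[i]) -> plane R -> R[i]) (K : plane R -> plane R -> R[i]).
Hypothesis Tb : L2_bounded T.
Hypothesis TK : associated T K.
Hypothesis czx : CZX_kernel K.

Implicit Types b f g h : plane R -> R[i].

Definition cform b f g : R[i] := opform T f (fun x => b x * g x) - opform T (fun x => b x * f x) g.

Lemma form_subl f g h : Lp 2 f -> Lp 2 g -> Lp 2 h ->
  opform T (fun x => f x - g x) h = opform T f h - opform T g h.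
Proof.
move=> lf lg lh; have := form_linl Tb (-1) lg lf lh.
by under [X in opform T X _]eq_fun do rewrite mulN1r addrC; rewrite mulN1r addrC.
Qed.

Lemma form_subr f g h : Lp 2 f -> Lp 2 g -> Lp 2 h ->
  opform T h (fun x => f x - g x) = opform T h f - opform T h g.
Proof.
move=> lf lg lh; have := form_linr Tb (-1) lh lg lf.
by under [X in opform T _ X]eq_fun do rewrite mulN1r addrC; rewrite mulN1r addrC.
Qed.

Lemma form_perturb (M a b c d : R) P f f' g g' : 0 <= M ->
  (forall c f g, Lp 2 f -> Lp 2 g ->
    (`|part c (opform T f g)|%:E <= M%:E * Lpnorm 2 f * Lpnorm 2 g)%E) ->
  Lp 2 f -> Lp 2 f' -> Lp 2 g -> Lp 2 g' ->
  (Lpnorm 2 (fun x => (f x - f' x)%R) <= a%:E)%E -> (Lpnorm 2 g <= b%:E)%E ->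
  (Lpnorm 2 f' <= c%:E)%E -> (Lpnorm 2 (fun x => (g x - g' x)%R) <= d%:E)%E ->
  `|part P (opform T f g) - part P (opform T f' g')| <= M * (a * b + c * d).
Proof.
move=> M0 hM lf lf' lg lg' ha hb hc hd.
have lff : Lp 2 (fun x => f x - f' x) by apply: LpB => //; exact: ler1n.
have lgg : Lp 2 (fun x => g x - g' x) by apply: LpB => //; exact: ler1n.
have -> : part P (opform T f g) - part P (opform T f' g') =
    part P (opform T (fun x => f x - f' x) g) + part P (opform T f' (fun x => g x - g' x)).
  by rewrite form_subl// form_subr// !partB; ring.
apply: le_trans (ler_normD _ _) _; rewrite mulrDr; apply: lerD; rewrite -lee_fin.
  apply: le_trans (hM P _ _ lff lg) _; rewrite -muleA !EFinM.
  apply: lee_wpmul2l; first by rewrite lee_fin.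
  by apply: lee_pmul; rewrite ?Lpnorm_ge0.
apply: le_trans (hM P _ _ lf' lgg) _; rewrite -muleA !EFinM.
apply: lee_wpmul2l; first by rewrite lee_fin.
by apply: lee_pmul; rewrite ?Lpnorm_ge0.
Qed.

(** The bound B and the side L only decide how fine the mesh must be; the constant is that of the
    matrices, which is uniform in the mesh. *)
Lemma real_trilinear (p q : R) : 1 < p -> 1 < q -> p^-1 + q^-1 = 1 ->
  exists2 C : R, 0 <= C & forall (A0 : plane R) (L B beta : R) (u f g : plane R -> R) P,
  0 < L -> 0 <= beta -> real_bmo u beta -> (forall x, `|u x| <= B) ->
  bounded_on A0 L B (fun x => (f x)%:C) -> bounded_on A0 L B (fun x => (g x)%:C) ->
  (`|part P (cform (fun x => (u x)%:C) (fun x => (f x)%:C) (fun x => (g x)%:C))|%:E <=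
   (C * beta)%:E * (Lpnorm p (fun x => (f x)%:C) * Lpnorm q (fun x => (g x)%:C)))%E.
Proof.
move=> p1 q1 pq; have [C C0 hC] := form_step_commutator Tb TK czx p1 pq.
exists C => // A0 L B0 beta u f g P L0 beta0 bu uB0 bf0 bg0.
have p0 : 0 < p by exact: lt_trans p1.
have q0 : 0 < q by exact: lt_trans q1.
(* Now B >= 1, so that the square of B also bounds B. *)
pose B := B0 + 1; have BB : B0 <= B by rewrite lerDl.
have B1 : 1 <= B by rewrite lerDr; apply: le_trans (uB0 (0, 0)).
have uB x : `|u x| <= B by exact: le_trans (uB0 x) BB.
have bf := bounded_on_le BB bf0; have bg := bounded_on_le BB bg0.
have [M M0 hM] := form_bound Tb.
have [mu _] := bu.
have mf : measurable_fun setT f by case: bf => -[].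
have mg : measurable_fun setT g by case: bg => -[].
have fB x : `|f x| <= B by rewrite -normc_real; case: bf.
have gB x : `|g x| <= B by rewrite -normc_real; case: bg.
have B0' : 0 < B by exact: lt_le_trans B1.
have NpfE (r : R) (h : plane R -> R) : 1 < r -> bounded_on A0 L B (fun x => (h x)%:C) ->
    measurable_fun setT h -> (forall x, `|h x| <= B) -> forall n,
    (((mesh L n ^+ 2 * \sum_(i <- box n) `|avg A0 L n h i| `^ r) `^ r^-1)%:E <=
    Lpnorm r (fun x => (h x)%:C))%E.
  move=> r1 [_ _ h0] mh hB n; have r0 : 0 < r by exact: lt_trans r1.
  rewrite LpnormE// -poweR_EFin; apply: ler_poweR2r; first by rewrite invr_ge0 ltW.
    rewrite lee_fin mulr_ge0 ?sqr_ge0// sumr_ge0// => i _; exact: powR_ge0.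
  apply: le_trans (avg_jensen_sum A0 L0 n r1 mh hB) _.
  rewrite integral_mkcond; apply: integral_monotone => x _; rewrite patchE.
  by case: ifP => _; rewrite lee_fin ?powR_ge0// normc_real.
apply/lee_addgt0Pr => eta eta0.
(* The two forms move by at most 4 M B^2 L D <= eta together when each function is within D in L^2.
   The choice of eps below gives this: a function bounded by 2 B^2 with L^1 norm at most 2 B eps has
   squared L^2 norm at most 4 B^3 eps = D^2. *)
pose D := eta / (4 * M * B ^+ 2 * L + 1).
have den0 : 0 < 4 * M * B ^+ 2 * L + 1.
  by rewrite ltr_wpDl// mulr_ge0 ?(ltW L0)// mulr_ge0 ?sqr_ge0// mulr_ge0.
have D0 : 0 < D by rewrite divr_gt0.
pose eps := D ^+ 2 / (4 * B ^+ 3).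
have e0 : 0 < eps by rewrite divr_gt0 ?exprn_gt0// mulr_gt0 ?exprn_gt0.
have [N1 hu] := avg_cvg A0 L0 mu uB e0.
have [N2 hf] := avg_cvg A0 L0 mf fB e0.
have [N3 hg] := avg_cvg A0 L0 mg gB e0.
pose n := maxn N1 (maxn N2 N3).
have {}hu := hu n (leq_maxl _ _).
have {}hf := hf n (leq_trans (leq_maxl _ _) (leq_maxr _ _)).
have {}hg := hg n (leq_trans (leq_maxr _ _) (leq_maxr _ _)).
set un := avg A0 L n u in hu; set fn := avg A0 L n f in hf; set gn := avg A0 L n g in hg.
have unB i : `|un i| <= B by exact: avg_bounded mu uB.
have fnB i : `|fn i| <= B by exact: avg_bounded mf fB.
have gnB i : `|gn i| <= B by exact: avg_bounded mg gB.
pose st s (x : plane R) : R[i] := (gstep A0 L n s x)%:C.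
have bst s : (forall i, `|s i| <= B) -> bounded_on A0 L B (st s) by exact: bounded_on_gstep.
have L2small h : bounded_on A0 L (2 * B ^+ 2) h ->
    (\int[area R]_(x in square A0 L) (normc (h x))%:E <= (2 * B * eps)%:E)%E ->
    (Lpnorm 2 h <= D%:E)%E.
  move=> bh ih; have two1 : 1 < 2 :> R by rewrite ltr1n.
  apply: le_trans (Lpnorm_small two1 bh ih) _.
  rewrite (_ : 2 - 1 = 1) ?powRr1; [|by rewrite mulr_ge0 ?sqr_ge0|by lra].
  have -> : 2 * B ^+ 2 * (2 * B * eps) = D ^+ 2.
    by rewrite /eps; field; rewrite gt_eqF.
  by rewrite powR12_sqrt ?sqr_ge0// sqrtr_sqr ger0_norm// ltW.
have BB2 : B <= B ^+ 2 by rewrite expr2 ler_peMr// ltW.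
have diff1 (h : plane R -> R) s : bounded_on A0 L B (fun x => (h x)%:C) ->
    (forall i, `|s i| <= B) ->
    (\int[area R]_(x in square A0 L) `|gstep A0 L n s x - h x|%:E <= eps%:E)%E ->
    (Lpnorm 2 (fun x => ((h x)%:C - st s x)%R) <= D%:E)%E.
  move=> bh sB ih; apply: L2small.
    by apply: bounded_on_le (bounded_onB bh (bst s sB)); lra.
  apply: (@le_trans _ _ eps%:E); last first.
    by rewrite lee_fin ler_peMl ?(ltW e0)//; lra.
  apply: le_trans ih; apply: integral_monotone => x _.
  by rewrite lee_fin /st -rmorphB normc_real distrC.
have bum h : bounded_on A0 L B h -> bounded_on A0 L (B * B) (fun x => (u x)%:C * h x).
  move=> bh; apply: (bounded_onM (f := h) (g := fun x => (u x)%:C)) => //.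
  by move=> x; rewrite normc_real.
have diff2 (h : plane R -> R) s : bounded_on A0 L B (fun x => (h x)%:C) ->
    (forall x, `|h x| <= B) -> measurable_fun setT h ->
    (forall i, `|s i| <= B) ->
    (\int[area R]_(x in square A0 L) `|gstep A0 L n s x - h x|%:E <= eps%:E)%E ->
    (Lpnorm 2 (fun x => ((u x)%:C * (h x)%:C - st (fun i => un i * s i)%R x)%R) <= D%:E)%E.
  move=> bh hB mh sB ih; apply: L2small.
    apply: (@bounded_on_le _ _ _ (B * B + B * B)); first by rewrite expr2; lra.
    apply: bounded_onB.
      exact: bum.
    apply: bounded_on_gstep => // i; rewrite normrM; exact: ler_pM.
  apply: (@le_trans _ _ (\int[area R]_(x in square A0 L)
     (B%:E * `|gstep A0 L n s x - h x|%:E + B%:E * `|gstep A0 L n un x - u x|%:E))%E).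
    apply: integral_monotone => x _; rewrite -!EFinM -EFinD lee_fin.
    rewrite /st gstepM// -rmorphM -rmorphB normc_real.
    set a := gstep A0 L n s x; set b := gstep A0 L n un x.
    have aB : `|a| <= B by have [_ + _] := bst s sB; move=> /(_ x); rewrite normc_real.
    have -> : u x * h x - b * a = u x * (h x - a) + a * (u x - b) by ring.
    apply: le_trans (ler_normD _ _) _; rewrite !normrM (distrC a) (distrC b).
    by apply: lerD; apply: ler_wpM2r.
  have mS := measurable_square A0 L.
  have mgs t : measurable_fun setT (gstep A0 L n t) by exact: measurable_gstep.
  have ma (h1 : plane R -> R) t : measurable_fun setT h1 ->
      measurable_fun (square A0 L) (fun x => `|gstep A0 L n t x - h1 x|%:E).
    move=> mh1; apply: measurable_funTS; apply: measurable_abs_EFin.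
    by apply: measurable_funB => //; exact: mgs.
  have B0l : (0 <= B%:E)%E by rewrite lee_fin ltW.
  rewrite ge0_integralD//; last 4 first.
  - by move=> x _; rewrite mule_ge0.
  - by apply: measurable_funeM; exact: ma.
  - by move=> x _; rewrite mule_ge0.
  - by apply: measurable_funeM; exact: ma.
  rewrite !ge0_integralZl//; [|exact: ma|exact: ma].
  rewrite (_ : 2 * B * eps = B * eps + B * eps); last by ring.
  by rewrite (EFinD (B * eps)) !(EFinM B eps); apply: leeD; apply: lee_wpmul2l.
have two1 : 1 < 2 :> R by rewrite ltr1n.
have lst s : (forall i, `|s i| <= B) -> Lp 2 (st s).
  by move=> sB; exact: (bounded_on_Lp L0 two1 (bst s sB)).
have bst2 s : (forall i, `|s i| <= B) -> bounded_on A0 L (B * B) (st (fun i => un i * s i)).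
  by move=> sB; apply: bounded_on_gstep => // i; rewrite normrM; exact: ler_pM.
have lf := bounded_on_Lp L0 two1 bf; have lg := bounded_on_Lp L0 two1 bg.
have luf := bounded_on_Lp L0 two1 (bum _ bf); have lug := bounded_on_Lp L0 two1 (bum _ bg).
have lst2 s : (forall i, `|s i| <= B) -> Lp 2 (st (fun i => un i * s i)).
  by move=> sB; exact: (bounded_on_Lp L0 two1 (bst2 s sB)).
have E1 := form_perturb P M0 hM lf (lst _ fnB) lug (lst2 _ gnB) (diff1 _ _ bf fnB hf)
  (bounded_on_L2 L0 (bum _ bg)) (bounded_on_L2 L0 (bst _ fnB)) (diff2 _ _ bg gB mg gnB hg).
have E2 := form_perturb P M0 hM luf (lst2 _ fnB) lg (lst _ gnB) (diff2 _ _ bf fB mf fnB hf)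
  (bounded_on_L2 L0 bg) (bounded_on_L2 L0 (bst2 _ fnB)) (diff1 _ _ bg gnB hg).
have H := hC (origin A0 L) (mesh L n) (mesh_gt0 L0 n) P n un beta fn gn beta0
  (avg_discrete_bmo A0 L0 n bu uB).
rewrite partB in H.
rewrite /cform partB.
have key : `|part P (opform T (fun x => (f x)%:C) (fun x => (u x)%:C * (g x)%:C)) -
   part P (opform T (fun x => (u x)%:C * (f x)%:C) (fun x => (g x)%:C))| <=
   C * beta * ((mesh L n ^+ 2 * \sum_(i <- box n) `|fn i| `^ p) `^ p^-1 *
              (mesh L n ^+ 2 * \sum_(i <- box n) `|gn i| `^ q) `^ q^-1) + eta.
  have small : 4 * M * B ^+ 2 * L * D <= eta.
    rewrite /D mulrCA ler_piMr ?(ltW eta0)// ler_pdivrMr// mul1r lerDl//.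
  have e1 : M * (D * (B * B * L) + B * L * D) <= 2 * M * B ^+ 2 * L * D.
    rewrite [leRHS](_ : _ = M * (D * (B * B * L) + B ^+ 2 * L * D)); last by ring.
    by rewrite ler_wpM2l// lerD2l ler_wpM2r ?(ltW D0)// ler_wpM2r ?(ltW L0).
  have e2 : M * (D * (B * L) + B * B * L * D) <= 2 * M * B ^+ 2 * L * D.
    rewrite [leRHS](_ : _ = M * (D * (B ^+ 2 * L) + B * B * L * D)); last by ring.
    by rewrite ler_wpM2l// lerD2r ler_wpM2l ?(ltW D0)// ler_wpM2r ?(ltW L0).
  apply: dist_perturb (le_trans E1 e1) (le_trans E2 e2) _ H.
  by apply: le_trans small; rewrite le_eqVlt; apply/orP; left; apply/eqP; ring.
apply: (@le_trans _ _ (C * beta * ((mesh L n ^+ 2 * \sum_(i <- box n) `|fn i| `^ p) `^ p^-1 *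
              (mesh L n ^+ 2 * \sum_(i <- box n) `|gn i| `^ q) `^ q^-1) + eta)%:E).
  by rewrite lee_fin.
rewrite EFinD leeD2r// EFinM; apply: lee_wpmul2l; first by rewrite lee_fin mulr_ge0.
rewrite EFinM; apply: lee_pmul; rewrite ?lee_fin ?powR_ge0//.
- exact: NpfE.
- exact: NpfE.
Qed.

End real_trilinear_bound.

(** * Truncation of real functions *)

Section clamping.
Context (R : realType).

Definition clamp (k t : R) : R := Num.max (- k) (Num.min k t).

Lemma clamp_cases k t : 0 <= k ->
  [\/ clamp k t = k /\ k <= t, clamp k t = - k /\ t <= - k | clamp k t = t /\ - k <= t <= k].
Proof.
move=> k0; have kk : - k <= k by lra.
rewrite /clamp; have [kt|tk] := leP k t.
  by rewrite (max_r kk); constructor 1.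
have [h|h] := leP (- k) t; first by constructor 3; rewrite (ltW tk).
by constructor 2; rewrite (ltW h).
Qed.

Lemma clamp_lip k s t : 0 <= k -> `|clamp k s - clamp k t| <= `|s - t|.
Proof.
move=> k0; have h1 := ler_norm (s - t).
have h2 : t - s <= `|s - t| by rewrite distrC; exact: ler_norm.
rewrite ler_norml; apply/andP.
by case: (clamp_cases s k0) => -[-> h]; case: (clamp_cases t k0) => -[-> h']; split; lra.
Qed.

Lemma clamp_le (k t : R) : 0 <= k -> `|clamp k t| <= k.
Proof.
move=> k0; rewrite ler_norml; apply/andP.
by case: (clamp_cases t k0) => -[-> h]; split; lra.
Qed.

Lemma clamp_id (k t : R) : `|t| <= k -> clamp k t = t.
Proof.
move=> h; have k0 : 0 <= k by exact: le_trans h.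
by move: h; rewrite ler_norml; case: (clamp_cases t k0) => -[-> h]; lra.
Qed.

Lemma measurable_clamp d (X : measurableType d) k (u : X -> R) :
  measurable_fun setT u -> measurable_fun setT (fun x => clamp k (u x)).
Proof. by move=> mu; apply: measurable_maxr => //; exact: measurable_minr. Qed.

Lemma real_bmo_clamp k (u : plane R -> R) beta : 0 <= k -> real_bmo u beta ->
  real_bmo (fun x => clamp k (u x)) beta.
Proof.
move=> k0 [mu hu]; split; first exact: measurable_clamp.
move=> a l l0; have [m hm] := hu a l l0; exists (clamp k m); apply: le_trans hm.
apply: integral_monotone => x _; rewrite lee_fin; exact: clamp_lip.
Qed.

End clamping.

Section complex_trilinear_bound.
Context (R : realType).
Variables (T : (plane R -> R[i]) -> plane R -> R[i]) (K : plane R -> plane R -> R[i]).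
Hypothesis Tb : L2_bounded T.
Hypothesis TK : associated T K.
Hypothesis czx : CZX_kernel K.
Implicit Types b f g h : plane R -> R[i].
Local Notation cform := (cform T).

Definition iunit : R[i] := 0 +i* 1.

Lemma cpartE (z : R[i]) : z = iunit * (part false z)%:C + (part true z)%:C.
Proof. by case: z => x y; apply/eqP; rewrite eq_complex /= /part; apply/andP; split; apply/eqP => /=; ring. Qed.

Lemma normc_iunit : normc iunit = 1.
Proof. by rewrite /iunit /= expr0n add0r expr1n sqrtr1. Qed.

Lemma cform_linf (z : R[i]) b f f' g : Lp 2 f -> Lp 2 f' -> Lp 2 g ->
  Lp 2 (fun x => b x * f x) -> Lp 2 (fun x => b x * f' x) -> Lp 2 (fun x => b x * g x) ->
  cform b (fun x => z * f x + f' x) g = z * cform b f g + cform b f' g.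
Proof.
move=> lf lf' lg lbf lbf' lbg; rewrite /cform.
rewrite (form_linl Tb z lf lf' lbg).
have -> : (fun x => b x * (z * f x + f' x)) = (fun x => z * (b x * f x) + b x * f' x).
  by apply/funext => x; ring.
by rewrite (form_linl Tb z lbf lbf' lg); ring.
Qed.

Lemma cform_ling (z : R[i]) b f g g' : Lp 2 f -> Lp 2 g -> Lp 2 g' ->
  Lp 2 (fun x => b x * f x) -> Lp 2 (fun x => b x * g x) -> Lp 2 (fun x => b x * g' x) ->
  cform b f (fun x => z * g x + g' x) = z * cform b f g + cform b f g'.
Proof.
move=> lf lg lg' lbf lbg lbg'; rewrite /cform.
rewrite (form_linr Tb z lbf lg lg').
have -> : (fun x => b x * (z * g x + g' x)) = (fun x => z * (b x * g x) + b x * g' x).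
  by apply/funext => x; ring.
by rewrite (form_linr Tb z lf lbg lbg'); ring.
Qed.

Lemma cform_linb (z : R[i]) b b' f g : Lp 2 f -> Lp 2 g ->
  Lp 2 (fun x => b x * f x) -> Lp 2 (fun x => b' x * f x) ->
  Lp 2 (fun x => b x * g x) -> Lp 2 (fun x => b' x * g x) ->
  cform (fun x => z * b x + b' x) f g = z * cform b f g + cform b' f g.
Proof.
move=> lf lg lbf lbf' lbg lbg'; rewrite /cform.
have E h : (fun x => (z * b x + b' x) * h x) = (fun x => z * (b x * h x) + b' x * h x).
  by apply/funext => x; ring.
by rewrite !E (form_linr Tb z lf lbg lbg') (form_linl Tb z lbf lbf' lg); ring.
Qed.

Lemma normc_split (X Y Z : R[i]) (r : R) (N : \bar R) : 0 <= r -> (0 <= N)%E ->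
  Z = iunit * X + Y -> ((normc X)%:E <= r%:E * N)%E -> ((normc Y)%:E <= r%:E * N)%E ->
  ((normc Z)%:E <= (2 * r)%:E * N)%E.
Proof.
move=> r0 N0 -> hX hY.
apply: (@le_trans _ _ (normc X + normc Y)%:E).
  by rewrite lee_fin; apply: le_trans (le_normcD _ _) _; rewrite normcM normc_iunit mul1r.
rewrite (_ : 2 * r = r + r); last by ring.
by rewrite !EFinD ge0_muleDl ?lee_fin//; exact: leeD.
Qed.

Lemma bounded_on_part A0 L B f c : bounded_on A0 L B f ->
  bounded_on A0 L B (fun x => (part c (f x))%:C).
Proof.
move=> [mf fB f0]; apply: bounded_on_real; first exact: cmeasurable_part.
  by move=> x; apply: le_trans (part_normc _ _) (fB x).
by move=> x /f0 ->; rewrite /part; case: c.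
Qed.

Lemma Lpnorm_part (p : R) f c : 0 < p ->
  (Lpnorm p (fun x => (part c (f x))%:C) <= Lpnorm p f)%E.
Proof. by move=> p0; apply: Lpnorm_le => // x; rewrite normc_real; exact: part_normc. Qed.

(** The constant doubles four times, for the real and imaginary parts of the value, of g, of f and
    of b. Only values of b where f or g is nonzero matter; there |b| <= B, so b may be replaced by
    its truncated parts, which are bounded everywhere. *)
Lemma complex_trilinear (p q : R) : 1 < p -> 1 < q -> p^-1 + q^-1 = 1 ->
  exists2 C : R, 0 <= C & forall (A0 : plane R) (L B beta : R) b f g,
  0 < L -> 0 <= beta -> (forall c, real_bmo (fun x => part c (b x)) beta) ->
  bounded_on A0 L B f -> bounded_on A0 L B g ->
  (forall x, f x != 0 -> normc (b x) <= B) -> (forall x, g x != 0 -> normc (b x) <= B) ->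
  ((normc (cform b f g))%:E <= (C * beta)%:E * (Lpnorm p f * Lpnorm q g))%E.
Proof.
move=> p1 q1 pq; have [C C0 hC] := real_trilinear Tb TK czx p1 q1 pq.
exists (2 * (2 * (2 * (2 * C)))); first by rewrite !mulr_ge0.
move=> A0 L B beta b f g L0 beta0 hb bf bg bfB bgB.
have p0 : 0 < p by exact: lt_trans p1.
have q0 : 0 < q by exact: lt_trans q1.
have two1 : 1 < 2 :> R by rewrite ltr1n.
have B0 : 0 <= B by have [_ + _] := bf; move=> /(_ (0, 0)); apply: le_trans; exact: normc_ge0.
pose u c x := clamp B (part c (b x)).
have uB c x : `|u c x| <= B by exact: clamp_le.
have bu c : real_bmo (u c) beta by exact: real_bmo_clamp.
pose cu c (x : plane R) := (u c x)%:C.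
have mcu c : cmeasurable (cu c) by apply: cmeasurable_real; case: (bu c).
have cuB c x : normc (cu c x) <= B by rewrite normc_real.
have bmul c h : bounded_on A0 L B h -> bounded_on A0 L (B * B) (fun x => cu c x * h x).
  by move=> bh; apply: (bounded_onM (f := h) (g := cu c)).
have l2 D h : bounded_on A0 L D h -> Lp 2 h by exact: bounded_on_Lp.
have l2m c h : bounded_on A0 L B h -> Lp 2 (fun x => cu c x * h x).
  by move=> bh; apply: l2; exact: bmul.
set N := (Lpnorm p f * Lpnorm q g)%E.
have N0 : (0 <= N)%E by rewrite mule_ge0// Lpnorm_ge0.
have Cb0 : 0 <= C * beta by exact: mulr_ge0.
pose pc (h : plane R -> R[i]) c x := (part c (h x))%:C.
have bp h c : bounded_on A0 L B h -> bounded_on A0 L B (pc h c) by exact: bounded_on_part.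
have pE (h : plane R -> R[i]) : h = (fun x => iunit * pc h false x + pc h true x).
  by apply/funext => x; rewrite /pc -cpartE.
have s1 c1 c2 c3 : ((normc (cform (cu c1) (pc f c2) (pc g c3)))%:E <=
    (2 * (C * beta))%:E * N)%E.
  apply: (@le_trans _ _ (`|part true (cform (cu c1) (pc f c2) (pc g c3))| +
     `|part false (cform (cu c1) (pc f c2) (pc g c3))|)%:E).
    by rewrite lee_fin; exact: normc_parts.
  rewrite (_ : 2 * (C * beta) = C * beta + C * beta); last by ring.
  rewrite !EFinD ge0_muleDl ?lee_fin//.
  have h P := hC A0 L B beta (u c1) (fun x => part c2 (f x)) (fun x => part c3 (g x)) P
    L0 beta0 (bu c1) (uB c1) (bp _ _ bf) (bp _ _ bg).
  have hN : ((C * beta)%:E * (Lpnorm p (pc f c2) * Lpnorm q (pc g c3)) <=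
      (C * beta)%:E * N)%E.
    apply: lee_wpmul2l; first by rewrite lee_fin.
    by apply: lee_pmul; rewrite ?Lpnorm_ge0//; exact: Lpnorm_part.
  by apply: leeD; apply: le_trans (h _) hN.
have s2 c1 c2 : ((normc (cform (cu c1) (pc f c2) g))%:E <= (2 * (2 * (C * beta)))%:E * N)%E.
  apply: (normc_split _ N0 _ (s1 c1 c2 false) (s1 c1 c2 true)); first by rewrite mulr_ge0.
  by rewrite {1}(pE g); apply: cform_ling; first [apply: l2m|apply: (l2 B)]; apply: bp.
have s3 c1 : ((normc (cform (cu c1) f g))%:E <= (2 * (2 * (2 * (C * beta))))%:E * N)%E.
  apply: (normc_split _ N0 _ (s2 c1 false) (s2 c1 true)); first by rewrite !mulr_ge0.
  by rewrite {1}(pE f); apply: cform_linf; first [apply: l2m|apply: (l2 B)]; first [exact: bg|apply: bp].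
have onB h : (forall x, h x != 0 -> normc (b x) <= B) ->
    (fun x => b x * h x) = (fun x => (iunit * cu false x + cu true x) * h x).
  move=> hB; apply/funext => x; have [->|hx] := eqVneq (h x) 0; first by rewrite !mulr0.
  congr (_ * _); rewrite {1}(cpartE (b x)) /cu /u !clamp_id//;
    by apply: le_trans (part_normc _ _) (hB x hx).
have -> : cform b f g = cform (fun x => iunit * cu false x + cu true x) f g.
  by rewrite /cform (onB f bfB) (onB g bgB).
rewrite (_ : _ * beta = 2 * (2 * (2 * (2 * (C * beta))))); last by ring.
apply: (normc_split _ N0 _ (s3 false) (s3 true)); first by rewrite !mulr_ge0.
by apply: cform_linb; first [exact: l2m|exact: (l2 B)].
Qed.

End complex_trilinear_bound.

(** * Duality and extension *)

Section limits_of_norms.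
Context (R : realType).
Implicit Types (f g h : plane R -> R[i]) (q : R).

Lemma measurable_normc_powR q h : cmeasurable h ->
  measurable_fun setT (fun x => ((normc (h x)) `^ q)%:E).
Proof.
move=> mh; apply/measurable_EFinP; apply: (measurableT_comp (measurable_powR _)).
exact: measurable_normc.
Qed.

Lemma limn_einf_le (u : nat -> \bar R) (c : \bar R) : (forall n, (u n <= c)%E) ->
  (limn_einf u <= c)%E.
Proof.
move=> uc; rewrite limn_einf_lim; apply: lime_le; first exact: is_cvg_einfs.
apply: nearW => n; apply: le_trans (uc n).
by apply: ereal_inf_lbound; exists n => //=.
Qed.

Lemma limn_einf_ge0 (u : nat -> \bar R) : (forall n, (0 <= u n)%E) -> (0 <= limn_einf u)%E.
Proof.
move=> u0; rewrite limn_einf_lim; apply: lime_ge; first exact: is_cvg_einfs.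
by apply: nearW => n; apply: le_ereal_inf_tmp => _ [k _ <-].
Qed.

Lemma Lpnorm_fatou q (F : nat -> plane R -> R[i]) h (c : R) : 0 < q -> 0 <= c ->
  (forall n, cmeasurable (F n)) ->
  (forall x, (fun n => normc (F n x)) @ \oo --> normc (h x)) ->
  (forall n, (Lpnorm q (F n) <= c%:E)%E) -> (Lpnorm q h <= c%:E)%E.
Proof.
move=> q0 c0 mF Fh Fc; apply/Lpnorm_le_fin => //.
have nn n x : (0 <= ((normc (F n x)) `^ q)%:E)%E by rewrite lee_fin powR_ge0.
have fat := @fatou _ _ _ (area R) setT measurableT (fun n x => ((normc (F n x)) `^ q)%:E)
  (fun n => measurable_normc_powR q (mF n)) (fun n x _ => nn n x).
apply: (@le_trans _ _ (\int[area R]_x limn_einf (fun n => ((normc (F n x)) `^ q)%:E))%E).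
  apply: integral_monotone => x _; have := normc_ge0 (h x).
  rewrite le_eqVlt => /predU1P[<-|hx].
    by rewrite powR0 ?gt_eqF//; apply: limn_einf_ge0 => n; exact: nn.
  rewrite (cvg_limn_einf_sup (l := ((normc (h x)) `^ q)%:E) _).1//.
  apply: cvg_EFin; first exact: nearW.
  apply: (@continuous_cvg _ _ _ _ _ (fun n => normc (F n x)) (fun t : R => t `^ q)); last exact: Fh.
  apply: differentiable_continuous; apply/derivable1_diffP.
  by apply: derivable_powR; rewrite in_itv/= andbT.
apply: le_trans fat _; apply: limn_einf_le => n.
by apply/Lpnorm_le_fin.
Qed.

Definition cutoff (G : set (plane R)) h (x : plane R) : R[i] := (\1_G x)%:C * h x.

Lemma cut_in G h x : G x -> cutoff G h x = h x.
Proof. by move=> Gx; rewrite /cutoff indicE mem_set// mul1r. Qed.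

Lemma cut_out G h x : ~ G x -> cutoff G h x = 0.
Proof. by move=> Gx; rewrite /cutoff indicE memNset// mul0r. Qed.

Lemma cmeasurable_cut G h : measurable G -> cmeasurable h -> cmeasurable (cutoff G h).
Proof.
move=> mG mh; apply: cmeasurableM => //; apply: cmeasurable_real.
exact: measurable_indic.
Qed.

Lemma normc_cut G h x : normc (cutoff G h x) <= normc (h x).
Proof.
have [Gx|Gx] := pselect (G x); first by rewrite cut_in.
by rewrite cut_out// normc0 normc_ge0.
Qed.

Lemma Lp_cut q G h : 0 < q -> measurable G -> Lp q h -> Lp q (cutoff G h).
Proof.
move=> q0 mG lh; apply: Lp_le (lh) => //; first by apply: cmeasurable_cut => //; case: lh.
exact: normc_cut.
Qed.

Lemma cut_cvg q (G : nat -> set (plane R)) h (eps : R) : 0 < q -> 0 < eps ->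
  (forall n, measurable (G n)) ->
  (forall x, exists N, forall n, (N <= n)%N -> G n x) -> Lp q h ->
  exists N, forall n, (N <= n)%N ->
    (Lpnorm q (fun x => (h x - cutoff (G n) h x)%R) <= eps%:E)%E.
Proof.
move=> q0 e0 mG Gx [mh fh].
pose fn n x := ((normc (h x - cutoff (G n) h x)) `^ q)%:E.
have mhc n : cmeasurable (fun x => h x - cutoff (G n) h x).
  by apply: cmeasurableB => //; exact: cmeasurable_cut.
have Ih : (Npow q h < +oo)%E by rewrite -powR_Lpnorm//; exact: poweR_lty.
have cvg0 : (\int[area R]_x fn n x @[n --> \oo] --> \int[area R]_x (cst 0 x : \bar R))%E.
  apply: (@dominated_cvg _ _ _ (area R) setT measurableT fn (cst 0%E)
    (fun x => ((normc (h x)) `^ q)%:E)).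
  - by move=> n; exact: measurable_normc_powR.
  - move=> x _; apply: cvg_near_cst; have [N hN] := Gx x; exists N => // n /= nN.
    by rewrite /fn cut_in ?subrr ?normc0 ?powR0 ?gt_eqF//; exact: hN.
  - by [].
  - apply/integrableP; split; first exact: measurable_normc_powR.
    apply: le_lt_trans Ih; apply: integral_monotone => x _.
    by rewrite gee0_abs// lee_fin powR_ge0.
  - move=> n x _; rewrite gee0_abs ?lee_fin ?powR_ge0//.
    apply: ler_powR2r; [exact: ltW|exact: normc_ge0|].
    have [Gnx|Gnx] := pselect (G n x); first by rewrite cut_in// subrr normc0 normc_ge0.
    by rewrite cut_out// subr0.
have eq0 : 0 < eps `^ q by exact: powR_gt0.
rewrite integral0 in cvg0.
move: cvg0 => /fine_cvgP[[N1 _ fin] /cvgrPdist_le/(_ _ eq0)[N2 _ hN]].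
exists (maxn N1 N2) => n; rewrite geq_max => /andP[n1 n2].
apply/Lpnorm_le_fin => //; first exact: ltW.
have := hN n n2; have := fin n n1; rewrite /= sub0r normrN => h1 h2.
rewrite /Npow -(fineK h1) lee_fin; apply: le_trans h2; exact: ler_norm.
Qed.

Definition bigsq n : set (plane R) :=
  square (- (n.+1%:R : R), - (n.+1%:R : R)) (2 * n.+1%:R).

(** Bounded sets on which b and h are bounded; each point of the plane belongs to all but finitely
    many. Used with h = f to approximate the input and with h the commutator to test the output. *)
Definition cutset (b h : plane R -> R[i]) n : set (plane R) := bigsq n `&`
  ([set x | normc (b x) <= n.+1%:R] `&` [set x | normc (h x) <= n.+1%:R]).

Lemma measurable_cutset b h n : cmeasurable b -> cmeasurable h -> measurable (cutset b h n).
Proof.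
move=> mb mh; have m f : cmeasurable f -> measurable [set x | normc (f x) <= n.+1%:R].
  move=> mf; rewrite (_ : [set _ | _] = setT `&` (fun x => normc (f x)) @^-1` `]-oo, n.+1%:R]).
    by apply: (measurable_normc mf) => //; exact: measurable_itv.
  by rewrite setTI; apply/seteqP; split => x /=; rewrite in_itv.
by apply: measurableI; [exact: measurable_square|apply: measurableI; exact: m].
Qed.

Lemma cutset_ev b h x : exists N, forall n, (N <= n)%N -> cutset b h n x.
Proof.
pose M := `|x.1| + `|x.2| + normc (b x) + normc (h x).
have M0 : 0 <= M by rewrite !addr_ge0 ?normc_ge0.
exists (Num.bound M) => n nN.
have Mn : M < n.+1%:R.
  apply: lt_le_trans (archi_boundP M0) _; rewrite ler_nat; exact: leqW.
have n1 := normr_ge0 x.1; have n2 := normr_ge0 x.2.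
have n3 := normc_ge0 (b x); have n4 := normc_ge0 (h x).
have [a1 a2] : (`|x.1| : R) < n.+1%:R /\ (`|x.2| : R) < n.+1%:R.
  by move: Mn n1 n2 n3 n4; rewrite /M => *; split; lra.
split; last by split => /=; move: Mn n1 n2 n3 n4; rewrite /M; lra.
apply/squareP => /=; move: a1 a2; rewrite !ltr_norml => /andP[b1 b2] /andP[b3 b4].
by split; apply/andP; split; lra.
Qed.

Lemma bigsq_mono n m : (n <= m)%N -> bigsq n `<=` bigsq m.
Proof.
move=> nm x /squareP/=[/andP[a1 a2] /andP[a3 a4]].
have : n.+1%:R <= m.+1%:R :> R by rewrite ler_nat.
by move=> h; apply/squareP => /=; split; apply/andP; split; lra.
Qed.

End limits_of_norms.

(** * From the trilinear form to the norm of the commutator *)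

Section duality.
Context (R : realType).
Variable T : (plane R -> R[i]) -> plane R -> R[i].
Hypothesis Tb : L2_bounded T.
Implicit Types b f g h : plane R -> R[i].

Definition admissible p b f := [/\ Lp p f, Lp 2 f & Lp 2 (fun x => b x * f x)].

Lemma complex_norm_conj (z : R[i]) (r : R) : 1 < r ->
  z * ((part true z +i* - part false z) * ((normc z) `^ (r - 2))%:C) = ((normc z) `^ r)%:C.
Proof.
move=> r1; have e1 : z * (part true z +i* - part false z) = ((normc z) ^+ 2)%:C.
  case: z => x y; rewrite /part /= sqr_sqrtr ?addr_ge0 ?sqr_ge0//.
  by apply/eqP; rewrite eq_complex /=; apply/andP; split; apply/eqP; ring.
rewrite mulrA e1 -rmorphM; congr (_%:C).
have n0 := normc_ge0 z.
have r0 : 0 < r by lra.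
have r10 : 0 < r - 1 by lra.
rewrite expr2 -mulrA (_ : r - 2 = (r - 1) - 1); last by ring.
by rewrite (mulr_powRB1 n0 r10) (mulr_powRB1 n0 r0).
Qed.

Lemma normc_conj_pow (z : R[i]) (r : R) : 1 < r ->
  normc ((part true z +i* - part false z) * ((normc z) `^ (r - 2))%:C) = (normc z) `^ (r - 1).
Proof.
move=> r1; rewrite normcM normc_real (ger0_norm (powR_ge0 _ _)).
have -> : normc (part true z +i* - part false z) = normc z.
  by case: z => x y; rewrite /part /= sqrrN.
have r10 : 0 < r - 1 by lra.
by rewrite (_ : r - 2 = (r - 1) - 1) ?(mulr_powRB1 (normc_ge0 z) r10)//; ring.
Qed.

Variables (p q C beta : R) (b : plane R -> R[i]).
Hypotheses (p1 : 1 < p) (q1 : 1 < q) (pq : p^-1 + q^-1 = 1) (C0 : 0 <= C) (beta0 : 0 <= beta).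
Hypothesis mb : cmeasurable b.
Hypothesis tri : forall (A0 : plane R) (L B : R) f g,
  0 < L -> bounded_on A0 L B f -> bounded_on A0 L B g ->
  (forall x, f x != 0 -> normc (b x) <= B) -> (forall x, g x != 0 -> normc (b x) <= B) ->
  ((normc (cform T b f g))%:E <= (C * beta)%:E * (Lpnorm p f * Lpnorm q g))%E.

Let p0 : 0 < p. Proof. exact: lt_trans p1. Qed.
Let q0 : 0 < q. Proof. exact: lt_trans q1. Qed.
Let two1 : 1 < 2 :> R. Proof. by rewrite ltr1n. Qed.
Let two0 : 0 < 2 :> R. Proof. by []. Qed.

Lemma bigsq_gt0 n : 0 < 2 * n.+1%:R :> R.
Proof. by rewrite mulr_gt0// ltr0n. Qed.

Definition test_fun n B g := bounded_on (- (n.+1%:R : R), - (n.+1%:R : R)) (2 * n.+1%:R) B g /\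
  (forall x, g x != 0 -> normc (b x) <= B).

Lemma test_fun_Lp n B g r : 1 < r -> test_fun n B g -> Lp r g.
Proof. by move=> r1 [bg _]; exact: (bounded_on_Lp (bigsq_gt0 n) r1 bg). Qed.

Lemma test_fun_Lpb n B g r : 1 < r -> test_fun n B g -> Lp r (fun x => b x * g x).
Proof.
move=> r1 [bg hb]; have r0 : 0 < r by exact: lt_trans r1.
have [mg gB _] := bg.
have B0 : 0 <= B by apply: le_trans (gB (0, 0)); exact: normc_ge0.
apply: (@Lp_le _ _ _ (fun x => B%:C * g x)) => //; first exact: cmeasurableM.
  move=> x; rewrite !normcM normc_real (ger0_norm B0).
  have [->|gx] := eqVneq (g x) 0; first by rewrite normc0 !mulr0.
  by apply: ler_wpM2r; [exact: normc_ge0|exact: hb].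
by apply: LpZ => //; exact: (bounded_on_Lp (bigsq_gt0 n) r1 bg).
Qed.

(** Cutting off makes f bounded without raising its p-norm. The cutoffs of f and of b f converge in
    L^2, and the L^2 bound of T passes the form to the limit. Taking k >= n puts the supports of
    both functions into one square. *)
Lemma cform_admissible n B f g : admissible p b f -> test_fun n B g ->
  ((normc (cform T b f g))%:E <= (C * beta)%:E * (Lpnorm p f * Lpnorm q g))%E.
Proof.
move=> [lpf l2f l2bf] tg; have [bg hbg] := tg.
have l2g := test_fun_Lp two1 tg; have l2bg := test_fun_Lpb two1 tg.
have [M M0 hM] := form_bound Tb.
have mf : cmeasurable f by case: l2f.
have mG k : measurable (cutset b f k) by exact: measurable_cutset.
pose fk k := cutoff (cutset b f k) f.
have bcut k : (fun x => b x * fk k x) = cutoff (cutset b f k) (fun x => b x * f x).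
  by apply/funext => x; rewrite /fk /cutoff mulrCA.
have l2fk k : Lp 2 (fk k) by exact: Lp_cut.
have l2bfk k : Lp 2 (fun x => b x * fk k x) by rewrite bcut; exact: Lp_cut.
set W := ((C * beta)%:E * (Lpnorm p f * Lpnorm q g))%E.
apply/lee_addgt0Pr => eta eta0.
have fin h : Lp 2 h -> Lpnorm 2 h = (fine (Lpnorm 2 h))%:E.
  by move=> [_ hh]; rewrite fineK// ge0_fin_numE//; exact: Lpnorm_ge0.
have fin0 h : 0 <= fine (Lpnorm 2 h) by apply: fine_ge0; exact: Lpnorm_ge0.
pose a := fine (Lpnorm 2 g); pose a' := fine (Lpnorm 2 (fun x => b x * g x)).
pose D := eta / (2 * M * (a' + a) + 1).
have a0 : 0 <= a by exact: fin0.
have a0' : 0 <= a' by exact: fin0.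
have den0 : 0 < 2 * M * (a' + a) + 1.
  by rewrite ltr_wpDl// mulr_ge0 ?addr_ge0// mulr_ge0.
have D0 : 0 < D by rewrite divr_gt0.
have [N1 h1] := cut_cvg two0 D0 mG (cutset_ev b f) l2f.
have [N2 h2] := cut_cvg two0 D0 mG (cutset_ev b f) l2bf.
pose k := maxn n (maxn N1 N2).
have {}h1 := h1 k (leq_trans (leq_maxl _ _) (leq_maxr _ _)).
have {}h2 := h2 k (leq_trans (leq_maxr _ _) (leq_maxr _ _)).
have nk : (n <= k)%N by exact: leq_maxl.
have dif : normc (cform T b f g - cform T b (fk k) g) <= eta.
  have l2d : Lp 2 (fun x => f x - fk k x) by apply: LpB => //; exact: ltW.
  have l2bd : Lp 2 (fun x => b x * f x - b x * fk k x) by apply: LpB => //; exact: ltW.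
  have E : cform T b f g - cform T b (fk k) g =
     opform T (fun x => f x - fk k x) (fun x => b x * g x) -
     opform T (fun x => b x * f x - b x * fk k x) g.
    by rewrite /cform (form_subl Tb l2f (l2fk k) l2bg) (form_subl Tb l2bf (l2bfk k) l2g); ring.
  have hp P : `|part P (cform T b f g - cform T b (fk k) g)| <= M * D * (a' + a).
    rewrite E partB; apply: le_trans (ler_normB _ _) _; rewrite mulrDr.
    apply: lerD; rewrite -lee_fin.
      apply: le_trans (hM P _ _ l2d l2bg) _; rewrite (fin _ l2bg) !EFinM.
      apply: lee_wpmul2r; first by rewrite lee_fin.
      by apply: lee_wpmul2l => //; rewrite lee_fin.
    apply: le_trans (hM P _ _ l2bd l2g) _; rewrite (fin _ l2g) !EFinM.
    apply: lee_wpmul2r; first by rewrite lee_fin.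
    apply: lee_wpmul2l; first by rewrite lee_fin.
    by move: h2; rewrite -bcut.
  apply: le_trans (normc_parts _) _; apply: le_trans (lerD (hp true) (hp false)) _.
  rewrite (_ : _ + _ = D * (2 * M * (a' + a))); last by ring.
  rewrite /D mulrAC -mulrA ler_piMr ?(ltW eta0)// ler_pdivrMr// mul1r lerDl//.
have [mg gB g0] := bg.
have B0 : 0 <= B by apply: le_trans (gB (0, 0)); exact: normc_ge0.
pose B' := B + k.+1%:R.
have BB' : B <= B' by rewrite lerDl.
have tk : ((normc (cform T b (fk k) g))%:E <= W)%E.
  apply: (@le_trans _ _ ((C * beta)%:E * (Lpnorm p (fk k) * Lpnorm q g))%E).
    apply: (@tri (- (k.+1%:R : R), - (k.+1%:R : R)) (2 * k.+1%:R) B' _ _ (bigsq_gt0 k)).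
    - split; first by apply: cmeasurable_cut.
        move=> x; have [Gx|Gx] := pselect (cutset b f k x).
          by rewrite /fk cut_in//; case: Gx => _ [_ /= h]; apply: le_trans h _; rewrite lerDr.
        by rewrite /fk cut_out// normc0 addr_ge0.
      by move=> x Sx; rewrite /fk cut_out// => -[].
    - split => //; first by move=> x; exact: le_trans (gB x) BB'.
      by move=> x Sx; apply: g0 => Sx'; apply: Sx; exact: bigsq_mono nk _ Sx'.
    - move=> x; have [Gx _|Gx] := pselect (cutset b f k x).
        by case: Gx => _ [/= h _]; apply: le_trans h _; rewrite lerDr.
      by rewrite /fk cut_out// eqxx.
    - by move=> x /hbg h; exact: le_trans h BB'.
  apply: lee_wpmul2l; first by rewrite lee_fin mulr_ge0.
  apply: lee_wpmul2r; first exact: Lpnorm_ge0.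
  apply: Lpnorm_le => // x; exact: normc_cut.
apply: (@le_trans _ _ (normc (cform T b (fk k) g) + eta)%:E); last by rewrite EFinD leeD2r.
rewrite lee_fin.
have -> : cform T b f g = cform T b (fk k) g + (cform T b f g - cform T b (fk k) g) by ring.
by apply: le_trans (le_normcD _ _) _; rewrite lerD2l.
Qed.

Lemma pairing_commutator n B f g : admissible p b f -> test_fun n B g ->
  pairing (commutator b T f) g = cform T b f g.
Proof.
move=> [lpf l2f l2bf] tg.
have l2g := test_fun_Lp two1 tg; have l2bg := test_fun_Lpb two1 tg.
have [[TL _] _] := Tb.
rewrite /cform /opform /pairing.
have -> : (fun x => commutator b T f x * g x) =
    (fun x => T f x * (b x * g x) + (-1) * (T (fun y => b y * f y) x * g x)).
  by apply/funext => x; rewrite /commutator; ring.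
have s1 : csummable (fun x => T f x * (b x * g x)) by apply: csummable2 => //; exact: TL.
have s2 : csummable (fun x => T (fun y => b y * f y) x * g x) by apply: csummable2 => //; exact: TL.
rewrite cintegralD//; first by rewrite cintegralZ// mulN1r.
move=> c; under eq_fun do rewrite mulN1r -[X in part c X]sub0r partB.
have -> : (fun x => (part c 0 - part c (T (fun y => b y * f y) x * g x))%:E) =
   (fun x => (-1)%:E * (part c (T (fun y => b y * f y) x * g x))%:E)%E.
  by apply/funext => x; rewrite -EFinM; congr (_%:E); rewrite /part; case: c => /=; ring.
by apply: integrableZl => //; exact: s2.
Qed.

(** The commutator is cut off before it is tested, so that its p-norm is finite and J <= W J^(1/q)
    can be divided by J^(1/q). Fatou removes the cutoff. *)
Lemma commutator_bound f : admissible p b f ->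
  (Lpnorm p (commutator b T f) <= (C * beta)%:E * Lpnorm p f)%E.
Proof.
move=> af; have [lpf l2f l2bf] := af; have [[TL _] _] := Tb.
set F := commutator b T f.
have mF : cmeasurable F.
  apply: cmeasurableB; first by apply: cmeasurableM => //; case: (TL _ l2f).
  by case: (TL _ l2bf).
have fN : Lpnorm p f = (fine (Lpnorm p f))%:E.
  by case: lpf => _ h; rewrite fineK// ge0_fin_numE//; exact: Lpnorm_ge0.
set Nf := fine (Lpnorm p f) in fN.
have Nf0 : 0 <= Nf by apply: fine_ge0; exact: Lpnorm_ge0.
pose W := C * beta * Nf.
have W0 : 0 <= W by rewrite !mulr_ge0.
rewrite fN -EFinM -/W.
have mG k : measurable (cutset b F k) by exact: measurable_cutset.
pose Fk k := cutoff (cutset b F k) F.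
have mFk k : cmeasurable (Fk k) by exact: cmeasurable_cut.
apply: (@Lpnorm_fatou _ p Fk) => //.
  move=> x; apply: cvg_near_cst; have [N hN] := cutset_ev b F x.
  by exists N => // k /= /hN Gx; rewrite /Fk cut_in.
move=> k; pose w := k.+1%:R : R.
have w1 : 1 <= w by rewrite ler1n.
have w0 : 0 <= w by exact: le_trans w1.
(* The extremal test function: on the cutoff set F g = |F|^p and |g|^q = |F|^p. *)
pose cj (z : R[i]) := (part true z +i* - part false z) * ((normc z) `^ (p - 2))%:C.
have mcj : cmeasurable (fun x => cj (F x)).
  apply: cmeasurableM.
    split => /=; first exact: (cmeasurable_part true mF).
    by apply: measurableT_comp => //; exact: (cmeasurable_part false mF).
  apply: cmeasurable_real; apply: (measurableT_comp (measurable_powR _)).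
  exact: measurable_normc.
pose g := cutoff (cutset b F k) (fun x => cj (F x)).
pose B := w + w `^ (p - 1).
have p10 : 0 < p - 1 by rewrite subr_gt0.
have tg : test_fun k B g.
  split; first split; first exact: cmeasurable_cut.
  - move=> x; have [Gx|Gx] := pselect (cutset b F k x).
      rewrite /g cut_in// normc_conj_pow//; case: Gx => _ [_ /= h].
      apply: le_trans (_ : w `^ (p - 1) <= _); last by rewrite lerDr.
      by apply: ler_powR2r => //; [exact: ltW|exact: normc_ge0].
    by rewrite /g cut_out// normc0 addr_ge0 ?powR_ge0.
  - by move=> x Sx; rewrite /g cut_out// => -[].
  - move=> x; have [Gx _|Gx] := pselect (cutset b F k x).
      by case: Gx => _ [/= h _]; apply: le_trans h _; rewrite lerDl powR_ge0.
    by rewrite /g cut_out// eqxx.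
have bFk : bounded_on (- (k.+1%:R : R), - (k.+1%:R : R)) (2 * k.+1%:R) w (Fk k).
  split => //.
    move=> x; have [Gx|Gx] := pselect (cutset b F k x).
      by rewrite /Fk cut_in//; case: Gx => _ [].
    by rewrite /Fk cut_out// normc0.
  by move=> x Sx; rewrite /Fk cut_out// => -[].
have lFk : Lp p (Fk k) by exact: (bounded_on_Lp (bigsq_gt0 k) p1 bFk).
pose J := fine (Npow p (Fk k)).
have Jfin : Npow p (Fk k) = J%:E.
  rewrite fineK// ge0_fin_numE; last exact: Npow_ge0.
  by rewrite -powR_Lpnorm//; case: lFk => _; exact: poweR_lty.
have J0 : 0 <= J by apply: fine_ge0; exact: Npow_ge0.
have Fg x : F x * g x = ((normc (Fk k x)) `^ p)%:C.
  have [Gx|Gx] := pselect (cutset b F k x).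
    by rewrite /g /Fk !cut_in// complex_norm_conj.
  by rewrite /g /Fk !cut_out// mulr0 normc0 powR0// gt_eqF.
have pair : part true (pairing F g) = J.
  rewrite part_cintegral /J /Rintegral; congr fine.
  by apply: eq_integral => x _; rewrite Fg.
have Ng : Lpnorm q g = (J `^ q^-1)%:E.
  rewrite LpnormE// (_ : Npow q g = Npow p (Fk k)); first by rewrite Jfin poweR_EFin.
  apply: eq_integral => x _; congr (_%:E).
  have [Gx|Gx] := pselect (cutset b F k x); last first.
    by rewrite /g /Fk !cut_out// normc0 !powR0// gt_eqF.
  rewrite /g /Fk !cut_in// normc_conj_pow// -powRrM; congr (_ `^ _).
  have pn : p != 0 by rewrite gt_eqF.
  have qn : q != 0 by rewrite gt_eqF.
  have : p * q * (p^-1 + q^-1) = p * q by rewrite pq mulr1.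
  rewrite mulrDr mulrAC mulfV// mul1r mulfK// => h.
  by rewrite mulrBl mul1r -h; ring.
have JW : J <= W * J `^ q^-1.
  have := cform_admissible af tg; rewrite -(pairing_commutator af tg) -/F Ng fN.
  rewrite -!EFinM lee_fin mulrA -/W; apply: le_trans.
  by rewrite -pair; apply: le_trans (ler_norm _) (part_normc _ _).
apply/Lpnorm_le_fin => //; rewrite Jfin lee_fin.
have [J00|Jn0] := eqVneq J 0; first by rewrite J00 powR_ge0.
have Jp : 0 < J by rewrite lt_def Jn0.
rewrite -[leLHS](@powR_invK _ p)// ?gt_eqF//.
apply: ler_powR2r; [exact: ltW|exact: powR_ge0|].
rewrite -(ler_pM2r (powR_gt0 q^-1 Jp)) -powRD ?pq ?powRr1//.
by rewrite oner_eq0.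
Qed.

End duality.

(** * Completeness of L^p *)

Section completeness.
Context (R : realType).
Implicit Types (f g h : plane R -> R[i]) (p : R).

Lemma Lpnorm_ae p f g : 0 < p -> cmeasurable f -> cmeasurable g -> ae_equal f g ->
  Lpnorm p f = Lpnorm p g.
Proof.
move=> p0 mf mg fg; rewrite (LpnormE f p0) (LpnormE g p0).
suff -> : Npow p f = Npow p g by [].
apply: ae_eq_integral => //; [exact: measurable_normc_powR|exact: measurable_normc_powR|].
by move: fg; apply: filterS => x /= -> _.
Qed.

Lemma Lpnorm_eq0_ae p f g : 0 < p -> cmeasurable f -> cmeasurable g ->
  Lpnorm p (fun x => f x - g x) = 0%E -> ae_equal f g.
Proof.
move=> p0 mf mg h0; have mfg := cmeasurableB mf mg.
have m : measurable_fun setT (fun x => (normc (f x - g x))%:E).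
  by apply/measurable_EFinP; exact: measurable_normc.
have := @Lnorm_eq0_eq0 _ _ _ (area R) (fun x => (normc (f x - g x))%:E) p%:E m _ h0.
rewrite lte_fin => /(_ p0); apply: filterS => x /= /(_ I) [] /eq0_normc /eqP.
by rewrite subr_eq0 => /eqP.
Qed.

Lemma cvg_normcB (z : nat -> R[i]) (w v : R[i]) :
  (forall c, part c (z n) @[n --> \oo] --> part c w) ->
  normc (z n - v) @[n --> \oo] --> normc (w - v).
Proof.
move=> h; apply/cvgrPdist_le => eps e0; have e20 : 0 < eps / 2 by rewrite divr_gt0.
have /cvgrPdist_le/(_ _ e20) h1 := h true; have /cvgrPdist_le/(_ _ e20) h2 := h false.
near=> n.
have d1 : `|part true (z n - w)| <= eps / 2 by rewrite partB distrC; near: n.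
have d2 : `|part false (z n - w)| <= eps / 2 by rewrite partB distrC; near: n.
have dz : normc (z n - w) <= eps.
  by apply: le_trans (normc_parts _) _; rewrite [leRHS]splitr; exact: lerD.
have dz' : normc (w - z n) <= eps by rewrite -opprB normcN.
have t1 := normc_tri w (z n) v; have t2 := normc_tri (z n) w v.
by rewrite ler_norml; apply/andP; split; lra.
Unshelve. all: by end_near. Qed.

Lemma cvg_of_bounded_variation (a : nat -> R) (M : R) :
  (forall n, \sum_(k < n) `|a k.+1 - a k| <= M) -> cvgn a.
Proof.
move=> hM; have c : cvgn (series (telescope a)).
  have nE n : [normed series (telescope a)] n = \sum_(k < n) `|a k.+1 - a k|.
    by rewrite /normed_series_of /series /= big_mkord.
  apply: normed_cvg; apply: nondecreasing_is_cvgn.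
    by apply/nondecreasing_seqP => n; rewrite !nE big_ord_recr/= lerDl.
  exists M => _ [n _ <-]; rewrite nE; exact: hM.
have -> : a = (fun n => a 0%N + series (telescope a) n).
  by apply/funext => n; exact: eq_sum_telescope.
by apply: is_cvgD => //; exact: is_cvg_cst.
Qed.

(* A limit is characterised by the distances it inherits from the sequence, so
   that no convergence in norm needs to be stated. *)
Lemma riesz_fischer p (F : nat -> plane R -> R[i]) (A : R) : 1 < p -> 0 <= A ->
  (forall n, cmeasurable (F n)) ->
  (forall n, (Lpnorm p (fun x => (F n.+1 x - F n x)%R) <= (A * 2^-1 ^+ n)%:E)%E) ->
  exists2 Phi, cmeasurable Phi & forall h (c : R) N, cmeasurable h -> 0 <= c ->
    (forall n, (N <= n)%N -> (Lpnorm p (fun x => (F n x - h x)%R) <= c%:E)%E) ->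
    (Lpnorm p (fun x => (Phi x - h x)%R) <= c%:E)%E.
Proof.
move=> p1 A0 mF hF; have p0 : 0 < p by exact: lt_trans p1.
(* G bounds the variation of the sequence at x. Its norms stay below 2 A, so by monotone convergence
   its supremum is finite almost everywhere, and there the sequence converges. *)
pose G n (x : plane R) := \sum_(k < n) normc (F k.+1 x - F k x).
have G0 n x : 0 <= G n x by apply: sumr_ge0 => k _; exact: normc_ge0.
have md n : cmeasurable (fun x => F n.+1 x - F n x) by exact: cmeasurableB.
have mG n : measurable_fun setT (G n).
  by apply: measurable_sum => k; exact: measurable_normc.
have mGc n : cmeasurable (fun x => (G n x)%:C) by exact: cmeasurable_real.
have NG n : (Lpnorm p (fun x => (G n x)%:C) <= (2 * A * (1 - 2^-1 ^+ n))%:E)%E.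
  elim: n => [|n IH].
    rewrite expr0 subrr mulr0; apply/Lpnorm_le_fin => //.
    rewrite powR0 ?gt_eqF// /Npow integral0_eq// => x _.
    by rewrite /G big_ord0 normc0 powR0// gt_eqF.
  have -> : (fun x => (G n.+1 x)%:C) =
      (fun x => (G n x)%:C + (normc (F n.+1 x - F n x))%:C).
    by apply/funext => x; rewrite /G big_ord_recr/= rmorphD.
  apply: le_trans (Lpnorm_triangle (ltW p1) (mGc n) _) _.
    by apply: cmeasurable_real; exact: measurable_normc.
  rewrite (_ : 2 * A * (1 - 2^-1 ^+ n.+1) = 2 * A * (1 - 2^-1 ^+ n) + A * 2^-1 ^+ n); last first.
    by rewrite exprS; field.
  rewrite EFinD; apply: leeD => //; apply: le_trans (hF n).
  by apply: Lpnorm_le => // x; rewrite normc_real ger0_norm ?normc_ge0.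
pose u n x := ((G n x) `^ p)%:E.
have Gmono x : {homo G^~ x : n m / (n <= m)%N >-> n <= m}.
  apply/nondecreasing_seqP => n; rewrite /G big_ord_recr/= lerDl; exact: normc_ge0.
have umono x : {homo u^~ x : n m / (n <= m)%N >-> (n <= m)%E}.
  move=> n m nm; rewrite lee_fin; apply: ler_powR2r => //; first exact: ltW.
  exact: Gmono.
have mu n : measurable_fun setT (u n).
  by apply/measurable_EFinP; exact: (measurableT_comp (measurable_powR _)).
pose S x : \bar R := ereal_sup (range (u^~ x)).
have Scvg x : u^~ x @ \oo --> S x by exact: ereal_nondecreasing_cvgn.
have mS : measurable_fun setT S.
  by apply: (@emeasurable_fun_cvg _ _ _ setT u S) => // x _; exact: Scvg.
have S0 x : (0 <= S x)%E.
  apply: (@le_trans _ _ (u 0%N x)); first by rewrite lee_fin powR_ge0.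
  by apply: ereal_sup_ubound; exists 0%N.
have IS : (\int[area R]_x S x <= ((2 * A) `^ p)%:E)%E.
  have -> : (\int[area R]_x S x = \int[area R]_x limn (u^~ x))%E.
    by apply: eq_integral => x _; apply/esym/cvg_lim => //; exact: Scvg.
  rewrite monotone_convergence//; last by move=> n x _; rewrite lee_fin powR_ge0.
  apply: lime_le.
    apply: ereal_nondecreasing_is_cvgn => n m nm; apply: integral_monotone => x _.
    exact: umono.
  apply: nearW => n.
  have c0 : 0 <= 2 * A * (1 - 2^-1 ^+ n).
    rewrite mulr_ge0 ?mulr_ge0// subr_ge0; apply: exprn_ile1 => //.
    by rewrite invf_le1// ler1n.
  have h := (Lpnorm_le_fin _ p0 c0).1 (NG n).
  rewrite [leLHS](_ : _ = Npow p (fun x => (G n x)%:C)); last first.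
    by apply: eq_integral => x _; rewrite normc_real ger0_norm.
  apply: le_trans h _; rewrite lee_fin; apply: ler_powR2r => //; first exact: ltW.
  by rewrite ler_piMr ?mulr_ge0// gerBl exprn_ge0.
pose E := [set x | S x \is a fin_num].
have aeE : \forall x \ae area R, E x.
  have iS : (area R).-integrable setT S.
    apply/integrableP; split => //.
    apply: le_lt_trans (_ : _ <= ((2 * A) `^ p)%:E)%E _; last by rewrite ltry.
    by apply: le_trans IS; apply: integral_monotone => x _; rewrite gee0_abs.
  by have := integrable_ae measurableT iS; apply: filterS => x /(_ I).
have mE : measurable E.
  by rewrite -[E]setTI; exact: (emeasurable_fin_num measurableT mS).
have Ecvg x c : E x -> cvgn (fun n => part c (F n x)).
  move=> Ex; apply: (cvg_of_bounded_variation (M := (fine (S x)) `^ p^-1)) => n.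
  apply: (@le_trans _ _ (G n x)).
    by apply: ler_sum => k _; rewrite -partB; exact: part_normc.
  rewrite -(@powRK _ p (G n x)) ?gt_eqF//.
  apply: ler_powR2r; [by rewrite invr_ge0 ltW|exact: powR_ge0|].
  by rewrite -lee_fin fineK//; apply: ereal_sup_ubound; exists n.
(* After cutting off to E the sequence converges at every point, so the limit is measurable. *)
pose sP (c : bool) (x : plane R) : R^nat := fun n => part c (cutoff E (F n) x).
pose P (c : bool) (x : plane R) : R := limn (sP c x).
have Pcvg x c : part c (cutoff E (F n) x) @[n --> \oo] --> P c x.
  have [Ex|Ex] := pselect (E x).
    have eF : (fun n => part c (cutoff E (F n) x)) = (fun n => part c (F n x)).
      by apply/funext => n; rewrite cut_in.
    by rewrite /P /sP eF; exact: Ecvg.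
  have eF : (fun n => part c (cutoff E (F n) x)) = (fun n => part c 0).
    by apply/funext => n; rewrite cut_out.
  by rewrite /P /sP eF; exact: is_cvg_cst.
pose Phi x := P true x +i* P false x.
have mcF n : cmeasurable (cutoff E (F n)) by exact: cmeasurable_cut.
have mP c : measurable_fun setT (P c).
  apply: (@measurable_fun_cvg _ _ _ setT (fun n x => part c (cutoff E (F n) x)) (P c)).
    by move=> n; exact: cmeasurable_part (mcF n).
  by move=> x _; exact: Pcvg.
have mPhi : cmeasurable Phi by split; [exact: (mP true)|exact: (mP false)].
exists Phi => // h c N mh c0 hN.
have mPh : cmeasurable (fun x => Phi x - h x) by exact: cmeasurableB.
rewrite (Lpnorm_ae p0 mPh (cmeasurable_cut mE mPh)); last first.
  by move: aeE; apply: filterS => x Ex; rewrite cut_in.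
apply: (@Lpnorm_fatou _ p (fun n => cutoff E (fun x => F (n + N)%N x - h x))) => //.
- by move=> n; apply: cmeasurable_cut => //; exact: cmeasurableB.
- move=> x; have [Ex|Ex] := pselect (E x); last first.
    rewrite cut_out//; apply: cvg_near_cst; apply: nearW => n; by rewrite cut_out.
  rewrite cut_in//.
  have -> : (fun n => normc (cutoff E (fun x => F (n + N)%N x - h x) x)) =
      (fun n => normc (F (n + N)%N x - h x)) by apply/funext => n; rewrite cut_in.
  apply: (cvg_normcB (z := fun n => F (n + N)%N x)) => c'.
  have := Pcvg x c'.
  have -> : (fun n => part c' (cutoff E (F n) x)) = (fun n => part c' (F n x)).
    by apply/funext => n; rewrite cut_in.
  rewrite (_ : part c' (Phi x) = P c' x); last by rewrite /Phi /part; case: c'.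
  by rewrite -(cvg_shiftn N).
- move=> n; apply: le_trans (hN (n + N)%N (leq_addl _ _)).
  by apply: Lpnorm_le => // x; exact: normc_cut.
Qed.

End completeness.

(** * Extension from the dense class *)

Section extension.
Context (R : realType).
Variables (T : (plane R -> R[i]) -> plane R -> R[i]) (p W : R) (b : plane R -> R[i]).
Hypotheses (Tb : L2_bounded T) (p1 : 1 < p) (W0 : 0 <= W) (mb : cmeasurable b).
Local Notation com := (commutator b T).
Local Notation adm := (admissible p b).
Hypothesis com_le : forall f, adm f -> (Lpnorm p (com f) <= W%:E * Lpnorm p f)%E.
Implicit Types f g h F G : plane R -> R[i].

Let p0 : 0 < p. Proof. exact: lt_trans p1. Qed.
Let p1' : 1 <= p. Proof. exact: ltW. Qed.
Let two0 : 0 < 2 :> R. Proof. by []. Qed.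
Let two1 : 1 <= 2 :> R. Proof. exact: ler1n. Qed.

Definition nm f : R := fine (Lpnorm p f).

Lemma nmE f : Lp p f -> Lpnorm p f = (nm f)%:E.
Proof. by move=> [_ h]; rewrite fineK// ge0_fin_numE//; exact: Lpnorm_ge0. Qed.

Lemma nm_ge0 f : 0 <= nm f. Proof. by apply: fine_ge0; exact: Lpnorm_ge0. Qed.

Lemma nm_eq f g : (forall x, normc (f x) = normc (g x)) -> nm f = nm g.
Proof. by move=> h; rewrite /nm (eq_Lpnorm p h). Qed.

Lemma nmC f g : nm (fun x => f x - g x) = nm (fun x => g x - f x).
Proof. by apply: nm_eq => x; rewrite -normcN opprB. Qed.

Lemma nmD f g : Lp p f -> Lp p g -> nm (fun x => f x + g x) <= nm f + nm g.
Proof.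
move=> lf lg; rewrite -lee_fin EFinD -!nmE//; last exact: LpD.
by apply: Lpnorm_triangle => //; [case: lf|case: lg].
Qed.

Lemma nm_tri f g h : Lp p f -> Lp p g -> Lp p h ->
  nm (fun x => f x - h x) <= nm (fun x => f x - g x) + nm (fun x => g x - h x).
Proof.
move=> lf lg lh; apply: le_trans (nmD (LpB p1' lf lg) (LpB p1' lg lh)).
by rewrite le_eqVlt; apply/orP; left; apply/eqP; apply: nm_eq => x; congr normc; ring.
Qed.

Lemma nmZ z f : Lp p f -> nm (fun x => z * f x) = normc z * nm f.
Proof.
move=> lf; apply: EFin_inj; rewrite -nmE; last exact: LpZ.
by rewrite LpnormZ//; [rewrite nmE// EFinM|case: lf].
Qed.

Lemma nm_ae f g : cmeasurable f -> cmeasurable g -> ae_equal f g -> nm f = nm g.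
Proof. by move=> mf mg fg; rewrite /nm (Lpnorm_ae p0 mf mg fg). Qed.

Lemma adm_lin z f g : adm f -> adm g -> adm (fun x => z * f x + g x).
Proof.
move=> [a1 a2 a3] [b1 b2 b3]; split.
- by apply: LpD => //; exact: LpZ.
- by apply: LpD => //; exact: LpZ.
- rewrite (_ : (fun x => _) = (fun x => z * (b x * f x) + b x * g x)).
    by apply: LpD => //; exact: LpZ.
  by apply/funext => x; ring.
Qed.

Lemma adm0 : adm (fun=> 0).
Proof.
split; [exact: Lp0|exact: Lp0|].
by rewrite (_ : (fun x => _) = (fun=> 0)); [exact: Lp0|apply/funext => x; rewrite mulr0].
Qed.

Lemma com_Lp f : adm f -> Lp p (com f).
Proof.
move=> af; have [lpf l2f l2bf] := af; have [[TL _] _] := Tb; split.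
  apply: cmeasurableB; first by apply: cmeasurableM => //; case: (TL _ l2f).
  by case: (TL _ l2bf).
by apply: le_lt_trans (com_le af) _; rewrite nmE// -EFinM ltry.
Qed.

Lemma com_nm f : adm f -> nm (com f) <= W * nm f.
Proof.
move=> af; have [lpf _ _] := af.
by rewrite -lee_fin EFinM -!nmE//; [exact: com_le|exact: com_Lp].
Qed.

Lemma com_lin z f g : adm f -> adm g ->
  ae_equal (com (fun x => z * f x + g x)) (fun x => z * com f x + com g x).
Proof.
move=> [_ a2 a3] [_ b2 b3]; have [[_ Tlin] _] := Tb.
have h1 := Tlin z _ _ a2 b2; have h2 := Tlin z _ _ a3 b3.
move: h1 h2; apply: filterS2 => x h1 h2.
rewrite /commutator h1 (_ : (fun y => b y * _) =
    (fun y => z * (b y * f y) + b y * g y)); last by apply/funext => y; ring.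
by rewrite h2; ring.
Qed.

Lemma com_dist f g : adm f -> adm g ->
  nm (fun x => com f x - com g x) <= W * nm (fun x => f x - g x).
Proof.
move=> af ag; have al := adm_lin (-1) ag af.
have E : (fun x => -1 * g x + f x) = (fun x => f x - g x).
  by apply/funext => x; ring.
rewrite E in al; apply: le_trans (com_nm al).
rewrite le_eqVlt; apply/orP; left; apply/eqP; apply: nm_ae.
- by apply: cmeasurableB; [case: (com_Lp af)|case: (com_Lp ag)].
- by case: (com_Lp al).
- have := com_lin (-1) ag af; rewrite E; apply: filterS => x /= ->; ring.
Qed.

Lemma adm_dense f (eps : R) : Lp p f -> 0 < eps ->
  exists2 h, adm h & nm (fun x => f x - h x) <= eps.
Proof.
move=> lf e0; have mf : cmeasurable f by case: lf.
have mG k : measurable (cutset b f k) by exact: measurable_cutset.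
have [N hN] := cut_cvg p0 e0 mG (cutset_ev b f) lf.
have lc : Lp p (cutoff (cutset b f N) f) by exact: Lp_cut.
have tf : test_fun b N N.+1%:R (cutoff (cutset b f N) f).
  split; first split; first exact: cmeasurable_cut.
  - move=> x; have [Gx|Gx] := pselect (cutset b f N x).
      by rewrite cut_in//; case: Gx => _ [].
    by rewrite cut_out// normc0.
  - by move=> x Sx; rewrite cut_out// => -[].
  - move=> x; have [Gx _|Gx] := pselect (cutset b f N x).
      by case: Gx => _ [].
    by rewrite cut_out// eqxx.
exists (cutoff (cutset b f N) f).
  have lt12 : 1 < 2 :> R by rewrite ltr1n.
  by split => //; [exact: test_fun_Lp lt12 tf|exact: (test_fun_Lpb mb lt12 tf)].
by rewrite -lee_fin -nmE; [exact: hN|exact: LpB].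
Qed.

(** Describes the value at f of the continuous extension of [com] by its distances to the values on
    admissible functions. Uniqueness, linearity and the bound then follow from density, without
    carrying an approximating sequence. *)
Definition represents f F := Lp p F /\ forall h, adm h ->
  nm (fun x => F x - com h x) <= W * nm (fun x => f x - h x).

Lemma represents_com f : adm f -> represents f (com f).
Proof. by move=> af; split=> [|h ah]; [exact: com_Lp|exact: com_dist]. Qed.

Lemma represents_unique f F G : Lp p f -> represents f F -> represents f G -> ae_equal F G.
Proof.
move=> lf [lF hF] [lG hG]; apply: (Lpnorm_eq0_ae p0); [by case: lF|by case: lG|].
rewrite nmE; last exact: LpB.
congr (_%:E); apply/eqP; rewrite eq_le nm_ge0 andbT.
apply/ler_addgt0Pr => eps e0; rewrite add0r.
(* The + 1 is there because W may be 0. *)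
have d0 : 0 < eps / (2 * W + 1) by rewrite divr_gt0// ltr_wpDl// mulr_ge0.
have [h ah hh] := adm_dense lf d0.
apply: le_trans (nm_tri lF (com_Lp ah) lG) _; rewrite [X in _ + X]nmC.
apply: le_trans (lerD (hF h ah) (hG h ah)) _.
have : W * nm (fun x => f x - h x) <= W * (eps / (2 * W + 1)) by rewrite ler_wpM2l.
have : 2 * (W * (eps / (2 * W + 1))) <= eps.
  rewrite (_ : 2 * _ = eps * (2 * W) / (2 * W + 1)); last by field; rewrite gt_eqF// ltr_wpDl// mulr_ge0.
  rewrite ler_pdivrMr; last by rewrite ltr_wpDl// mulr_ge0.
  by rewrite ler_wpM2l ?(ltW e0)// lerDl.
lra.
Qed.

Lemma represents_bound f F : Lp p f -> represents f F -> nm F <= W * nm f.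
Proof.
move=> lf [lF hF]; apply/ler_addgt0Pr => eps e0.
have d0 : 0 < eps / (2 * W + 1) by rewrite divr_gt0// ltr_wpDl// mulr_ge0.
have [h ah hh] := adm_dense lf d0; have [lh _ _] := ah.
have l0 : Lp p (fun _ : plane R => 0 : R[i]) by exact: Lp0.
have nm0 g : nm (fun x => g x - 0) = nm g by apply: nm_eq => x; rewrite subr0.
have t1 := nm_tri lF (com_Lp ah) l0; have t2 := nm_tri lh lf l0; rewrite !nm0 in t1 t2.
have t3 := hF h ah; have t4 := com_nm ah.
have t5 : W * nm h <= W * (nm (fun x => h x - f x) + nm f) by rewrite ler_wpM2l.
rewrite nmC mulrDr in t5.
have t6 : W * nm (fun x => f x - h x) <= W * (eps / (2 * W + 1)) by rewrite ler_wpM2l.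
have : 2 * (W * (eps / (2 * W + 1))) <= eps.
  rewrite (_ : 2 * _ = eps * (2 * W) / (2 * W + 1)); last by field; rewrite gt_eqF// ltr_wpDl// mulr_ge0.
  rewrite ler_pdivrMr; last by rewrite ltr_wpDl// mulr_ge0.
  by rewrite ler_wpM2l ?(ltW e0)// lerDl.
lra.
Qed.

Lemma represents_lin z f g F G : Lp p f -> Lp p g -> represents f F -> represents g G ->
  represents (fun x => z * f x + g x) (fun x => z * F x + G x).
Proof.
move=> lf lg [lF hF] [lG hG]; have lzF : Lp p (fun x => z * F x) by exact: LpZ.
have lzf : Lp p (fun x => z * f x) by exact: LpZ.
have lzfg : Lp p (fun x => z * f x + g x) by exact: LpD.
have lzFG : Lp p (fun x => z * F x + G x) by exact: LpD.
split => // h ah; have [lh _ _] := ah.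
apply/ler_addgt0Pr => eps e0.
(* Replacing f and g by f' and g' costs W (|z| + 1) eps / A twice, once on the side of F and G and
   once on the side of the inputs. *)
pose A := 2 * W * (normc z + 1) + 1.
have z0 := normc_ge0 z.
have A0 : 0 < A by rewrite ltr_wpDl// mulr_ge0 ?mulr_ge0// addr_ge0.
have d0 : 0 < eps / A by rewrite divr_gt0.
have [f' af' hf'] := adm_dense lf d0; have [g' ag' hg'] := adm_dense lg d0.
have [lf' _ _] := af'; have [lg' _ _] := ag'.
have al := adm_lin z af' ag'; have [ll _ _] := al.
have lcl := com_Lp al; have lcf := com_Lp af'; have lcg := com_Lp ag'.
have split_le u v u' v' : Lp p u -> Lp p u' -> Lp p v -> Lp p v' ->
    nm (fun x => (z * u x + v x) - (z * u' x + v' x)) <=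
    normc z * nm (fun x => u x - u' x) + nm (fun x => v x - v' x).
  move=> lu lu' lv lv'; have l1 := LpB p1' lu lu'; have l2 := LpB p1' lv lv'.
  rewrite -nmZ//; apply: le_trans (nmD (LpZ z p0 l1) l2).
  by rewrite le_eqVlt; apply/orP; left; apply/eqP; apply: nm_eq => x; congr normc; ring.
have lzc : Lp p (fun x => z * com f' x + com g' x) by apply: LpD => //; exact: LpZ.
have t1 := nm_tri lzFG lzc (com_Lp ah).
have t2 := split_le F G (com f') (com g') lF lcf lG lcg.
have t3 : nm (fun x => (z * com f' x + com g' x) - com h x) =
    nm (fun x => com (fun y => z * f' y + g' y) x - com h x).
  apply: nm_ae.
  - by apply: cmeasurableB; [case: lzc|case: (com_Lp ah)].
  - by apply: cmeasurableB; [case: lcl|case: (com_Lp ah)].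
  - by move: (com_lin z af' ag'); apply: filterS => x /= ->.
have t4 := com_dist al ah.
have t5 := nm_tri ll lzfg lh; rewrite [X in _ <= X + _]nmC in t5.
have t6 := split_le f g f' g' lf lf' lg lg'.
have s1 : normc z * nm (fun x => F x - com f' x) <= normc z * (W * (eps / A)).
  by rewrite ler_wpM2l//; apply: le_trans (hF _ af') _; rewrite ler_wpM2l.
have s2 : nm (fun x => G x - com g' x) <= W * (eps / A).
  by apply: le_trans (hG _ ag') _; rewrite ler_wpM2l.
have s3 : W * nm (fun x => (z * f' x + g' x) - h x) <=
    W * (normc z * (eps / A) + eps / A) + W * nm (fun x => (z * f x + g x) - h x).
  rewrite -mulrDr ler_wpM2l//; apply: le_trans t5 _; rewrite lerD2r.
  by apply: le_trans t6 _; apply: lerD => //; rewrite ler_wpM2l.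
have s4 : 2 * W * (normc z + 1) * (eps / A) <= eps.
  rewrite mulrCA ler_piMr ?(ltW e0)// ler_pdivrMr// mul1r /A lerDl//.
have s5 : normc z * (W * (eps / A)) + W * (eps / A) + W * (normc z * (eps / A) + eps / A) =
    2 * W * (normc z + 1) * (eps / A) by ring.
move: t1 t2 t4 s1 s2 s3 s4 s5; rewrite t3.
move: (nm _) (nm _) (nm _) (nm _) (W * nm _) (W * nm _) => *; lra.
Qed.

Lemma represents_exists f : Lp p f -> exists F, represents f F.
Proof.
move=> lf; have half0 n : 0 < 2^-1 ^+ n :> R by rewrite exprn_gt0// invr_gt0.
have [h hh] : exists h : nat -> plane R -> R[i],
    forall n, adm (h n) /\ nm (fun x => f x - h n x) <= 2^-1 ^+ n.
  have ex n : exists h : plane R -> R[i], adm h /\ nm (fun x => f x - h x) <= 2^-1 ^+ n.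
    by have [h ah hh] := adm_dense lf (half0 n); exists h.
  by have [h hh] := choice ex; exists h.
have ah n : adm (h n) by case: (hh n).
have lh n : Lp p (h n) by case: (ah n).
have dh n : nm (fun x => f x - h n x) <= 2^-1 ^+ n by case: (hh n).
have W20 : 0 <= 2 * W by rewrite mulr_ge0.
have lc n := com_Lp (ah n).
have [Phi mPhi hPhi] : exists2 Phi, cmeasurable Phi & forall k (c : R) N, cmeasurable k -> 0 <= c ->
    (forall n, (N <= n)%N -> (Lpnorm p (fun x => (com (h n) x - k x)%R) <= c%:E)%E) ->
    (Lpnorm p (fun x => (Phi x - k x)%R) <= c%:E)%E.
  (* The factor 2 W covers the distance between consecutive approximants, which is at most 2^(-n) +
     2^(-n-1). *)
  apply: (riesz_fischer (F := fun n => com (h n)) p1 W20).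
    by move=> n; case: (lc n).
  move=> n; rewrite nmE ?lee_fin; last exact: LpB.
  apply: le_trans (com_dist (ah n.+1) (ah n)) _.
  have t := nm_tri (lh n.+1) lf (lh n); rewrite [X in _ <= X + _]nmC in t.
  rewrite [leRHS](_ : _ = W * (2^-1 ^+ n + 2^-1 ^+ n)); last by ring.
  rewrite ler_wpM2l//; apply: le_trans t _; apply: lerD => //.
  apply: le_trans (dh n.+1) _; rewrite exprS ler_piMl ?(ltW (half0 n))//.
  by rewrite invf_le1// ler1n.
have close k N : adm k -> (Lpnorm p (fun x => (Phi x - com k x)%R) <=
    (W * (nm (fun x => (f x - k x)%R) + 2^-1 ^+ N))%:E)%E.
  move=> ak; have [lk _ _] := ak; apply: (hPhi _ _ N).
  - by case: (com_Lp ak).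
  - by rewrite mulr_ge0// addr_ge0 ?nm_ge0 ?(ltW (half0 N)).
  move=> n Nn; rewrite nmE ?lee_fin; last by apply: LpB => //; exact: com_Lp.
  apply: le_trans (com_dist (ah n) ak) _; rewrite ler_wpM2l//.
  have t := nm_tri (lh n) lf lk; rewrite [X in _ <= X + _]nmC in t.
  apply: le_trans t _; rewrite addrC lerD2l; apply: le_trans (dh n) _.
  by rewrite ler_wiXn2l ?invr_ge0// invf_le1// ler1n.
have lPhi : Lp p Phi.
  have ld : Lp p (fun x => Phi x - com (fun=> 0) x).
    split; first by apply: cmeasurableB => //; case: (com_Lp adm0).
    by apply: le_lt_trans (close _ 0%N adm0) _; rewrite ltry.
  have := LpD p1' ld (com_Lp adm0).
  by under eq_fun do rewrite subrK.
exists Phi; split => // k ak; have [lk _ _] := ak.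
apply/ler_addgt0Pr => eps e0.
have [N hN] : exists N, W * 2^-1 ^+ N <= eps.
  have eW : 0 < eps / (W + 1) by rewrite divr_gt0// ltr_wpDl.
  (* With side 1 the mesh is 2^(-N). *)
  have [N hN] := mesh_small ltr01 eW.
  exists N; have := hN N (leqnn N); rewrite /mesh mul1r => h1.
  apply: (@le_trans _ _ (W * (eps / (W + 1)))).
    by rewrite ler_wpM2l// exprVn.
  by rewrite mulrCA ler_piMr ?(ltW e0)// ler_pdivrMr ?mul1r ?lerDl// ltr_wpDl.
rewrite -lee_fin -nmE; last by apply: LpB => //; exact: com_Lp.
apply: le_trans (close k N ak) _.
by rewrite lee_fin mulrDr lerD2l.
Qed.

Lemma commutator_extends : exists bT : (plane R -> R[i]) -> plane R -> R[i],
  is_commutator p b T bT /\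
  forall f, Lp p f -> (Lpnorm p (bT f) <= W%:E * Lpnorm p f)%E.
Proof.
have ex f : exists F, Lp p f -> represents f F.
  have [lf|nlf] := pselect (Lp p f); last by exists f.
  by have [F hF] := represents_exists lf; exists F.
have [bT hT] := choice ex; exists bT; split; last first.
  move=> f lf; have rf := hT f lf; have [lF _] := rf.
  by rewrite !nmE// -EFinM lee_fin; exact: represents_bound.
split; first split.
- by move=> f lf; case: (hT f lf).
- move=> c f g lf lg; have lcfg : Lp p (fun x => c * f x + g x) by apply: LpD => //; exact: LpZ.
  apply: (represents_unique lcfg (hT _ lcfg)).
  by apply: represents_lin => //; exact: hT.
- move=> f lf l2f l2bf; apply: (represents_unique lf (hT f lf)).
  exact: represents_com.
Qed.

End extension.

Section bmo.
Context (R : realType).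

Lemma BMO_norm_ge0 (b : plane R -> R[i]) : (0 <= BMO_norm b)%E.
Proof.
apply: (@le_trans _ _ (mean_oscillation b (square (0, 0) 1))).
  rewrite /mean_oscillation mule_ge0 ?lee_fin ?invr_ge0 ?fine_ge0//.
  by apply: integral_ge0 => x _; rewrite lee_fin normc_ge0.
by apply: ereal_sup_ubound; exists ((0, 0), 1) => //=.
Qed.

Lemma BMO_real_bmo (b : plane R -> R[i]) c : BMO b ->
  real_bmo (fun x => part c (b x)) (fine (BMO_norm b)).
Proof.
move=> [[mb _] bfin]; split; first exact: cmeasurable_part.
move=> a l l0; exists (part c (average b (square a l))).
have bE : BMO_norm b = (fine (BMO_norm b))%:E.
  by rewrite fineK// ge0_fin_numE//; exact: BMO_norm_ge0.
have : (mean_oscillation b (square a l) <= BMO_norm b)%E.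
  by apply: ereal_sup_ubound; exists (a, l).
rewrite bE /mean_oscillation [fine (area R _)](_ : _ = l ^+ 2); last first.
  by rewrite [X in fine X](_ : _ = (l ^+ 2)%:E)//; apply: area_square; exact: ltW.
have l2 : 0 < l ^+ 2 by exact: exprn_gt0.
set I := (\int[_]_(x in _) _)%E => h.
apply: (@le_trans _ _ I).
  apply: integral_monotone => x _; rewrite lee_fin -partB; exact: part_normc.
rewrite muleC in h; move: h; rewrite lee_pdivrMr//.
Qed.

End bmo.

Theorem theorem1p4 (R : realType)
    (T : (plane R -> R[i]) -> plane R -> R[i])
    (K : plane R -> plane R -> R[i]) :
  L2_bounded T -> CZX_kernel K -> associated T K ->
  forall p : R, 1 < p ->
  exists C : R, 0 <= C /\
  forall b : plane R -> R[i], BMO b ->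
  exists bT : (plane R -> R[i]) -> plane R -> R[i],
    is_commutator p b T bT /\
    forall f : plane R -> R[i], Lp p f ->
      (Lpnorm p (bT f) <= C%:E * BMO_norm b * Lpnorm p f)%E.
Proof.
move=> Tb czx TK p p1; have p0 : 0 < p by exact: lt_trans p1.
pose q := (1 - p^-1)^-1.
have pV : 0 < 1 - p^-1 by rewrite subr_gt0 invf_lt1.
have pq : p^-1 + q^-1 = 1 by rewrite /q invrK addrC subrK.
have q1 : 1 < q by rewrite /q invf_gt1// gtrBl invr_gt0.
(* C is fixed before b is introduced, so it depends on T and p only. *)
have [C C0 hC] := complex_trilinear Tb TK czx p1 q1 pq.
exists C; split => // b Bb; have [[mb _] bfin] := Bb.
have bE : BMO_norm b = (fine (BMO_norm b))%:E.
  by rewrite fineK// ge0_fin_numE//; exact: BMO_norm_ge0.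
have beta0 : 0 <= fine (BMO_norm b) by apply: fine_ge0; exact: BMO_norm_ge0.
have W0 : 0 <= C * fine (BMO_norm b) by exact: mulr_ge0.
rewrite bE -EFinM; apply: commutator_extends => // f af.
apply: (commutator_bound Tb p1 q1 pq C0 beta0 mb _ af) => A0 L B f' g' L0.
by apply: hC => // c; exact: BMO_real_bmo.
Qed.
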